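(* Let $X$ and $Y$ be Banach spaces and let $\Omega$ be a compact Hausdorff space with Borel $\sigma$-algebra $\Sigma$. Let $1\le p\le\infty$. Assume that $m:\Sigma\to\mathcal{L}(X,Y^{**})$ is a vector measure of bounded $p'$-semivariation. Then the formula $$\int_\Omega(\varphi x)\,dm=\Big(\int_\Omega\varphi\,dm\Big)x$$ defines an integral on $\mathcal{C}_p(\Omega,X)$ with respect to $m$ (by linear and continuous extension from the functions $\varphi x$, $\varphi\in\mathcal{C}(\Omega)$, $x\in X$); the integration operator $U$, $Uf=\int_\Omega f\,dm$, belongs to $\mathcal{L}(\mathcal{C}_p(\Omega,X),Y^{**})$, $\|U\|=\|m\|_{p'}(\Omega)$, and $U^*y^*=I_{y^*}$ for all $y^*\in Y^*$. Moreover, if the integration operator $U$ takes its values in $Y$ (in particular, this is the case when the measure $m$ takes its values in $\mathcal{L}(X,Y)$), then $$U^{**}(\chi_E\otimes x)=m(E)x\quad\text{for all }E\in\Sigma\text{ and }x\in X,$$ where $\chi_E\otimes x\in\mathcal{C}_p(\Omega,X)^{**}$ is defined by $\langle A,\chi_E\otimes x\rangle=\langle A^*x,\chi_E\rangle$ for $A\in\mathcal{P}_{p'}(\mathcal{C}(\Omega),X^* )=\mathcal{C}_p(\Omega,X)^*$.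
   Context: Banach spaces are over the same field $\mathbb{K}$ ($\mathbb{R}$ or $\mathbb{C}$) and are regarded as subspaces of their biduals; $\mathcal{L}$ denotes bounded linear operators and $B_Z$ the closed unit ball of $Z$. $p'$ is the conjugate index of $p$ ($1/p+1/p'=1$, $1/\infty=0$). $\mathcal{C}(\Omega)$, $\mathcal{C}(\Omega,X)$ are the spaces of continuous scalar-, resp. $X$-valued functions. $\mathcal{B}(\Sigma)$ is the Banach space of uniform limits of sequences of $\Sigma$-simple scalar functions. $\mathcal{C}(\Omega)^*$ is identified with the regular countably additive scalar Borel measures; $\langle\mu,\chi_E\rangle=\mu(E)$ for $\mu\in\mathcal{C}(\Omega)^*$, i.e. $\mathcal{B}(\Sigma)\subset\mathcal{C}(\Omega)^{**}$. $\mathcal{C}_p(\Omega,X)$ consists of all $f\in\mathcal{C}(\Omega,X)$ for which there is $(x_n)\in\ell_p(X)$ (absolutely $p$-summable; $(x_n)\in c_0(X)$ if $p=\infty$) with $f(\Omega)\subset\{\sum_n\alpha_nx_n:(\alpha_n)\in B_{\ell_{p'}}\}$, with norm the infimum of $\|(x_n)\|_p$ over such sequences. It is a Banach space, $\mathcal{C}_\infty(\Omega,X)=\mathcal{C}(\Omega,X)$, and isometrically $\mathcal{C}_p(\Omega,X)=\mathcal{C}(\Omega)\hat{\otimes}_{d_p}X$ under $\varphi x\leftrightarrow\varphi\otimes x$, where $d_p$ is the right Chevet--Saphar tensor norm ($\|v\|_{d_p}=\inf\|(x_i)\|_p\sup_{z^*\in B_{Z^*}}\|(\langle z_i,z^*\rangle)_i\|_{\ell_{p'}}$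 over finite representations $v=\sum z_i\otimes x_i\in Z\otimes X$). Hence $\mathcal{C}_p(\Omega,X)^*=\mathcal{P}_{p'}(\mathcal{C}(\Omega),X^* )$ isometrically under $\langle\varphi x,T\rangle=\langle x,T\varphi\rangle$, where $\mathcal{P}_q$ is the ideal of absolutely $q$-summing operators with its norm ($\mathcal{P}_\infty=\mathcal{L}$; $\|T\|_{\mathcal{P}_q}=\infty$ if $T\notin\mathcal{P}_q$). A vector measure is a finitely additive set function; it is bounded if its range is bounded. For bounded $m$, $\int_\Omega\varphi\,dm$ is defined for $\varphi\in\mathcal{B}(\Sigma)$ by $\int_\Omega\chi_E\,dm=m(E)$, linearity, and density. For a bounded vector measure $m:\Sigma\to\mathcal{L}(X,Y^{**})$ and $y^*\in Y^*$, $m_{y^*}:\Sigma\to X^*$ is given by $\langle x,m_{y^*}(E)\rangle=\langle y^*,m(E)x\rangle$, and $I_{y^*}\in\mathcal{L}(\mathcal{C}(\Omega),X^* )$ is $I_{y^*}\varphi=\int_\Omega\varphi\,dm_{y^*}$. The $q$-semivariation of a bounded $m$ is $\|m\|_q(\Omega)=\sup_{y^*\in B_{Y^*}}\|I_{y^*}\|_{\mathcal{P}_q}$; $m$ is of bounded $q$-semivariation if $m$ is bounded and $\|m\|_q(\Omega)<\infty$. When $U$ takes its values in $Y$ it is regarded as an element of $\mathcal{L}(\mathcal{C}_p(\Omega,X),Y)$, so $U^{**}$ maps into $Y^{**}$.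
   Formalization: The formula U**(χ_E⊗x)=m(E)x is proved for those x for which ⟨y*,m(·)x⟩ is a regular countably additive Borel measure for every y*∈Y*; for merely finitely additive m it fails (an ultrafilter measure on the one-point compactification of ℕ). *)

(* Defs.v *)
From HB Require Import structures.
From mathcomp Require Import all_boot all_order all_algebra.
From mathcomp Require Import complex finmap.
From mathcomp Require Import all_classical all_reals all_analysis.
From mathcomp Require Import ess_sup_inf.
From mathcomp Require Import zify ring lra.

Set Implicit Arguments.
Unset Strict Implicit.
Unset Printing Implicit Defensive.

Import Order.TTheory GRing.Theory Num.Theory.
Import numFieldNormedType.Exports.

Local Open Scope classical_set_scope.
Local Open Scope ring_scope.

(* A normed module over K has a K-valued norm in the library. Real-valued norms,
   infima and suprema are read off through reK : K -> R and its section ofR. *)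
Variant scalar_kind := RealScalars | ComplexScalars.

Definition scalar_field (R : realType) (k : scalar_kind) : numFieldType :=
  match k with RealScalars => R | ComplexScalars => R[i] end.

Definition reK (R : realType) (k : scalar_kind) : scalar_field R k -> R :=
  match k with RealScalars => id | ComplexScalars => @complex.Re R end.

Definition ofR (R : realType) (k : scalar_kind) : R -> scalar_field R k :=
  match k with RealScalars => id | ComplexScalars => real_complex R end.

Section Scalars.
Variables (R : realType) (k : scalar_kind).
Implicit Types (r s : R) (a b : scalar_field R k).

Lemma ofRK r : reK (ofR k r) = r.
Proof. by case: k. Qed.

Lemma ofRD r s : ofR k (r + s) = ofR k r + ofR k s.
Proof. by case: k => //=; exact: rmorphD. Qed.

Lemma ofRM r s : ofR k (r * s) = ofR k r * ofR k s.
Proof. by case: k => //=; exact: rmorphM. Qed.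

Lemma ofR_le r s : (ofR k r <= ofR k s) = (r <= s).
Proof. by case: k => //=; rewrite lecR. Qed.

Lemma ofR_lt r s : (ofR k r < ofR k s) = (r < s).
Proof. by case: k => //=; rewrite ltcR. Qed.

Lemma ofR0 : ofR k (0 : R) = 0.
Proof. by case: k. Qed.

Lemma ofR1 : ofR k (1 : R) = 1.
Proof. by case: k. Qed.

Lemma ofRN r : ofR k (- r) = - ofR k r.
Proof. by case: k => //=; exact: rmorphN. Qed.

Lemma reKK a : a \is Num.real -> ofR k (reK a) = a.
Proof. by case: k a => //= a /RRe_real. Qed.

Lemma ofR_real r : ofR k r \is Num.real.
Proof. by rewrite realE -ofR0 !ofR_le -realE num_real. Qed.

Lemma norm_reK (V : normedZmodType (scalar_field R k)) (x : V) : ofR k (reK `|x|) = `|x|.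
Proof. by rewrite reKK// normr_real. Qed.

End Scalars.

Definition nrm (R : realType) (k : scalar_kind)
  (V : normedZmodType (scalar_field R k)) (x : V) : R := reK `|x|.

Section Nrm.
Variables (R : realType) (k : scalar_kind).
Notation K := (scalar_field R k).

Lemma ofR_nrm (V : normedZmodType K) (x : V) : ofR k (nrm x) = `|x|.
Proof. exact: norm_reK. Qed.

Lemma nrm_ge0 (V : normedZmodType K) (x : V) : 0 <= nrm x.
Proof. by rewrite -(ofR_le k) ofR0 ofR_nrm. Qed.

Lemma nrmD (V : normedZmodType K) (x y : V) : nrm (x + y) <= nrm x + nrm y.
Proof. by rewrite -(ofR_le k) ofRD !ofR_nrm ler_normD. Qed.

Lemma nrmZ (V : normedModType K) (a : K) (x : V) : nrm (a *: x) = nrm a * nrm x.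
Proof. by rewrite -[LHS](ofRK k) -[RHS](ofRK k) ofRM !ofR_nrm normrZ. Qed.

Lemma nrm0 (V : normedZmodType K) : nrm (0 : V) = 0.
Proof. by rewrite -[LHS](ofRK k) ofR_nrm normr0 -ofR0 ofRK. Qed.

Lemma nrm0_eq0 (V : normedZmodType K) (x : V) : nrm x = 0 -> x = 0.
Proof. by move=> x0; apply/eqP; rewrite -normr_eq0 -ofR_nrm x0 ofR0. Qed.

Lemma nrm_ofR (r : R) : nrm (ofR k r) = `|r|.
Proof.
rewrite /nrm; case: k => //=.
have /(congr1 (@complex.Re R))/= := normc_def (real_complex R r).
by rewrite expr0n addr0 sqrtr_sqr; exact.
Qed.

Lemma nrmM (a b : K) : nrm (a * b) = nrm a * nrm b.
Proof. by rewrite -[LHS](ofRK k) -[RHS](ofRK k) ofRM !ofR_nrm normrM. Qed.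

Lemma nrmN (V : normedZmodType K) (x : V) : nrm (- x) = nrm x.
Proof. by rewrite /nrm normrN. Qed.

Lemma nrm1 : nrm (1 : K) = 1.
Proof. by rewrite -(ofR1 R) nrm_ofR normr1. Qed.

Lemma nrmV (a : K) : nrm a^-1 = (nrm a)^-1.
Proof.
have [->|a0] := eqVneq a 0; first by rewrite invr0 nrm0 invr0.
have na : nrm a != 0 by apply: contra_neq a0 => /nrm0_eq0.
by apply: (mulfI na); rewrite -nrmM !divff// nrm1.
Qed.

End Nrm.

Section BoundedOperators.
Variables (R : realType) (k : scalar_kind).
Notation K := (scalar_field R k).
Variables V W : normedModType K.

Definition bop_pred : {pred V -> W} :=
  [pred f | `[< linear f /\ continuous f >]].

Record bop := Bop { bop_val :> V -> W; bop_valP : bop_val \in bop_pred }.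

HB.instance Definition _ := [isSub for bop_val].
HB.instance Definition _ := [Choice of bop by <:].

Lemma bop_submod_closed : submod_closed bop_pred.
Proof.
split.
  apply/asboolP; split; last by move=> x; exact: cst_continuous.
  by move=> a x y /=; rewrite scaler0 addr0.
move=> a f g /asboolP[lf cf] /asboolP[lg cg].
apply/asboolP; split.
  move=> b x y; rewrite !fctE lf lg !scalerDr !scalerA mulrC -!addrA.
  by congr (_ + _); rewrite addrCA.
move=> x.
apply: (@continuousD _ _ _ (fun x => a *: f x) g) => //; last exact: cg.
by apply: continuousZl_tmp; exact: cf.
Qed.

HB.instance Definition _ := GRing.isSubmodClosed.Build _ _ bop_pred
  bop_submod_closed.
HB.instance Definition _ := [SubChoice_isSubLmodule of bop by <:].

End BoundedOperators.

Section BoundedOperatorsTheory.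
Variables (R : realType) (k : scalar_kind).
Notation K := (scalar_field R k).
Variables V W : normedModType K.
Implicit Types f g : bop V W.

Lemma bop_linear f : linear f.
Proof. by have /asboolP[] := bop_valP f. Qed.

Lemma bop_continuous f : continuous f.
Proof. by have /asboolP[] := bop_valP f. Qed.

HB.instance Definition _ f :=
  GRing.isLinear.Build K V W *:%R (bop_val f) (bop_linear f).

Lemma bopP f g : f =1 g -> f = g.
Proof. by move=> fg; apply/val_inj/funext. Qed.

Lemma bop_bounded f :
  exists2 M : R, 0 <= M & forall x, nrm (f x) <= M * nrm x.
Proof.
have : bounded_near f (nbhs (0 : V)).
  by apply/linear_bounded_continuous; exact: bop_continuous.
move=> /linear_boundedP/pinfty_ex_gt0[a a0 fa].
exists (reK a).
  by rewrite -(ofR_le k) ofR0 reKK ?ltW// gtr0_real.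
move=> x; rewrite -(ofR_le k) ofRM !ofR_nrm reKK ?gtr0_real//.
exact: fa.
Qed.

Lemma linear_bounded_bop (f : V -> W) (M : R) : linear f ->
  (forall x, nrm (f x) <= M * nrm x) -> f \in @bop_pred R k V W.
Proof.
move=> lf fM; apply/asboolP; split => //.
pose F := GRing.isLinear.Build K V W *:%R f lf.
pose f' : {linear V -> W} := HB.pack f F.
apply: (@bounded_linear_continuous K V W f').
apply/linear_boundedP; near=> a => x /=.
rewrite -!ofR_nrm.
apply: (@le_trans _ _ (ofR k M * ofR k (nrm x))).
  by rewrite -ofRM ofR_le.
apply: ler_wpM2r; first by rewrite ofR_nrm.
near: a; apply: nbhs_pinfty_ge.
exact: ofR_real.
Unshelve. all: by end_near. Qed.

Definition opnorm f : R :=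
  sup [set nrm (f x) | x in [set x : V | nrm x <= 1]].

Lemma opnorm_has_sup f :
  has_sup [set nrm (f x) | x in [set x : V | nrm x <= 1]].
Proof.
split; first by exists (nrm (f 0)), 0 => //=; rewrite nrm0 ler01.
have [M M0 fM] := bop_bounded f; exists M => _ [x /= x1 <-].
by rewrite (le_trans (fM x))// ler_piMr.
Qed.

Lemma opnorm_ge0 f : 0 <= opnorm f.
Proof.
apply: (@le_trans _ _ (nrm (f 0))); first exact: nrm_ge0.
apply: (sup_upper_bound (opnorm_has_sup f)).
by exists 0 => //=; rewrite nrm0 ler01.
Qed.

Lemma opnorm_bound f x : nrm (f x) <= opnorm f * nrm x.
Proof.
have [x0|x0] := eqVneq (nrm x) 0.
  by rewrite x0 mulr0 (nrm0_eq0 x0) linear0 nrm0.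
have xp : 0 < nrm x by rewrite lt_def x0 nrm_ge0.
rewrite -ler_pdivrMr//.
apply: (sup_upper_bound (opnorm_has_sup f)).
exists (ofR k (nrm x)^-1 *: x).
  by rewrite /= nrmZ nrm_ofR ger0_norm ?invr_ge0 ?nrm_ge0// mulVf.
by rewrite linearZ/= nrmZ nrm_ofR ger0_norm ?invr_ge0 ?nrm_ge0// mulrC.
Qed.

Lemma opnorm_le f (M : R) : 0 <= M ->
  (forall x, nrm (f x) <= M * nrm x) -> opnorm f <= M.
Proof.
move=> M0 fM; apply: ge_sup; first by case: (opnorm_has_sup f).
by move=> _ [x /= x1 <-]; rewrite (le_trans (fM x))// ler_piMr.
Qed.

Lemma opnormD f g : opnorm (f + g) <= opnorm f + opnorm g.
Proof.
apply: opnorm_le; first by rewrite addr_ge0 ?opnorm_ge0.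
move=> x /=; rewrite (le_trans (nrmD _ _))// mulrDl lerD// opnorm_bound//.
Qed.

Lemma opnormZ a f : opnorm (a *: f) = nrm a * opnorm f.
Proof.
have le b h : opnorm (b *: h) <= nrm b * opnorm h.
  apply: opnorm_le; first by rewrite mulr_ge0 ?nrm_ge0 ?opnorm_ge0.
  by move=> x /=; rewrite nrmZ -mulrA ler_wpM2l ?nrm_ge0 ?opnorm_bound.
apply/eqP; rewrite eq_le le /=.
have [->|a0] := eqVneq a 0; first by rewrite nrm0 mul0r opnorm_ge0.
have na : 0 < nrm a.
  rewrite lt_def nrm_ge0 andbT; apply/eqP => /nrm0_eq0/eqP.
  by rewrite (negbTE a0).
rewrite -ler_pdivlMl// -{1}[f](scalerK a0) (le_trans (le _ _))//.
by rewrite nrmV.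
Qed.

Lemma opnorm0_eq0 f : opnorm f = 0 -> f = 0.
Proof.
move=> f0; apply: bopP => x; apply: nrm0_eq0; apply/eqP.
by rewrite eq_le nrm_ge0 andbT (le_trans (opnorm_bound _ _))// f0 mul0r.
Qed.

Let bopnormD f g :
  ofR k (opnorm (f + g)) <= ofR k (opnorm f) + ofR k (opnorm g).
Proof. by rewrite -ofRD ofR_le opnormD. Qed.

Let bopnormZ (a : K) f : ofR k (opnorm (a *: f)) = `|a| * ofR k (opnorm f).
Proof. by rewrite opnormZ ofRM ofR_nrm. Qed.

Let bopnorm0_eq0 f : ofR k (opnorm f) = 0 -> f = 0.
Proof.
by move=> f0; apply: opnorm0_eq0; rewrite -[LHS](ofRK k) f0 -(ofR0 R) ofRK.
Qed.

HB.instance Definition _ := Lmodule_isNormed.Build K (bop V W)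
  bopnormD bopnormZ bopnorm0_eq0.

Lemma nrm_bop f : nrm f = opnorm f.
Proof. exact: ofRK. Qed.

End BoundedOperatorsTheory.

Definition dual (R : realType) (k : scalar_kind)
  (V : normedModType (scalar_field R k)) := bop V (scalar_field R k).

Notation bidual V := (dual (dual V)).

Section Composition.
Variables (R : realType) (k : scalar_kind).
Notation K := (scalar_field R k).
Variables V W Z : normedModType K.

Lemma bcomp_subproof (g : bop W Z) (f : bop V W) :
  (fun v => g (f v)) \in @bop_pred R k V Z.
Proof.
apply: (@linear_bounded_bop _ _ _ _ _ (opnorm g * opnorm f)).
  by move=> a x y /=; rewrite linearP linearP.
move=> x; rewrite (le_trans (opnorm_bound _ _))// -mulrA.
by rewrite ler_wpM2l ?opnorm_ge0 ?opnorm_bound.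
Qed.

Definition bcomp (g : bop W Z) (f : bop V W) : bop V Z :=
  Bop (bcomp_subproof g f).

Lemma beval_subproof (v : V) : (fun f : bop V W => f v) \in
  @bop_pred R k (bop V W) W.
Proof.
apply: (@linear_bounded_bop _ _ _ _ _ (nrm v)); first by [].
by move=> f; rewrite nrm_bop mulrC opnorm_bound.
Qed.

Definition beval (v : V) : bop (bop V W) W := Bop (beval_subproof v).

End Composition.

Section Adjoint.
Variables (R : realType) (k : scalar_kind).
Notation K := (scalar_field R k).
Variables V W : normedModType K.

Lemma adjoint_subproof (U : bop V W) :
  (fun l : dual W => bcomp l U : dual V) \in @bop_pred R k (dual W) (dual V).
Proof.
apply: (@linear_bounded_bop _ _ _ _ _ (opnorm U)).
  by move=> a f g; apply: bopP.
move=> f; rewrite !nrm_bop; apply: opnorm_le.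
  by rewrite mulr_ge0 ?opnorm_ge0.
move=> v; rewrite (le_trans (opnorm_bound f (U v)))// [opnorm U * _]mulrC.
by rewrite -mulrA ler_wpM2l ?opnorm_ge0//; exact: opnorm_bound.
Qed.

Definition adjoint (U : bop V W) : bop (dual W) (dual V) :=
  Bop (adjoint_subproof U).

(* The second adjoint, as a map on arbitrary functionals on V^*; on bidual V it
   is adjoint (adjoint U). *)
Definition biadjoint (U : bop V W) (Phi : dual V -> K) : dual W -> K :=
  Phi \o adjoint U.

Definition to_bidual (v : V) : bidual V := @beval R k V K v.

End Adjoint.

Section ContinuousFunctions.
Variables (R : realType) (k : scalar_kind).
Notation K := (scalar_field R k).
Variables (Omega : topologicalType) (Ocpt : compact [set: Omega]).

Lemma nrm_continuous (V : normedModType K) : continuous (@nrm R k V).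
Proof.
move=> x; apply/cvgrPdist_lt => e e0.
have e0' : 0 < ofR k e by rewrite -(ofR0 R) ofR_lt.
have : \forall y \near x, `|x - y| < ofR k e by exact: cvgr_dist_lt.
apply: filterS => y; rewrite -ofR_nrm ofR_lt; apply: le_lt_trans.
rewrite ler_norml; apply/andP; split.
  have -> : nrm (x - y) = nrm (y - x) by rewrite -nrmN opprB.
  by rewrite lerNl opprB lerBlDr (le_trans _ (nrmD _ _))// subrK.
by rewrite lerBlDr (le_trans _ (nrmD _ _))// subrK.
Qed.

Definition cfun_pred : {pred Omega -> K} := [pred f | `[< continuous f >]].

(* The compactness proof only serves to equip the type with the sup norm. *)
Record cfun_of (c : compact [set: Omega]) :=
  Cfun { cfun_val :> Omega -> K; cfun_valP : cfun_val \in cfun_pred }.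

Notation cfun := (cfun_of Ocpt).

HB.instance Definition _ := [isSub for @cfun_val Ocpt].
HB.instance Definition _ := [Choice of cfun by <:].

Lemma cfun_submod_closed : submod_closed cfun_pred.
Proof.
split; first by apply/asboolP => x; exact: cst_continuous.
move=> a f g /asboolP cf /asboolP cg; apply/asboolP => x.
apply: (@continuousD _ _ _ (fun x => a *: f x) g) => //; last exact: cg.
by apply: continuousZl_tmp; exact: cf.
Qed.

HB.instance Definition _ := GRing.isSubmodClosed.Build _ _ cfun_pred
  cfun_submod_closed.
HB.instance Definition _ := [SubChoice_isSubLmodule of cfun by <:].

Implicit Types f g : cfun.

Lemma cfunP f g : f =1 g -> f = g.
Proof. by move=> fg; apply/val_inj/funext. Qed.

Lemma cfun_continuous f : continuous f.
Proof. by have /asboolP := cfun_valP f. Qed.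

Definition supnorm f : R := sup [set nrm (f w) | w in [set: Omega]].

Lemma supnorm_has_ubound f : has_ubound [set nrm (f w) | w in [set: Omega]].
Proof.
have /compact_bounded : compact [set nrm (f w) | w in [set: Omega]].
  apply: (@continuous_compact _ _ (fun w => nrm (f w))) => //.
  apply: continuous_subspaceT => w.
  apply: (@continuous_comp _ _ _ (f : Omega -> K) (@nrm R k K)).
    exact: cfun_continuous.
  exact: nrm_continuous.
move=> [M [_ /(_ (M + 1))]]; rewrite ltrDl ltr01 => /(_ isT) fM.
by exists (M + 1) => _ [w _ <-]; rewrite (le_trans (ler_norm _))// fM//; exists w.
Qed.

Lemma supnorm_ge f w : nrm (f w) <= supnorm f.
Proof.
apply: sup_upper_bound; last by exists w.
by split; [exists (nrm (f w)), w|exact: supnorm_has_ubound].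
Qed.

Lemma supnorm_le f (M : R) : 0 <= M -> (forall w, nrm (f w) <= M) ->
  supnorm f <= M.
Proof.
move=> M0 fM; rewrite /supnorm; set A := [set _ | _ in _].
have [->|A0] := eqVneq A set0; first by rewrite sup0.
by apply: ge_sup; [exact/set0P|move=> _ [w _ <-]].
Qed.

Lemma supnorm_ge0 f : 0 <= supnorm f.
Proof.
rewrite /supnorm; set A := [set _ | _ in _].
have [->|/set0P[_ [w _ _]]] := eqVneq A set0; first by rewrite sup0.
by rewrite (le_trans _ (supnorm_ge f w))// nrm_ge0.
Qed.

Lemma supnormD f g : supnorm (f + g) <= supnorm f + supnorm g.
Proof.
apply: supnorm_le => [|w]; first by rewrite addr_ge0 ?supnorm_ge0.
by rewrite (le_trans (nrmD _ _))// lerD// supnorm_ge.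
Qed.

Lemma supnormZ (a : K) f : supnorm (a *: f) = nrm a * supnorm f.
Proof.
have le b (h : cfun) : supnorm (b *: h) <= nrm b * supnorm h.
  apply: supnorm_le => [|w]; first by rewrite mulr_ge0 ?nrm_ge0 ?supnorm_ge0.
  by rewrite nrmM ler_wpM2l ?nrm_ge0 ?supnorm_ge.
apply/eqP; rewrite eq_le le /=.
have [->|a0] := eqVneq a 0; first by rewrite nrm0 mul0r supnorm_ge0.
have na : 0 < nrm a.
  rewrite lt_def nrm_ge0 andbT; apply/eqP => /nrm0_eq0/eqP.
  by rewrite (negbTE a0).
rewrite -ler_pdivlMl// -{1}[f](scalerK a0) (le_trans (le _ _))//.
by rewrite nrmV.
Qed.

Lemma supnorm0_eq0 f : supnorm f = 0 -> f = 0.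
Proof.
move=> f0; apply: cfunP => w; apply: nrm0_eq0; apply/eqP.
by rewrite eq_le nrm_ge0 andbT -f0 supnorm_ge.
Qed.

Let cnormD f g :
  ofR k (supnorm (f + g)) <= ofR k (supnorm f) + ofR k (supnorm g).
Proof. by rewrite -ofRD ofR_le supnormD. Qed.

Let cnormZ (a : K) f : ofR k (supnorm (a *: f)) = `|a| * ofR k (supnorm f).
Proof. by rewrite supnormZ ofRM ofR_nrm. Qed.

Let cnorm0_eq0 f : ofR k (supnorm f) = 0 -> f = 0.
Proof.
by move=> f0; apply: supnorm0_eq0; rewrite -[LHS](ofRK k) f0 -(ofR0 R) ofRK.
Qed.

HB.instance Definition _ := Lmodule_isNormed.Build K cfun
  cnormD cnormZ cnorm0_eq0.

Lemma nrm_cfun f : nrm f = supnorm f.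
Proof. exact: ofRK. Qed.

End ContinuousFunctions.

Definition lp_norm (R : realType) (k : scalar_kind)
    (V : normedModType (scalar_field R k)) (p : \bar R) (x : nat -> V) : \bar R :=
  ('N[@counting nat R]_p[(fun n => (nrm (x n))%:E)])%E.

Section LpNorm.
Variables (R : realType) (k : scalar_kind).
Notation K := (scalar_field R k).
Variable V : normedModType K.
Implicit Types (x y : nat -> V) (r C : R) (p : \bar R).

Lemma lp_norm_ge0 p x : (0 <= lp_norm p x)%E.
Proof. exact: Lnorm_ge0. Qed.

Lemma lp_fin_le r x C : 0 < r -> 0 <= C ->
  ((lp_norm r%:E x <= C%:E)%E <->
   forall m, \sum_(0 <= i < m) nrm (x i) `^ r <= C `^ r).
Proof.
move=> r0 C0; rewrite /lp_norm Lnorm_counting//.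
set S := (X in ((X `^ _)%E <= _)%E).
have S0 : (0 <= S)%E by apply: nneseries_ge0 => n _ _; exact: poweR_ge0.
have SE : (S `^ r^-1 <= C%:E)%E <-> (S <= (C `^ r)%:E)%E.
  have r0' : 0 <= r^-1 by rewrite invr_ge0 ltW.
  split=> SC.
    have := gt0_ler_poweR (ltW r0).
    move=> /(_ (S `^ r^-1)%E C%:E); rewrite -poweRrM mulVf ?gt_eqF// poweRe1//.
    by apply => //; rewrite in_itv/= ?poweR_ge0 ?leey// lee_fin C0.
  have := gt0_ler_poweR r0'.
  move=> /(_ S (C `^ r)%:E); rewrite poweR_EFin -powRrM mulfV ?gt_eqF// powRr1//.
  by apply => //; rewrite in_itv/= ?S0 ?leey// lee_fin powR_ge0.
rewrite SE; split=> [SC m|SC].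
  rewrite -lee_fin -sumEFin (le_trans _ SC)//.
  apply: le_trans (nneseries_lim_ge m _); last by move=> *; exact: poweR_ge0.
  apply: lee_sum => i _.
  by rewrite /= ger0_norm ?nrm_ge0.
apply: lime_le.
  by apply: is_cvg_nneseries => n _ _; exact: poweR_ge0.
apply: nearW => m; 
  rewrite (le_trans _ (_ : (\sum_(0 <= i < m) nrm (x i) `^ r)%:E <= _)%E)//.
  rewrite -sumEFin; apply: lee_sum => i _ /=.
  by rewrite ger0_norm ?nrm_ge0.
by rewrite lee_fin.
Qed.

Lemma lp_oo_le x C : ((lp_norm +oo x <= C%:E)%E <-> forall i, nrm (x i) <= C).
Proof.
rewrite /lp_norm unlock /= ifT; last first.
  by rewrite /counting asboolF ?ltry//; exact: infinite_nat.
split=> [/ess_supP[A [mA A0 sA]] i|xC].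
  rewrite -lee_fin; apply: contrapT => Ci.
  have Ai : A i.
    by apply: sA => /= h; apply: Ci; move: h; rewrite ger0_norm ?nrm_ge0.
  have : (@counting nat R [set i] <= counting A)%E.
    by apply: (@le_measure _ _ _ (@counting nat R)); try (by move=> _ ->); exact: mem_set.
  rewrite A0 /counting asboolT; last exact: finite_set1.
  by rewrite fset_set1 cardfs1 lee_fin ler10.
apply/ess_supP; apply: nearW => i /=.
by rewrite ger0_norm ?nrm_ge0// lee_fin.
Qed.

Lemma lp_normZ p a x C : (1 <= p)%E -> 0 <= C ->
  (lp_norm p x <= C%:E)%E -> (lp_norm p (fun n => a *: x n) <= (nrm a * C)%:E)%E.
Proof.
move=> p1 C0; case: p p1 => [r|_|//].
  rewrite lee_fin => r1; have r0 : 0 < r by rewrite (lt_le_trans _ r1).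
  move=> /(lp_fin_le x r0 C0) xC; apply/lp_fin_le => // [|m].
    by rewrite mulr_ge0 ?nrm_ge0.
  rewrite powRM ?nrm_ge0// (le_trans _ (ler_wpM2l _ (xC m))) ?powR_ge0//.
  rewrite mulr_sumr; apply: ler_sum => i _.
  by rewrite nrmZ powRM ?nrm_ge0.
move=> /lp_oo_le xC; apply/lp_oo_le => i.
by rewrite nrmZ ler_wpM2l ?nrm_ge0.
Qed.

Definition single (v : V) (n : nat) : V := if n is 0%N then v else 0.

Lemma lp_norm_single p v : (1 <= p)%E -> (lp_norm p (single v) <= (nrm v)%:E)%E.
Proof.
case: p => [r|_|//].
  rewrite lee_fin => r1; have r0 : 0 < r by rewrite (lt_le_trans _ r1).
  apply/lp_fin_le => //; first exact: nrm_ge0.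
  case=> [|m]; first by rewrite big_geq// powR_ge0.
  rewrite big_nat_recl// big1 ?addr0//= => i _.
  by rewrite nrm0 powR0 ?gt_eqF.
by apply/lp_oo_le => -[|i] //=; rewrite nrm0 nrm_ge0.
Qed.

Definition interleave (T : Type) (x y : nat -> T) (n : nat) : T :=
  if odd n then y n./2 else x n./2.

Lemma sum_interleave (F : nat -> V -> R) x y m :
  \sum_(0 <= i < m.*2) F i (interleave x y i) =
  \sum_(0 <= i < m) F i.*2 (x i) + \sum_(0 <= i < m) F i.*2.+1 (y i).
Proof.
elim: m => [|m ih]; first by rewrite !big_geq// addr0.
rewrite doubleS !big_nat_recr//= ih /interleave /= odd_double /= uphalf_double.
by rewrite doubleK addrACA addrA.
Qed.

Lemma lp_interleave r x y A B C : 0 < r -> 0 <= A -> 0 <= B -> 0 <= C ->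
  A `^ r + B `^ r <= C `^ r ->
  (lp_norm r%:E x <= A%:E)%E -> (lp_norm r%:E y <= B%:E)%E ->
  (lp_norm r%:E (interleave x y) <= C%:E)%E.
Proof.
move=> r0 A0 B0 C0 ABC /(lp_fin_le x r0 A0) xA /(lp_fin_le y r0 B0) yB.
apply/lp_fin_le => // m; apply: le_trans ABC.
apply: (@le_trans _ _ (\sum_(0 <= i < m.*2) nrm (interleave x y i) `^ r)).
  rewrite (@big_cat_nat _ _ _ m 0 m.*2)//=; last by rewrite -addnn leq_addr.
  by rewrite lerDl sumr_ge0// => i _; rewrite powR_ge0.
by rewrite (sum_interleave (fun _ v => nrm v `^ r)) lerD.
Qed.

End LpNorm.

Lemma hoelder_cases (R : realType) (p : \bar R) : (1 <= p)%E ->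
  [\/ p = 1%E /\ hoelder_conjugate p = +oo%E,
      p = +oo%E /\ hoelder_conjugate p = 1%E |
      exists r s : R, [/\ p = r%:E, hoelder_conjugate p = s%:E, 1 < r, 1 < s &
        r^-1 + s^-1 = 1]].
Proof.
case: p => [r|_|//]; last by apply: Or32; rewrite hoelder_conjugatey.
rewrite lee_fin le_eqVlt => /predU1P[<-|r1].
  by apply: Or31; rewrite hoelder_conjugate1.
apply: Or33; exists r, (r / (r - 1)).
have r0 : 0 < r by rewrite (lt_trans _ r1).
have r10 : 0 < r - 1 by rewrite subr_gt0.
split => //.
- rewrite /hoelder_conjugate/= gt_eqF ?lte_fin// inver subr_eq0 gt_eqF//.
- by rewrite ltr_pdivlMr// mul1r ltrBlDl ltrDr.
- by rewrite invf_div; field; rewrite gt_eqF.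
Qed.

Section LpNormTheory.
Variables (R : realType) (k : scalar_kind).
Notation K := (scalar_field R k).
Variable V : normedModType K.
Implicit Types (x y : nat -> V) (a b : nat -> K) (A B C : R) (p : \bar R).

Lemma lp_hoelder p a x C : (1 <= p)%E -> 0 < C -> (lp_norm p x <= C%:E)%E ->
  (lp_norm (hoelder_conjugate p) a <= 1)%E ->
  forall m, nrm (\sum_(0 <= i < m) a i *: x i) <= C.
Proof.
move=> p1 C0 xC a1 m.
apply: (@le_trans _ _ (\sum_(0 <= i < m) nrm (a i) * nrm (x i))).
  elim: m => [|m ih]; first by rewrite !big_geq// nrm0.
  by rewrite !big_nat_recr//= (le_trans (nrmD _ _))// lerD// nrmZ.
have [[pE qE]|[pE qE]|[r [s [pE qE r1 s1 rs]]]] := hoelder_cases p1;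
    rewrite pE in xC; rewrite qE in a1.
- move/lp_fin_le : xC => /(_ ltr01 (ltW C0) m); rewrite (powRr1 (ltW C0)).
  move=> xC; apply: le_trans xC; apply: ler_sum => i _.
  rewrite powRr1 ?nrm_ge0// ler_piMl ?nrm_ge0//.
  by move/lp_oo_le : a1; exact.
- move/lp_fin_le : a1 => /(_ ltr01 ler01 m); rewrite powRr1//.
  under eq_bigr do rewrite powRr1 ?nrm_ge0//.
  move=> a1; apply: (@le_trans _ _ (\sum_(0 <= i < m) nrm (a i) * C)).
    apply: ler_sum => i _; rewrite ler_wpM2l ?nrm_ge0//.
    by move/lp_oo_le : xC; exact.
  by rewrite -mulr_suml ler_piMl// ltW.
- have r0 : 0 < r by rewrite (lt_trans _ r1).
  have s0 : 0 < s by rewrite (lt_trans _ s1).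
  move/lp_fin_le : xC => /(_ r0 (ltW C0) m) xC.
  move/lp_fin_le : a1 => /(_ s0 ler01 m); rewrite powR1 => a1.
  apply: (@le_trans _ _ (\sum_(0 <= i < m)
      C * ((nrm (x i) / C) `^ r / r + nrm (a i) `^ s / s))).
    apply: ler_sum => i _.
    have -> : nrm (a i) * nrm (x i) = C * ((nrm (x i) / C) * nrm (a i)).
      by field; rewrite gt_eqF.
    rewrite (ler_wpM2l (ltW C0))// conjugate_powR ?nrm_ge0//.
    by rewrite divr_ge0 ?nrm_ge0// ltW.
  rewrite -mulr_sumr (ler_piMr (ltW C0))// -rs big_split /= -!mulr_suml.
  rewrite lerD//; last by rewrite ler_piMl// invr_ge0 ltW.
  rewrite ler_piMl ?invr_ge0 ?(ltW r0)//.
  under eq_bigr do rewrite powRM ?nrm_ge0 ?invr_ge0 ?(ltW C0)//.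
  rewrite -mulr_suml.
  have Cr : 0 < C `^ r by rewrite powR_gt0.
  have -> : C^-1 `^ r = (C `^ r)^-1.
    by rewrite -(powR_inv1 (ltW C0)) -powRrM mulN1r powRN.
  by rewrite ler_pdivrMr// mul1r.
Qed.

Lemma lp_split p A B : (1 <= p)%E -> 0 < A -> 0 < B ->
  exists c d : R, [/\ 0 < c, 0 < d,
    forall x y, (lp_norm p x <= A%:E)%E -> (lp_norm p y <= B%:E)%E ->
      (lp_norm p (interleave (fun n => ofR k c^-1 *: x n)%R
                             (fun n => ofR k d^-1 *: y n)%R) <= (A + B)%R%:E)%E &
    forall a b, (lp_norm (hoelder_conjugate p) a <= 1)%E ->
      (lp_norm (hoelder_conjugate p) b <= 1)%E ->
      (lp_norm (hoelder_conjugate p)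
        (interleave (fun n => ofR k c * a n)%R (fun n => ofR k d * b n)%R) <= 1)%E].
Proof.
move=> p1 A0 B0.
have AB : 0 < A + B by rewrite addr_gt0.
have [A0' B0' AB'] : [/\ 0 <= A, 0 <= B & 0 <= A + B] by rewrite !ltW.
have l01 : 0 < 1 :> R by []. have l01' : 0 <= 1 :> R by [].
have q1 : (1 <= hoelder_conjugate p)%E by exact: hoelder_conj_ge1.
have nr (c : R) : 0 < c -> nrm (ofR k c) = c by move=> c0; rewrite nrm_ofR gtr0_norm.
have [[pE qE]|[pE qE]|[r [s [pE qE r1 s1 rs]]]] := hoelder_cases p1;
    rewrite pE in p1 *; rewrite pE in qE; rewrite qE.
- exists 1, 1; split => //.
    move=> x y xA yB; apply: (@lp_interleave _ _ _ 1 _ _ A B) => //.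
      by rewrite !powRr1.
    have := lp_normZ (ofR k 1^-1) p1 A0' xA.
      by rewrite invr1 nr// mul1r.
    have := lp_normZ (ofR k 1^-1) p1 B0' yB.
    by rewrite invr1 nr// mul1r.
  move=> a b /lp_oo_le a1 /lp_oo_le b1; apply/lp_oo_le => i.
  by rewrite /interleave; case: ifP => _; rewrite nrmM nr// mul1r.
- exists (A / (A + B)), (B / (A + B)).
  have c0 : 0 < A / (A + B) by rewrite divr_gt0.
  have d0 : 0 < B / (A + B) by rewrite divr_gt0.
  have [c0' d0'] := (ltW c0, ltW d0).
  split=> //.
    move=> x y /lp_oo_le xA /lp_oo_le yB; apply/lp_oo_le => i.
    rewrite /interleave; case: ifP => _; rewrite nrmZ nr ?invr_gt0// invf_div.
      by rewrite mulrAC ler_pdivrMr// ler_wpM2l.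
    by rewrite mulrAC ler_pdivrMr// ler_wpM2l.
  move=> a b a1 b1; have q1' : (1 <= 1 :> \bar R)%E by [].
  apply: (@lp_interleave _ _ _ 1 _ _ (A / (A + B)) (B / (A + B)) 1) => //.
  + by rewrite !powRr1// -mulrDl divff// gt_eqF.
  + by have := lp_normZ (ofR k (A / (A + B))) q1' l01' a1; rewrite nr// mulr1.
  + by have := lp_normZ (ofR k (B / (A + B))) q1' l01' b1; rewrite nr// mulr1.
- have r0 : 0 < r by rewrite (lt_trans _ r1).
  have s0 : 0 < s by rewrite (lt_trans _ s1).
  have tt (T : R) : 0 < T -> 0 < (T / (A + B)) `^ s^-1.
    by move=> T0; rewrite powR_gt0 ?divr_gt0.
  have ts (T : R) : 0 < T -> ((T / (A + B)) `^ s^-1) `^ s = T / (A + B).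
    by move=> T0; rewrite -powRrM mulVf ?gt_eqF// powRr1// divr_ge0// ltW.
  have tr (T : R) : 0 < T ->
      (((T / (A + B)) `^ s^-1)^-1 * T) `^ r = T * (A + B) `^ (r - 1).
    move=> T0; rewrite [LHS]powRM ?invr_ge0 ?powR_ge0 ?(ltW T0)//.
    rewrite -[X in X `^ r * _]powR_inv1 ?powR_ge0// -!powRrM ?mulrA.
    have -> : s^-1 * -1 * r = - (r - 1).
      have -> : s^-1 = 1 - r^-1 by rewrite -rs addrC addKr.
      by field; rewrite gt_eqF.
    rewrite powRN powRM ?invr_ge0 ?(ltW T0)//.
    have -> : (A + B)^-1 `^ (r - 1) = ((A + B) `^ (r - 1))^-1.
      by rewrite -(powR_inv1 AB') -powRrM mulN1r powRN.
    have Tr : 0 < T `^ (r - 1) by rewrite powR_gt0.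
    have Sr : 0 < (A + B) `^ (r - 1) by rewrite powR_gt0.
    rewrite -[in T `^ r](mulr_powRB1 (ltW T0) r0).
    by field; rewrite !gt_eqF.
  exists ((A / (A + B)) `^ s^-1), ((B / (A + B)) `^ s^-1).
  split; [exact: tt|exact: tt| |].
    move=> x y xA yB.
    apply: (@lp_interleave _ _ _ r _ _ (((A / (A + B)) `^ s^-1)^-1 * A)
      (((B / (A + B)) `^ s^-1)^-1 * B)) => //.
    + by rewrite mulr_ge0// invr_ge0 ltW// tt.
    + by rewrite mulr_ge0// invr_ge0 ltW// tt.
    + by rewrite !tr// -mulrDl mulr_powRB1.
    + by have := lp_normZ (ofR k ((A / (A + B)) `^ s^-1)^-1) p1 A0' xA; rewrite nr// invr_gt0 tt.
    + by have := lp_normZ (ofR k ((B / (A + B)) `^ s^-1)^-1) p1 B0' yB; rewrite nr// invr_gt0 tt.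
  move=> a b a1 b1; rewrite pE qE in q1.
  apply: (@lp_interleave _ _ _ s _ _ ((A / (A + B)) `^ s^-1)
      ((B / (A + B)) `^ s^-1)) => //.
  + by rewrite ltW// tt.
  + by rewrite ltW// tt.
  + by rewrite !ts// powR1 -mulrDl divff// gt_eqF.
  + by have := lp_normZ (ofR k ((A / (A + B)) `^ s^-1)) q1 l01' a1; rewrite nr ?tt// mulr1.
  + by have := lp_normZ (ofR k ((B / (A + B)) `^ s^-1)) q1 l01' b1; rewrite nr ?tt// mulr1.
Qed.

Lemma series_interleave x y (u v : V) :
  series x @ \oo --> u -> series y @ \oo --> v ->
  series (interleave x y) @ \oo --> u + v.
Proof.
move=> xu yv.
have -> : series (interleave x y) =
    (fun n => series x (uphalf n) + series y n./2).
  apply/funext => n; elim: n => [|n ih].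
    by rewrite /series /= !big_geq// addr0.
  rewrite seriesSr ih /interleave.
  have -> : uphalf n.+1 = n./2.+1 by [].
  have -> : n.+1./2 = uphalf n by [].
  rewrite uphalf_half; case: (odd n); rewrite ?add1n ?add0n.
    by rewrite [series y n./2.+1]seriesSr addrA.
  by rewrite [series x n./2.+1]seriesSr addrAC.
have hoo : (fun n => n./2) @ \oo --> \oo.
  move=> P [N _ NP]; exists N.*2 => // n /= Nn; apply: NP => /=.
  by rewrite -(doubleK N) half_leq.
have uhoo : uphalf @ \oo --> \oo.
  move=> P [N _ NP]; exists N.*2 => // n /= Nn; apply: NP => /=.
  by rewrite -(doubleK N) (leq_trans (half_leq Nn))// uphalf_half leq_addl.
apply: cvgD.
  exact: (cvg_comp _ _ uhoo xu).
exact: (cvg_comp _ _ hoo yv).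
Qed.

Lemma cvg_interleave x y (u : V) : x @ \oo --> u -> y @ \oo --> u ->
  interleave x y @ \oo --> u.
Proof.
move=> xu yu P Pu.
have [N _ NP] := xu P Pu; have [M _ MP] := yu P Pu.
exists (maxn N M).*2 => // n /= NMn; rewrite /interleave.
have : (maxn N M <= n./2)%N by rewrite -(doubleK (maxn N M)) half_leq.
rewrite geq_max => /andP[Nn Mn].
by case: ifP => _; [exact: MP|exact: NP].
Qed.

End LpNormTheory.

Section PContinuousFunctions.
Variables (R : realType) (k : scalar_kind).
Notation K := (scalar_field R k).
Variables (Omega : topologicalType) (X : normedModType K) (p : \bar R).
Hypothesis p1 : (1 <= p)%E.
Implicit Types (F G : Omega -> X) (x y : nat -> X).

(* l_p(X), and c_0(X) when p = +oo *)
Definition lp_seq x : Prop :=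
  (lp_norm p x < +oo)%E /\ (p = +oo%E -> x @ \oo --> (0 : X)).

Definition lp_covers F x : Prop := forall w, exists2 a : nat -> K,
  (lp_norm (hoelder_conjugate p) a <= 1)%E &
  series (fun n => a n *: x n) @ \oo --> F w.

Definition cp_pred : {pred Omega -> X} :=
  [pred F | `[< continuous F /\ exists2 x, lp_seq x & lp_covers F x >]].

Definition cp_norm F : R :=
  inf [set fine (lp_norm p x) | x in [set x | lp_seq x /\ lp_covers F x]].

Lemma cp_norm_le F x (C : R) : lp_seq x -> lp_covers F x ->
  (lp_norm p x <= C%:E)%E -> cp_norm F <= C.
Proof.
move=> lx Fx xC; apply: (@le_trans _ _ (fine (lp_norm p x))).
  apply: inf_lbound; last by exists x.
  by exists 0 => _ [y _ <-]; rewrite fine_ge0// lp_norm_ge0.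
rewrite -lee_fin fineK// ge0_fin_numE; first by case: lx.
exact: lp_norm_ge0.
Qed.

Lemma cp_norm_lt F (C : R) : F \in cp_pred -> cp_norm F < C ->
  exists x, [/\ lp_seq x, lp_covers F x & (lp_norm p x <= C%:E)%E].
Proof.
move=> /asboolP[_ [x0 lx0 Fx0]] FC.
have hi : has_inf [set fine (lp_norm p x) | x in [set x | lp_seq x /\ lp_covers F x]].
  split; first by exists (fine (lp_norm p x0)), x0.
  by exists 0 => _ [y _ <-]; rewrite fine_ge0// lp_norm_ge0.
have [_ [x [lx Fx] <-] xC] : exists2 e,
    [set fine (lp_norm p x) | x in [set x | lp_seq x /\ lp_covers F x]] e & e < C.
  have e0 : 0 < C - cp_norm F by rewrite subr_gt0.
  have [e Fe] := inf_adherent e0 hi.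
  by rewrite -/(cp_norm F) addrC subrK => eC; exists e.
exists x; split => //; rewrite -[lp_norm p x]fineK ?lee_fin ?ltW//.
by rewrite ge0_fin_numE ?lp_norm_ge0//; case: lx.
Qed.

Lemma cp_norm_ge0 F : 0 <= cp_norm F.
Proof.
rewrite /cp_norm; set A := [set _ | _ in _].
have [->|A0] := eqVneq A set0; first by rewrite inf0.
apply: lb_le_inf; first exact/set0P.
by move=> _ [y _ <-]; rewrite fine_ge0// lp_norm_ge0.
Qed.

Lemma lp_coversZ (a : K) F x : lp_covers F x ->
  lp_covers (a *: F) (fun n => a *: x n).
Proof.
move=> Fx w; have [b b1 bF] := Fx w; exists b => //.
have -> : series (fun n => b n *: (a *: x n)) =
    (fun m => a *: series (fun n => b n *: x n) m).
  apply/funext => m; rewrite /series /= scaler_sumr.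
  by apply: eq_bigr => i _; rewrite !scalerA mulrC.
exact: cvgZl_tmp.
Qed.

Lemma lp_seqZ (a : K) x (C : R) : 0 <= C -> lp_seq x ->
  (lp_norm p x <= C%:E)%E ->
  lp_seq (fun n => a *: x n) /\
  (lp_norm p (fun n => a *: x n) <= (nrm a * C)%:E)%E.
Proof.
move=> C0 [_ x0] xC; have axC := lp_normZ a p1 C0 xC.
split=> //; split; first by rewrite (le_lt_trans axC)// ltry.
by move=> /x0 x00; rewrite -(scaler0 _ a); exact: cvgZl_tmp.
Qed.

Lemma lp_combine F G x y (A B : R) : 0 < A -> 0 < B ->
  lp_seq x -> lp_covers F x -> (lp_norm p x <= A%:E)%E ->
  lp_seq y -> lp_covers G y -> (lp_norm p y <= B%:E)%E ->
  exists z, [/\ lp_seq z, lp_covers (F + G) z & (lp_norm p z <= (A + B)%:E)%E].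
Proof.
move=> A0 B0 [_ x0] Fx xA [_ y0] Gy yB.
have [c [d [c0 d0 hxy hab]]] := lp_split X p1 A0 B0.
have oc (r : R) : 0 < r -> ofR k r * ofR k r^-1 = 1.
  by move=> r0; rewrite -ofRM mulfV ?gt_eqF// ofR1.
have zAB := hxy _ _ xA yB.
eexists; split; last exact: zAB.
  split; first by rewrite (le_lt_trans zAB)// ltry.
  move=> poo; apply: cvg_interleave.
    by rewrite -(scaler0 _ (ofR k c^-1)); apply: cvgZl_tmp; exact: x0.
  by rewrite -(scaler0 _ (ofR k d^-1)); apply: cvgZl_tmp; exact: y0.
move=> w; have [a a1 aF] := Fx w; have [b b1 bG] := Gy w.
eexists; first exact: (hab _ _ a1 b1).
set u := (X in series X @ \oo --> _).
have -> : u = interleave (fun n => a n *: x n) (fun n => b n *: y n).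
  apply/funext => n; rewrite /u /interleave; case: ifP => _.
    by rewrite scalerA mulrAC oc// mul1r.
  by rewrite scalerA mulrAC oc// mul1r.
exact: series_interleave.
Qed.

Lemma lp_seq_bound x : lp_seq x ->
  exists2 C : R, 0 < C & (lp_norm p x <= C%:E)%E.
Proof.
move=> [xoo _]; have xfin : lp_norm p x \is a fin_num.
  by rewrite ge0_fin_numE ?lp_norm_ge0.
exists (fine (lp_norm p x) + 1); first by rewrite ltr_wpDl ?fine_ge0 ?lp_norm_ge0.
by rewrite EFinD fineK// leeDl// lee01.
Qed.

Lemma lp_norm0 (q : \bar R) (V : normedModType K) : (1 <= q)%E ->
  (lp_norm q (fun=> 0%R : V) <= 0)%E.
Proof.
move=> q1; have := lp_norm_single (0 : V) q1; rewrite nrm0.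
by congr (lp_norm _ _ <= _)%E; apply/funext => -[].
Qed.

Lemma cp_submod_closed : submod_closed cp_pred.
Proof.
split.
  apply/asboolP; split; first by move=> x; exact: cst_continuous.
  exists (fun=> 0) => [|w].
    split; last by move=> _; exact: cvg_cst.
    by rewrite (le_lt_trans (lp_norm0 X p1))// ltry.
  exists (fun=> 0).
    by rewrite (le_trans (lp_norm0 K (hoelder_conj_ge1 p1)))// lee01.
  have -> : series (fun n => (0 : K) *: (0 : X)) = fun=> 0.
    by apply/funext => m; rewrite /series /= big1// => i _; rewrite scaler0.
  exact: cvg_cst.
move=> a F G /asboolP[cF [x lx Fx]] /asboolP[cG [y ly Gy]].
apply/asboolP; split.
  move=> w; apply: (@continuousD _ _ _ (fun w => a *: F w) G).
    by apply: continuousZl_tmp; exact: cF.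
  exact: cG.
have [A A0 xA] := lp_seq_bound lx; have [B B0 yB] := lp_seq_bound ly.
have [lax axA] := lp_seqZ a (ltW A0) lx xA.
have A1 : 0 < nrm a * A + 1 by rewrite ltr_wpDl// mulr_ge0 ?nrm_ge0// ltW.
have axA1 : (lp_norm p (fun n => (a *: x n)%R) <= (nrm a * A + 1)%:E)%E.
  by rewrite (le_trans axA)// lee_fin lerDl.
have [z [lz FGz _]] := lp_combine A1 B0 lax (lp_coversZ a Fx) axA1 ly Gy yB.
by exists z.
Qed.

End PContinuousFunctions.

Section CpSpace.
Variables (R : realType) (k : scalar_kind).
Notation K := (scalar_field R k).
Variables (Omega : topologicalType) (X : normedModType K) (p : \bar R).
Variable p1 : (1 <= p)%E.
Notation cp_pred := (@cp_pred R k Omega X p).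

(* The proof of 1 <= p only serves to equip the type with its norm. *)
Record cp_of (h : (1 <= p)%E) :=
  Cp { cp_val :> Omega -> X; cp_valP : cp_val \in cp_pred }.

Notation cp := (cp_of p1).

HB.instance Definition _ := [isSub for @cp_val p1].
HB.instance Definition _ := [Choice of cp by <:].
HB.instance Definition _ := GRing.isSubmodClosed.Build _ _ cp_pred
  (@cp_submod_closed R k Omega X p p1).
HB.instance Definition _ := [SubChoice_isSubLmodule of cp by <:].

Implicit Types F G : cp.

Lemma cpP F G : F =1 G -> F = G.
Proof. by move=> FG; apply/val_inj/funext. Qed.

Let cp_normD F G : cp_norm p (F + G : cp) <= cp_norm p F + cp_norm p G.
Proof.
apply/ler_addgt0Pr => e e0.
have e2 : 0 < e / 2 by rewrite divr_gt0.
have [x [lx Fx xA]] := cp_norm_lt (cp_valP F) (ltr_pwDr e2 (lexx (cp_norm p F))).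
have [y [ly Gy yB]] := cp_norm_lt (cp_valP G) (ltr_pwDr e2 (lexx (cp_norm p G))).
have gt0 (H : Omega -> X) : 0 < cp_norm p H + e / 2 by rewrite ltr_wpDl// cp_norm_ge0.
have [z [lz FGz zAB]] := lp_combine p1 (gt0 F) (gt0 G) lx Fx xA ly Gy yB.
apply: (cp_norm_le lz FGz); rewrite (le_trans zAB)// lee_fin.
by rewrite addrACA -splitr.
Qed.

Let cp_normZ (a : K) F : cp_norm p (a *: F : cp) = nrm a * cp_norm p F.
Proof.
have le b (H : cp) : cp_norm p (b *: H : cp) <= nrm b * cp_norm p H.
  apply/ler_addgt0Pr => e e0.
  have b1 : 0 < nrm b + 1 by rewrite ltr_wpDl ?nrm_ge0.
  have e2 : 0 < e / (nrm b + 1) by rewrite divr_gt0.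
  have [x [lx Fx xA]] := cp_norm_lt (cp_valP H) (ltr_pwDr e2 (lexx (cp_norm p H))).
  have A0 : 0 <= cp_norm p H + e / (nrm b + 1) by rewrite addr_ge0 ?cp_norm_ge0 ?ltW.
  have [lbx bxA] := lp_seqZ p1 b A0 lx xA.
  apply: (cp_norm_le lbx (lp_coversZ b Fx)); rewrite (le_trans bxA)// lee_fin.
  rewrite mulrDr lerD2l mulrCA ler_piMr ?(ltW e0)//.
  by rewrite ler_pdivrMr// mul1r lerDl.
apply/eqP; rewrite eq_le le /=.
have [->|a0] := eqVneq a 0; first by rewrite nrm0 mul0r cp_norm_ge0.
have na : 0 < nrm a.
  rewrite lt_def nrm_ge0 andbT; apply/eqP => /nrm0_eq0/eqP.
  by rewrite (negbTE a0).
rewrite -ler_pdivlMl// -{1}[F](scalerK a0) (le_trans (le _ _))//.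
by rewrite nrmV.
Qed.

Lemma cp_norm_ge F w : nrm (F w) <= cp_norm p F.
Proof.
apply/ler_addgt0Pr => e e0.
have [x [_ Fx xA]] := cp_norm_lt (cp_valP F) (ltr_pwDr e0 (lexx (cp_norm p F))).
have C0 : 0 < cp_norm p F + e by rewrite ltr_wpDl// cp_norm_ge0.
have [a a1 aF] := Fx w.
have h := lp_hoelder p1 C0 xA a1.
have nF : nrm (series (fun n => a n *: x n) m) @[m --> \oo] --> nrm (F w).
  exact: (cvg_comp _ _ aF (@nrm_continuous R k X (F w))).
rewrite -(cvg_lim (@Rhausdorff R) nF).
apply: limr_le; first by apply/cvg_ex; exists (nrm (F w)).
by apply: nearW => m; exact: h.
Qed.

Let cp_norm0_eq0 F : cp_norm p F = 0 -> F = 0.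
Proof.
move=> F0; apply: cpP => w; apply: nrm0_eq0; apply/eqP.
by rewrite eq_le nrm_ge0 andbT -F0 cp_norm_ge.
Qed.

Let cnormD F G : ofR k (cp_norm p (F + G : cp)) <=
  ofR k (cp_norm p F) + ofR k (cp_norm p G).
Proof. by rewrite -ofRD ofR_le cp_normD. Qed.

Let cnormZ (a : K) F :
  ofR k (cp_norm p (a *: F : cp)) = `|a| * ofR k (cp_norm p F).
Proof. by rewrite cp_normZ ofRM ofR_nrm. Qed.

Let cnorm0_eq0 F : ofR k (cp_norm p F) = 0 -> F = 0.
Proof.
by move=> F0; apply: cp_norm0_eq0; rewrite -[LHS](ofRK k) F0 -(ofR0 R) ofRK.
Qed.

HB.instance Definition _ := @Lmodule_isNormed.Build K cp
  (fun F => ofR k (cp_norm p F)) cnormD cnormZ cnorm0_eq0.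

Lemma nrm_cp F : nrm F = cp_norm p F.
Proof. exact: ofRK. Qed.

Variable Ocpt : compact [set: Omega].
Implicit Types (phi : cfun_of R k Ocpt) (x : X).

Lemma tensor_covers phi x :
  lp_covers p (fun w => phi w *: x) (single (ofR k (nrm phi) *: x)).
Proof.
move=> w; exists (single (phi w * ofR k (nrm phi)^-1)).
  rewrite (le_trans (lp_norm_single _ (hoelder_conj_ge1 p1)))// lee_fin.
  have [p0|p0] := eqVneq (nrm phi) 0.
    by rewrite p0 invr0 ofR0 mulr0 nrm0 ler01.
  have pp : 0 < nrm phi by rewrite lt_def p0 nrm_ge0.
  rewrite nrmM nrm_ofR gtr0_norm ?invr_gt0// ler_pdivrMr// mul1r nrm_cfun.
  exact: supnorm_ge.
rewrite -(cvg_shiftS) /=.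
have -> : (fun n => series (fun n => single (phi w * ofR k (nrm phi)^-1) n *:
    single (ofR k (nrm phi) *: x) n) n.+1) = fun=> phi w *: x.
  apply/funext => n; rewrite /series /= big_nat_recl// big1 /= => [|i _]; last first.
    by rewrite scaler0.
  rewrite addr0 scalerA -mulrA -ofRM.
  have [p0|p0] := eqVneq (nrm phi) 0; last by rewrite mulVf// ofR1 mulr1.
  have -> : phi w = 0.
    apply: nrm0_eq0; apply/eqP; rewrite eq_le nrm_ge0 andbT -p0 nrm_cfun.
    exact: supnorm_ge.
  by rewrite mul0r.
exact: cvg_cst.
Qed.

Lemma tensor_lp_seq phi x : lp_seq p (single (ofR k (nrm phi) *: x)) /\
  (lp_norm p (single (ofR k (nrm phi) *: x)) <= (nrm phi * nrm x)%:E)%E.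
Proof.
have h : (lp_norm p (single (ofR k (nrm phi) *: x)) <= (nrm phi * nrm x)%:E)%E.
  rewrite (le_trans (lp_norm_single _ p1))// lee_fin nrmZ nrm_ofR.
  by rewrite ger0_norm ?nrm_ge0.
split=> //; split; first by rewrite (le_lt_trans h)// ltry.
by move=> _; rewrite -(cvg_shiftS) /=; exact: cvg_cst.
Qed.

Lemma tensor_subproof phi x : (fun w => phi w *: x) \in cp_pred.
Proof.
apply/asboolP; split.
  by move=> w; apply: cvgZr_tmp; exact: (@cfun_continuous R k Omega Ocpt phi w).
exists (single (ofR k (nrm phi) *: x)); last exact: tensor_covers.
by case: (tensor_lp_seq phi x).
Qed.

Definition tensor phi x : cp := Cp p1 (tensor_subproof phi x).

Lemma btensor_subproof phi : tensor phi \in @bop_pred R k X cp.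
Proof.
apply: (@linear_bounded_bop _ _ _ _ _ (nrm phi)) => [a x y|x].
  apply: cpP => w.
  change (phi w *: (a *: x + y) = a *: (phi w *: x) + phi w *: y).
  by rewrite scalerDr !scalerA mulrC.
rewrite nrm_cp; have [lx xC] := tensor_lp_seq phi x.
exact: (cp_norm_le lx (tensor_covers phi x) xC).
Qed.

Definition btensor phi : bop X cp := Bop (btensor_subproof phi).

Lemma nrm_btensor phi : nrm (btensor phi) <= nrm phi.
Proof.
rewrite nrm_bop; apply: opnorm_le; first exact: nrm_ge0.
move=> x; rewrite nrm_cp; have [lx xC] := tensor_lp_seq phi x.
exact: (cp_norm_le lx (tensor_covers phi x) xC).
Qed.

Lemma cp_dual_op_subproof (l : dual cp) :
  (fun phi => bcomp l (btensor phi) : dual X) \in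
    @bop_pred R k (cfun_of R k Ocpt) (dual X).
Proof.
apply: (@linear_bounded_bop _ _ _ _ _ (nrm l)) => [a f g|phi].
  apply: bopP => x.
  change (l (tensor (a *: f + g) x) = a *: l (tensor f x) + l (tensor g x)).
  rewrite -linearP; congr (l _); apply: cpP => w.
  change ((a *: f w + g w) *: x = a *: (f w *: x) + g w *: x).
  by rewrite scalerDl scalerA.
rewrite [nrm (bcomp _ _)]nrm_bop; apply: opnorm_le; first by rewrite mulr_ge0 ?nrm_ge0.
move=> x; rewrite (le_trans (opnorm_bound l (btensor phi x)))// -nrm_bop -mulrA.
rewrite ler_wpM2l ?nrm_ge0// (le_trans (opnorm_bound _ _))// -nrm_bop.
by rewrite ler_wpM2r ?nrm_ge0// nrm_btensor.
Qed.

(* The identification of C_p(Omega, X)^* with a space of operators from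
   C(Omega) to X^*, through <phi x, T> = <x, T phi>. *)
Definition cp_dual_op (l : dual cp) : bop (cfun_of R k Ocpt) (dual X) :=
  Bop (cp_dual_op_subproof l).

End CpSpace.

Definition borel (Omega : topologicalType) : set (set Omega) :=
  <<s [set A : set Omega | open A] >>.

Section VectorMeasures.
Variables (R : realType) (k : scalar_kind) (Omega : topologicalType).
Notation K := (scalar_field R k).
Variable Z : normedModType K.
Implicit Types (m : set Omega -> Z) (phi : Omega -> K).

(* Set functions are total on set Omega; only their values on Borel sets are
   ever used. *)
Definition bounded_vector_measure m : Prop :=
  (forall A B, borel A -> borel B -> A `&` B = set0 ->
     m (A `|` B) = m A + m B) /\
  (exists M : R, forall A, borel A -> nrm (m A) <= M).

Record borel_simple := BorelSimple {
  simple_size : nat;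
  simple_coef : 'I_simple_size -> K;
  simple_set : 'I_simple_size -> set Omega;
  simple_borel : forall i, borel (simple_set i) }.

Definition simple_fun (s : borel_simple) (w : Omega) : K :=
  \sum_i simple_coef i * \1_(simple_set (b := s) i) w.

Definition simple_integral m (s : borel_simple) : Z :=
  \sum_i simple_coef i *: m (simple_set (b := s) i).

(* For a bounded vector measure with values in a complete space, the limit
   exists for every phi in the uniform closure of the Borel simple functions
   and does not depend on the approximating sequence. *)
Definition vintegral m phi : Z := xget 0 [set z | exists s : nat -> borel_simple,
  {uniform, (fun n => simple_fun (s n)) @ \oo --> phi} /\
  (fun n => simple_integral m (s n)) @ \oo --> z].

End VectorMeasures.

Section RegularMeasures.
Variables (R : realType) (k : scalar_kind) (Omega : topologicalType).
Notation K := (scalar_field R k).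

(* The last condition says that the variation of mu is a regular measure. *)
Definition regular_measure (mu : set Omega -> K) : Prop :=
  [/\ bounded_vector_measure mu,
      forall F : nat -> set Omega, (forall n, borel (F n)) -> trivIset setT F ->
        series (fun n => mu (F n)) @ \oo --> mu (\bigcup_n F n) &
      forall A, borel A -> forall e : R, 0 < e -> exists C U : set Omega,
        [/\ closed C, open U, C `<=` A, A `<=` U &
            forall B, borel B -> B `<=` U `\` C -> nrm (mu B) < e]].

Variable Ocpt : compact [set: Omega].
Notation COmega := (cfun_of R k Ocpt).

(* The measure that the Riesz representation theorem attaches to l. *)
Definition riesz_measure (l : dual COmega) : set Omega -> K :=
  xget (fun=> 0) [set mu | regular_measure mu /\
                           forall phi : COmega, l phi = vintegral mu phi].

Variables (X : normedModType K) (p : \bar R) (p1 : (1 <= p)%E).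

(* <A, chi_E (x) x> = <A^* x, chi_E>, where <mu, chi_E> = mu(E) and A^* x is
   identified with its regular representing measure. A set function nu that is
   merely bounded and finitely additive may differ from the representing measure
   of phi |-> vintegral nu phi: on the one-point compactification of nat let
   nu(E) = 1 if E `&` nat belongs to a fixed free ultrafilter and nu(E) = 0
   otherwise; then vintegral nu phi = phi(oo), while nu([set oo]) = 0. *)
Definition chi_tensor (E : set Omega) (x : X) (l : dual (cp_of Omega X p1)) : K :=
  riesz_measure (adjoint (cp_dual_op Ocpt l) (to_bidual x)) E.

End RegularMeasures.

Section Summing.
Variables (R : realType) (k : scalar_kind).
Notation K := (scalar_field R k).
Variables Z W : normedModType K.

Definition weak_lp_norm (r : R) (n : nat) (z : 'I_n -> Z) : \bar R :=
  ereal_sup [set ((\sum_i nrm (l (z i)) `^ r) `^ r^-1)%:E |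
              l in [set l : dual Z | nrm l <= 1]].

Definition summing_norm (q : \bar R) (T : Z -> W) : \bar R :=
  if q is r%:E then
    ereal_inf [set C%:E | C in [set C : R | 0 <= C /\
      forall n (z : 'I_n -> Z),
        (((\sum_i nrm (T (z i)) `^ r) `^ r^-1)%:E <=
          C%:E * weak_lp_norm r z)%E]]
  else ereal_sup [set (nrm (T z))%:E | z in [set z : Z | nrm z <= 1]].

End Summing.

Section Semivariation.
Variables (R : realType) (k : scalar_kind) (Omega : topologicalType).
Notation K := (scalar_field R k).
Variable Ocpt : compact [set: Omega].
Notation COmega := (cfun_of R k Ocpt).
Variables X Y : normedModType K.
Variable m : set Omega -> bop X (bidual Y).

(* m_{y^*} and I_{y^*} *)
Definition scalarized_measure (ystar : dual Y) (E : set Omega) : dual X :=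
  bcomp (to_bidual ystar : dual (bidual Y)) (m E).

Definition scalarized_integral (ystar : dual Y) (phi : COmega) : dual X :=
  vintegral (scalarized_measure ystar) phi.

Definition semivariation (q : \bar R) : \bar R :=
  ereal_sup [set summing_norm q (scalarized_integral ystar) |
              ystar in [set ystar : dual Y | nrm ystar <= 1]].

Definition bounded_semivariation (q : \bar R) : Prop :=
  bounded_vector_measure m /\ (semivariation q < +oo)%E.

End Semivariation.

(* Main.v *)
Require Import Defs.
From HB Require Import structures.
From mathcomp Require Import all_boot all_order all_algebra.
From mathcomp Require Import complex.
From mathcomp Require Import all_classical all_reals all_analysis.
From mathcomp Require Import ring lra.

Set Implicit Arguments.
Unset Strict Implicit.
Unset Printing Implicit Defensive.

Import Order.TTheory GRing.Theory Num.Theory.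
Import numFieldNormedType.Exports.

Local Open Scope classical_set_scope.
Local Open Scope ring_scope.

(** Write T_y = I_{y^*} for the operator phi |-> (integral of phi dm_{y^*}) from
    C(Omega) to X^*, and let q = p'. On a finite sum G = sum_i phi_i x_i the
    integral must be L(G) = sum_i (integral of phi_i dm) x_i, and pairing with
    y^* gives sum_i <x_i, T_y phi_i>. Everything rests on two facts about such
    sums: they are controlled by the C_p norm, and they are dense in C_p.

    Control ([tensor_functional_bound]). Let G(w) = sum_n a_n(w) y_n with
    (a_n(w)) in the unit ball of l_q. Choose a partition of unity (psi_j) with
    nodes c_j, fine enough for the finitely many phi_i. Then L(G) is close to
    the pairing of sum_j psi_j G(c_j), which equals sum_n <y_n, T_y g_n> where
    g_n = sum_j a_n(c_j) psi_j. For every w the sequence (g_n(w)) is a convex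
    combination of elements of the unit ball of l_q, so (g_n) has weak l_q norm
    at most one, and Hoelder's inequality together with the definition of the
    q-summing norm bounds the sum by the summing norm of T_y times the l_p norm
    of (y_n) ([summing_pairing]). The selection w |-> a(w) is arbitrary: only its
    values at the nodes enter. Conversely, testing on sums with
    (x_i) in the unit ball of l_p recovers the summing norm
    ([summing_norm_le]); hence the norm of U is the q-semivariation.

    Density ([cp_approx]). The functions sum_j psi_j F(c_j) converge to F
    uniformly, but the C_p norm of the difference has to be small. By
    compactness of the coefficient ball in the topology of coordinatewise
    convergence, a vector of small norm which is representable by coefficients
    in a ball of l_q is also representable by coefficients in a larger ball
    whose first N entries are small ([small_head_coefficients]). The first N
    terms are then small because of their coefficients, the remaining ones
    because the tail of (x_n) is small in l_p.

    Given both facts, U is the extension of L by density ([dense_extension]),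
    the bidual being complete. It takes values in Y when m does, since the
    canonical image of Y in its bidual is closed; this needs functionals
    norming a given vector ([norming_functional]), obtained from Zorn's lemma.
    For the formula for the second adjoint, the functional phi |-> <y^*, U(phi
    x)> is represented by the measure <y^*, m(.)x>. The latter is assumed
    regular, and by Urysohn's lemma a regular measure is determined by the
    integrals of continuous functions ([regular_measure_unique]); so it is the
    Riesz measure that defines chi_E (x) x. *)

(** * Real-valued norms: convergence and completeness *)

Section NrmConvergence.
Variables (R : realType) (k : scalar_kind).
Notation K := (scalar_field R k).
Implicit Types V W : normedModType K.

Lemma nrmB (V : normedZmodType K) (x y : V) : nrm (x - y) = nrm (y - x).
Proof. by rewrite -nrmN opprB. Qed.

Lemma nrm_sum (V : normedZmodType K) (I : Type) (s : seq I) (P : pred I)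
    (F : I -> V) :
  nrm (\sum_(i <- s | P i) F i) <= \sum_(i <- s | P i) nrm (F i).
Proof.
elim/big_rec2: _ => [|i y x _ yx]; first by rewrite nrm0.
by rewrite (le_trans (nrmD _ _))// lerD2l.
Qed.

Lemma nrm_small0 (V : normedZmodType K) (x : V) :
  (forall e : R, 0 < e -> nrm x <= e) -> x = 0.
Proof.
move=> xe; apply: nrm0_eq0; apply/eqP; rewrite eq_le nrm_ge0 andbT.
by apply/ler_addgt0Pr => e e0; rewrite add0r xe.
Qed.

Lemma cvg_nrmP V (T : Type) (F : set_system T) (FF : Filter F) (f : T -> V) (l : V) :
  f @ F --> l <->
  (forall e : R, 0 < e -> \forall t \near F, nrm (l - f t) < e).
Proof.
split=> [fl e e0|fl].
  have e0' : 0 < ofR k e by rewrite -(ofR0 R) ofR_lt.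
  have /cvgrPdist_lt/(_ _ e0') := fl.
  by apply: filterS => t; rewrite -ofR_nrm ofR_lt.
apply/cvgrPdist_lt => e e0.
have er : ofR k (reK e) = e by rewrite reKK// gtr0_real.
have e0' : 0 < reK e by rewrite -(ofR_lt k) ofR0 er.
have := fl _ e0'; apply: filterS => t.
by rewrite -(ofR_lt k) er ofR_nrm.
Qed.

Definition nrm_cauchy V (u : nat -> V) := forall e : R, 0 < e ->
  exists N, forall n m, (N <= n)%N -> (N <= m)%N -> nrm (u n - u m) < e.

Definition nrm_complete V := forall u : nat -> V, nrm_cauchy u ->
  exists l : V, u @ \oo --> l.

Lemma cvg_nrm_cauchy V (u : nat -> V) (l : V) : u @ \oo --> l -> nrm_cauchy u.
Proof.
move=> /cvg_nrmP ul e e0; have e2 : 0 < e / 2 by rewrite divr_gt0.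
have [N _ NP] := ul _ e2; exists N => n m Nn Nm.
have -> : u n - u m = (l - u m) - (l - u n) by rewrite [RHS]addrC opprB addrA subrK.
rewrite (le_lt_trans (nrmD _ _))// nrmN (splitr e) ltrD//; exact: NP.
Qed.

Lemma completeNormedMod_nrm_complete (V : completeNormedModType K) :
  nrm_complete V.
Proof.
move=> u uc; suff : cvgn u by move=> /cvg_ex.
apply: cauchy_cvg; apply: (@cauchy_exP _ V) => e e0.
have er : ofR k (reK e) = e by rewrite reKK// gtr0_real.
have e0' : 0 < reK e by rewrite -(ofR_lt k) ofR0 er.
have [N NP] := uc _ e0'; exists (u N).
exists N => // n /= Nn; rewrite -ball_normE /ball_ /=.
by rewrite -ofR_nrm -er ofR_lt NP.
Qed.

End NrmConvergence.

Section ScalarComplete.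
Variable R : realType.

Lemma real_scalar_complete : @nrm_complete R RealScalars (scalar_field R RealScalars).
Proof. exact: (@completeNormedMod_nrm_complete R RealScalars R). Qed.

Lemma complex_parts_le (z : R[i]) :
  let: nz := @nrm R ComplexScalars R[i] z in
  [/\ `|complex.Re z| <= nz, `|complex.Im z| <= nz &
      nz <= `|complex.Re z| + `|complex.Im z|].
Proof.
rewrite /nrm; case: z => a b; rewrite /=.
have s0 : 0 <= a ^+ 2 + b ^+ 2 by rewrite addr_ge0 ?sqr_ge0.
split.
- by rewrite -sqrtr_sqr ler_sqrt// lerDl sqr_ge0.
- by rewrite -sqrtr_sqr ler_sqrt// lerDr sqr_ge0.
- rewrite -(@ler_pXn2r _ 2)// ?nnegrE ?sqrtr_ge0 ?addr_ge0//.
  rewrite sqr_sqrtr// sqrrD !real_normK ?num_real// addrAC lerDl.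
  by rewrite mulrn_wge0// mulr_ge0.
Qed.

Lemma complex_scalar_complete :
  @nrm_complete R ComplexScalars (scalar_field R ComplexScalars).
Proof.
move=> u uc.
have part (f : R[i] -> R) : (forall a b, f (a - b) = f a - f b) ->
    (forall z, `|f z| <= @nrm R ComplexScalars R[i] z) ->
    exists l : R, (fun n => f (u n)) @ \oo --> l.
  move=> fB fn; apply: real_scalar_complete => e e0.
  have [N NP] := uc e e0; exists N => n m Nn Nm.
  by rewrite /nrm/= -fB (le_lt_trans (fn _))// NP.
have [||a ua] := part (@complex.Re R).
- by move=> [? ?] [? ?].
- by move=> z; have [] := complex_parts_le z.
have [||b ub] := part (@complex.Im R).
- by move=> [? ?] [? ?].
- by move=> z; have [] := complex_parts_le z.
exists (Complex a b); apply/cvg_nrmP => e e0.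
have e2 : 0 < e / 2 by rewrite divr_gt0.
have := ua; move=> /cvgrPdist_lt/(_ _ e2); have := ub; move=> /cvgrPdist_lt/(_ _ e2).
move=> h1 h2; near=> n.
have [_ _ h] := complex_parts_le (Complex a b - u n).
rewrite (le_lt_trans h)// (splitr e) ltrD//.
  have -> : complex.Re (Complex a b - u n) = a - complex.Re (u n) by case: (u n).
  by near: n.
have -> : complex.Im (Complex a b - u n) = b - complex.Im (u n) by case: (u n).
by near: n.
Unshelve. all: by end_near. Qed.

End ScalarComplete.

Lemma scalar_complete (R : realType) (k : scalar_kind) :
  @nrm_complete R k (scalar_field R k).
Proof.
case: k; [exact: real_scalar_complete|exact: complex_scalar_complete].
Qed.

Section BopComplete.
Variables (R : realType) (k : scalar_kind).
Notation K := (scalar_field R k).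
Variables V W : normedModType K.

Lemma nrm_cvg (T : Type) (F : set_system T) (FF : ProperFilter F)
  (f : T -> W) (l : W) (C : R) : f @ F --> l ->
  (\forall t \near F, nrm (f t) <= C) -> nrm l <= C.
Proof.
move=> /cvg_nrmP fl fC; apply/ler_addgt0Pr => e /fl fe.
have [t [/= tl tC]] := filter_ex (filterI fe fC).
by rewrite -[l](subrK (f t)) (le_trans (nrmD _ _))// addrC lerD// ltW.
Qed.

Lemma bop_nrm_bound (f : bop V W) x : nrm (f x) <= nrm f * nrm x.
Proof. by rewrite nrm_bop opnorm_bound. Qed.

Lemma bop_nrm_le (f : bop V W) (M : R) : 0 <= M ->
  (forall x, nrm (f x) <= M * nrm x) -> nrm f <= M.
Proof. by rewrite nrm_bop; exact: opnorm_le. Qed.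

Lemma bop_nrm_le_ball (f : bop V W) (M : R) :
  (forall x, nrm x <= 1 -> nrm (f x) <= M) -> nrm f <= M.
Proof.
move=> fM; rewrite nrm_bop; apply: ge_sup; first by case: (opnorm_has_sup f).
by move=> _ [x /= x1 <-]; exact: fM.
Qed.

Lemma bop_sumE (I : Type) (s : seq I)
    (F : I -> bop V W) (v : V) : (\sum_(i <- s) F i) v = \sum_(i <- s) F i v.
Proof. by elim: s => [|i s ih]; rewrite ?big_nil// !big_cons -ih. Qed.

Lemma bop_nrm_complete : nrm_complete W -> nrm_complete (bop V W).
Proof.
move=> cW u uc.
have uxc x : nrm_cauchy (fun n => u n x).
  move=> e e0; have x1 : 0 < nrm x + 1 by rewrite ltr_wpDl ?nrm_ge0.
  have [N NP] := uc _ (divr_gt0 e0 x1); exists N => n m Nn Nm.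
  have -> : u n x - u m x = (u n - u m) x by [].
  have := NP _ _ Nn Nm; rewrite ltr_pdivlMr//; apply: le_lt_trans.
  by rewrite (le_trans (bop_nrm_bound _ _))// ler_wpM2l ?nrm_ge0// lerDl.
have [l ul] := choice (fun x => cW _ (uxc x)).
have lin : linear l.
  move=> a x y; apply: (@cvg_unique _ (@norm_hausdorff _ W) ((fun n => u n (a *: x + y)) @ \oo)).
    exact: ul.
  rewrite (_ : (fun n => _) = fun n => a *: u n x + u n y); last first.
    by apply/funext => n; rewrite linearP.
  by apply: cvgD; [apply: cvgZl_tmp; exact: ul|exact: ul].
have dist e : 0 < e -> exists N, forall n, (N <= n)%N ->
    forall x, nrm (l x - u n x) <= e * nrm x.
  move=> /uc[N NP]; exists N => n Nn x.
  apply: (@nrm_cvg _ \oo _ (fun m => u m x - u n x)).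
    by apply: cvgB; [exact: ul|exact: cvg_cst].
  exists N => // m /= Nm; have -> : u m x - u n x = (u m - u n) x by [].
  by rewrite (le_trans (bop_nrm_bound _ _))// ler_wpM2r ?nrm_ge0// ltW// NP.
have [N0 N0P] := dist 1 ltr01.
have lb x : nrm (l x) <= (1 + nrm (u N0)) * nrm x.
  rewrite -[l x](subrK (u N0 x)) (le_trans (nrmD _ _))// mulrDl lerD ?bop_nrm_bound//.
  exact: N0P.
exists (Bop (linear_bounded_bop lin lb)); apply/cvg_nrmP => e e0.
have e2 : 0 < e / 2 by rewrite divr_gt0.
have [N NP] := dist _ e2; exists N => // n /= Nn.
rewrite (@le_lt_trans _ _ (e / 2))//; last by rewrite ltr_pdivrMr// mulr_natr mulr2n ltrDl.
by apply: bop_nrm_le; [exact: ltW|exact: NP].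
Qed.

End BopComplete.

(** * Extension by density *)

(** The dense set is presented by a type [P] of representations: [ev] gives the
    vector and [L] its prescribed image. By [comb] and [bound] the image depends
    only on the vector, so no quotient is formed. *)
Section DenseExtension.
Variables (R : realType) (k : scalar_kind).
Notation K := (scalar_field R k).
Variables (V W : normedModType K) (P : Type) (ev : P -> V) (L : P -> W) (S : R).
Hypothesis cW : nrm_complete W.
Hypothesis S0 : 0 <= S.
Hypothesis comb : forall (a : K) s t, exists u,
  ev u = a *: ev s + ev t /\ L u = a *: L s + L t.
Hypothesis bound : forall s, nrm (L s) <= S * nrm (ev s).
Hypothesis dense : forall v (e : R), 0 < e -> exists s, nrm (v - ev s) <= e.

Lemma dense_dist s t : nrm (L s - L t) <= S * nrm (ev s - ev t).
Proof.
have [u [eu Lu]] := comb (-1) t s.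
have -> : L s - L t = L u by rewrite Lu scaleN1r addrC.
by rewrite (le_trans (bound u))// eu scaleN1r addrC.
Qed.

(** The inequality against all representatives, and not only along one
    approximating sequence, characterizes the value of the extension at [v]:
    linearity and the norm bound follow from it directly. *)
Lemma dense_value v : exists w, forall s, nrm (w - L s) <= S * nrm (v - ev s).
Proof.
have [s sv] := choice (fun n => @dense v n.+1%:R^-1 (ltac:(by rewrite invr_gt0))).
have S1 : 0 < S + 1 by rewrite ltr_wpDl.
have sE t n : nrm (ev (s n) - ev t) <= nrm (v - ev t) + n.+1%:R^-1.
  have -> : ev (s n) - ev t = (v - ev t) - (v - ev (s n)).
    by rewrite [RHS]addrC opprB addrA subrK.
  by rewrite (le_trans (nrmD _ _))// nrmN lerD2l.
have [w Lw] : exists w : W, (fun n => L (s n)) @ \oo --> w.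
  apply: cW => e e0.
  have e1 : 0 < e / ((S + 1) * 2) by rewrite divr_gt0// mulr_gt0.
  have := near_infty_natSinv_lt (PosNum e1) => -[N _ NP] /=.
  exists N => n m Nn Nm; rewrite (le_lt_trans (dense_dist _ _))//.
  apply: (@le_lt_trans _ _ ((S + 1) * nrm (ev (s n) - ev (s m)))).
    by rewrite ler_wpM2r ?nrm_ge0// lerDl.
  rewrite -ltr_pdivlMl// (le_lt_trans (sE _ _))//.
  apply: (@lt_le_trans _ _ (e / ((S + 1) * 2) + e / ((S + 1) * 2))).
    by rewrite ltrD//; [rewrite (le_lt_trans (sv m))//; exact: NP|exact: NP].
  rewrite le_eqVlt; apply/orP; left; apply/eqP; field; exact: lt0r_neq0.
exists w => t; apply/ler_addgt0Pr => e e0.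
have e1 : 0 < e / (S + 1) by rewrite divr_gt0.
have [N _ NP] := near_infty_natSinv_lt (PosNum e1).
apply: (@nrm_cvg R k W _ \oo _ (fun n => L (s n) - L t)).
  by apply: cvgB => //; exact: cvg_cst.
exists N => // n /NP /= h; rewrite (le_trans (dense_dist _ _))//.
rewrite (le_trans (ler_wpM2l S0 (sE _ _)))// mulrDr lerD2l.
rewrite (le_trans (ler_wpM2l S0 (ltW h)))// mulrCA ler_piMr ?ltW//.
by rewrite ltr_pdivrMr// mul1r ltrDl.
Qed.

Lemma dense_extension : exists U : bop V W,
  (forall s, U (ev s) = L s) /\ nrm U <= S.
Proof.
have [U UP] := choice dense_value.
have Uev s : U (ev s) = L s.
  apply/eqP; rewrite -subr_eq0; apply/eqP/nrm0_eq0/eqP.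
  by rewrite eq_le nrm_ge0 andbT (le_trans (UP _ s))// subrr nrm0 mulr0.
have lin : linear U.
  move=> a x y; apply/eqP; rewrite -subr_eq0; apply/eqP/(@nrm_small0 R k) => e e0.
  set d := e / ((S + 1) * (nrm a + 1) * 4).
  have S1 : 0 < S + 1 by rewrite ltr_wpDl.
  have a1 : 0 < nrm a + 1 by rewrite ltr_wpDl ?nrm_ge0.
  have d0 : 0 < d by rewrite divr_gt0// !mulr_gt0.
  have [s sx] := dense x d0; have [t ty] := dense y d0.
  have [u [eu Lu]] := comb a s t.
  have -> : U (a *: x + y) - (a *: U x + U y) =
      (U (a *: x + y) - L u) - (a *: (U x - L s) + (U y - L t)).
    rewrite Lu scalerBr [in RHS]addrACA -opprD opprB addrA.
    by rewrite subrK.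
  rewrite (le_trans (nrmD _ _))// nrmN (le_trans (lerD (UP _ u) (nrmD _ _)))//.
  have -> : a *: x + y - ev u = a *: (x - ev s) + (y - ev t).
    by rewrite eu scalerBr opprD addrACA.
  apply: (@le_trans _ _ (S * (nrm a * d + d) + (nrm a * (S * d) + S * d))).
    apply: lerD.
      apply: ler_wpM2l => //; rewrite (le_trans (nrmD _ _))// nrmZ lerD//.
      by rewrite ler_wpM2l// nrm_ge0.
    rewrite nrmZ lerD//.
      by rewrite ler_wpM2l ?nrm_ge0// (le_trans (UP _ s))// ler_wpM2l.
    by rewrite (le_trans (UP _ t))// ler_wpM2l.
  have -> : S * (nrm a * d + d) + (nrm a * (S * d) + S * d) =
     (S * (nrm a + 1)) * (d * 2) by ring.
  apply: (@le_trans _ _ (((S + 1) * (nrm a + 1)) * (d * 2))).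
    by apply: ler_wpM2r; [rewrite mulr_ge0 ?(ltW d0)|apply: ler_wpM2r; rewrite ?(ltW a1)// lerDl].
  rewrite /d; have -> : (S + 1) * (nrm a + 1) * (e / ((S + 1) * (nrm a + 1) * 4) * 2) = e / 2.
    by field; rewrite !gt_eqF.
  by rewrite ler_pdivrMr// ler_peMr ?(ltW e0)// ler1n.
have Ub x : nrm (U x) <= S * nrm x.
  apply/ler_addgt0Pr => e e0.
  have S1 : 0 < S + 1 by rewrite ltr_wpDl.
  have d0 : 0 < e / ((S + 1) * 2) by rewrite divr_gt0// !mulr_gt0.
  have [s sx] := dense x d0.
  rewrite -[U x](subrK (L s)) (le_trans (nrmD _ _))//.
  rewrite (le_trans (lerD (UP x s) (bound s)))//.
  have h : nrm (ev s) <= nrm x + e / ((S + 1) * 2).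
    rewrite -[ev s](subrK x) addrC (le_trans (nrmD _ _))// lerD2l.
    by rewrite nrmB.
  rewrite -mulrDr (le_trans (ler_wpM2l S0 (lerD sx h)))//.
  rewrite addrCA mulrDr lerD2l.
  apply: (@le_trans _ _ ((S + 1) * (e / ((S + 1) * 2) + e / ((S + 1) * 2)))).
    by apply: ler_wpM2r; rewrite ?lerDl// addr_ge0 ?ltW.
  by rewrite le_eqVlt; apply/orP; left; apply/eqP; field; exact: lt0r_neq0.
exists (Bop (linear_bounded_bop lin Ub)); split; first exact: Uev.
by apply: bop_nrm_le.
Qed.

End DenseExtension.

(** * Norming functionals and the embedding into the bidual *)

Section HahnBanach.
Variables (R : realType) (k : scalar_kind).
Notation K := (scalar_field R k).
Variable V : normedModType K.
Implicit Types G : set (V * R).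

Notation rs t v := (ofR k t *: v).

(** Real-linear functionals below the norm on real subspaces, encoded by their
    graphs in order to be ordered by inclusion. Such a graph is single valued:
    the difference of two points over the same vector lies over 0, and so has
    second coordinate at most 0. *)
Definition dominated_graph G : Prop :=
  (forall (t : R) u v, G u -> G v -> G (rs t u.1 + v.1, t * u.2 + v.2)) /\
  (forall u, G u -> u.2 <= nrm u.1).

(** One-dimensional extension. The value [c] at [v0] must satisfy
    s - |u - v0| <= c <= |v + v0| - r for all (u, s) and (v, r) in [G]; every
    lower bound is below every upper bound, and [c] is the infimum of the
    latter. The cases t > 0 and t < 0 follow by homogeneity. *)
Lemma dominated_graph_extend G (v0 : V) : dominated_graph G -> G (0, 0) ->
  exists c : R, dominated_graph
    [set u | exists t v, G v /\ u = (v.1 + rs t v0, v.2 + t * c)].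
Proof.
move=> [Glin Gle] G00.
pose A := [set nrm (u.1 + v0) - u.2 | u in G].
have lbA u s : G u -> G s -> s.2 - nrm (s.1 - v0) <= nrm (u.1 + v0) - u.2.
  move=> Gu Gs; have /Gle /= := Glin 1 _ _ Gu Gs.
  rewrite ofR1 scale1r mul1r => h.
  have : nrm (u.1 + s.1) <= nrm (u.1 + v0) + nrm (s.1 - v0).
    by rewrite (le_trans _ (nrmD _ _))// addrACA subrr addr0.
  by lra.
have hA : has_inf A.
  split; first by exists (nrm (0 + v0) - 0), (0, 0).
  by exists (0 - nrm (0 - v0)) => _ [u Gu <-]; exact: (lbA u (0, 0)).
exists (inf A); split.
  move=> t _ _ [a [u [Gu ->]]] [b [v [Gv ->]]] /=.
  exists (t * a + b), (rs t u.1 + v.1, t * u.2 + v.2); split; first exact: Glin.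
  rewrite /= ofRD ofRM !scalerDr scalerDl scalerA; congr pair.
    by rewrite addrACA.
  by ring.
move=> _ [t [v [Gv ->]]] /=.
have Gs (a : R) u : G u -> G (rs a u.1, a * u.2).
  by move=> Gu; have := Glin a _ _ Gu G00; rewrite /= !addr0.
have [t0|t0|->] := ltgtP t 0; last first.
- by rewrite ofR0 scale0r mul0r !addr0; exact: Gle.
- have Gv' := Gs t^-1 _ Gv.
  have : inf A <= nrm (rs t^-1 v.1 + v0) - t^-1 * v.2.
    by apply: inf_lbound; [exact: hA.2|exists (rs t^-1 v.1, t^-1 * v.2)].
  rewrite -(ler_pM2l t0) mulrBr mulrA mulfV ?gt_eqF// mul1r.
  have -> : v.1 + rs t v0 = rs t (rs t^-1 v.1 + v0).
    by rewrite scalerDr scalerA -ofRM mulfV ?gt_eqF// ofR1 scale1r.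
  by rewrite nrmZ nrm_ofR gtr0_norm//; lra.
- have Gv' := Gs (- t)^-1 _ Gv; have nt0 : 0 < - t by rewrite oppr_gt0.
  have : (- t)^-1 * v.2 - nrm (rs (- t)^-1 v.1 - v0) <= inf A.
    apply: lb_le_inf; first exact: hA.1.
    by move=> _ [u Gu <-]; exact: (lbA u (rs (- t)^-1 v.1, (- t)^-1 * v.2)).
  rewrite -(ler_pM2l nt0) mulrBr mulrA mulfV ?gt_eqF// mul1r.
  have -> : v.1 + rs t v0 = rs (- t) (rs (- t)^-1 v.1 - v0).
    rewrite scalerBr scalerA -ofRM mulfV ?gt_eqF// ofR1 scale1r ofRN scaleNr.
    by rewrite opprK.
  by rewrite nrmZ nrm_ofR gtr0_norm//; lra.
Qed.

Lemma real_norming_functional y : exists g : V -> R,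
  [/\ forall t u v, g (rs t u + v) = t * g u + g v,
      forall v, g v <= nrm v & g y = nrm y].
Proof.
pose G0 : set (V * R) := [set u | exists t, u = (rs t y, t * nrm y)].
have G0y : G0 (y, nrm y) by exists 1; rewrite ofR1 scale1r mul1r.
have dG0 : dominated_graph G0.
  split=> [t _ _ [a ->] [b ->]|_ [t ->]] /=.
    by exists (t * a + b); rewrite ofRD ofRM scalerDl scalerA mulrDl mulrA.
  by rewrite nrmZ nrm_ofR ler_wpM2r ?nrm_ge0// ler_norm.
(* The empty graph is admitted because it is the union of the empty chain. *)
pose P (G : set (V * R)) := dominated_graph G /\ (G !=set0 -> G0 `<=` G).
have [G [[dG GG0] Gmax]] : exists G, P G /\ forall H, G `<` H -> ~ P H.
  apply: Zorn_bigcup => F FP tot; split; [split|].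
  - move=> t u v [H1 F1 Hu] [H2 F2 Hv].
    have [H12|H21] := tot _ _ F1 F2.
      by exists H2 => //; apply: (FP _ F2).1.1 => //; exact: H12.
    by exists H1 => //; apply: (FP _ F1).1.1 => //; exact: H21.
  - by move=> u [H FH Hu]; exact: (FP _ FH).1.2.
  - move=> [u [H FH Hu]] z G0z; exists H => //.
    by apply: (FP _ FH).2 => //; exists u.
have Gne : G !=set0.
  apply: contrapT => Ge; apply: (Gmax G0); last first.
    by split=> // _; exact: subset_refl.
  split; last by move=> /(_ _ G0y) h; apply: Ge; eexists; exact: h.
  by move=> z Gz; exfalso; apply: Ge; exists z.
have G0G := GG0 Gne.
have G00 : G (0, 0) by apply: G0G; exists 0; rewrite ofR0 scale0r mul0r.
have tot v0 : exists r, G (v0, r).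
  have [c dH] := dominated_graph_extend v0 dG G00.
  set H := (X in dominated_graph X) in dH.
  have GH : G `<=` H.
    move=> [v r] Gvr; exists 0, (v, r); split => //=.
    by rewrite ofR0 scale0r mul0r !addr0.
  have Hv0 : H (v0, c).
    by exists 1, (0, 0); split => //=; rewrite ofR1 scale1r mul1r !add0r.
  apply: contrapT => nG; apply: (Gmax H).
    by split=> // /(_ _ Hv0) Gv0; apply: nG; exists c.
  split=> // _; exact: subset_trans GH.
have [g gP] := choice tot.
have uniq v r : G (v, r) -> r = g v.
  move=> Gvr; have le a b : G (v, a) -> G (v, b) -> a <= b.
    move=> Ga Gb; have /dG.2 /= := dG.1 (-1) _ _ Gb Ga.
    by rewrite ofRN ofR1 scaleN1r addNr nrm0 mulN1r; lra.
  by apply/eqP; rewrite eq_le !le.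
exists g; split.
- by move=> t u v; apply/esym/uniq; exact: (dG.1 t (u, g u) (v, g v)).
- by move=> v; exact: (dG.2 (v, g v)).
- by apply/esym/uniq/G0G.
Qed.

End HahnBanach.

Section NormingFunctional.
Variable R : realType.

Lemma real_norming (V : normedModType (scalar_field R RealScalars)) (y : V) :
  exists l : dual V, nrm l <= 1 /\ l y = ofR RealScalars (nrm y).
Proof.
have [g [glin gle gy]] := real_norming_functional y.
have gN v : g (- v) = - g v.
  have g0 : g 0 = 0.
    by have := glin (-1) 0 0; rewrite scaler0 addr0 mulN1r addNr.
  by have := glin (-1) v 0; rewrite g0 /= scaleN1r !addr0 mulN1r.
have gb (v : V) : nrm (g v : scalar_field R RealScalars) <= 1 * nrm v.
  rewrite mul1r /nrm/= ler_norml lerNl -gN (le_trans (gle _)) ?gle//.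
  by rewrite nrmN.
have lin : linear (g : V -> scalar_field R RealScalars).
  by move=> a u v; exact: glin.
exists (Bop (linear_bounded_bop lin gb)); split; last exact: gy.
exact: bop_nrm_le.
Qed.

(** A complex functional is recovered from its real part g as
    v |-> g(v) - i g(i v); rotating v makes the value real, so that the bound on
    g passes to it. *)
Lemma complex_norming (V : normedModType (scalar_field R ComplexScalars)) (y : V) :
  exists l : dual V, nrm l <= 1 /\ l y = ofR ComplexScalars (nrm y).
Proof.
have [g [glin gle gy]] := real_norming_functional y.
pose I : R[i] := Complex 0 1.
pose f v : scalar_field R ComplexScalars := Complex (g v) (- g ((I : scalar_field R ComplexScalars) *: v)).
have g0 : g 0 = 0.
  have := glin (-1) 0 0; rewrite scaler0 addr0 mulN1r => h; lra.
have gD u v : g (u + v) = g u + g v.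
  by have := glin 1 u v; rewrite ofR1 scale1r mul1r.
have gZ t v : g (ofR ComplexScalars t *: v) = t * g v.
  by have := glin t v 0; rewrite !addr0 g0 addr0.
have gN v : g (- v) = - g v by have := gD v (- v); rewrite subrr g0 => h; lra.
have fD u v : f (u + v) = f u + f v.
  by rewrite /f scalerDr !gD opprD.
have aE (a : R[i]) : a = ofR ComplexScalars (complex.Re a) + I * ofR ComplexScalars (complex.Im a).
  by case: a => a b; rewrite /I /=; apply/eqP; rewrite eq_complex /=; apply/andP; split; apply/eqP; ring.
have II : I * I = -1.
  by rewrite /I; apply/eqP; rewrite eq_complex /=; apply/andP; split; apply/eqP; ring.
have fZ (a : scalar_field R ComplexScalars) v : f (a *: v) = a * f v.
  rewrite [a]aE scalerDl fD mulrDl; congr (_ + _).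
    rewrite /f gZ [I *: (_ *: _)]scalerA [I * _]mulrC -scalerA gZ.
    by apply/eqP; rewrite eq_complex /=; apply/andP; split; apply/eqP; ring.
  rewrite /f scalerA [I * (I * _)]mulrA II mulN1r scaleNr gN gZ.
  rewrite (_ : I * _ = ofR ComplexScalars (complex.Im a) *
    (I : scalar_field R ComplexScalars)); last exact: mulrC.
  rewrite -scalerA gZ.
  by apply/eqP; rewrite eq_complex /=; apply/andP; split; apply/eqP; ring.
have lin : linear f by move=> a u v; rewrite fD fZ.
have fb (v : V) : nrm (f v) <= 1 * nrm v.
  rewrite mul1r; have [->|fv0] := eqVneq (f v) 0; first by rewrite nrm0 nrm_ge0.
  pose th := ofR ComplexScalars (nrm (f v)) * (f v)^-1.
  have nth : nrm th = 1.
    rewrite /th nrmM nrmV nrm_ofR ger0_norm ?nrm_ge0// mulfV//.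
    by apply: contra_neq fv0 => /nrm0_eq0.
  have := gle (th *: v); rewrite nrmZ nth mul1r; apply: le_trans.
  have : f (th *: v) = ofR ComplexScalars (nrm (f v)) by rewrite fZ /th mulfVK.
  by move=> /(congr1 (@complex.Re R)) /= ->.
exists (Bop (linear_bounded_bop lin fb)); split.
  exact: bop_nrm_le.
rewrite /=; have := fb y; rewrite mul1r.
have [_ _ _] := complex_parts_le (f y).
rewrite /nrm /f /= gy; set b := - g _.
(* The real part of f y is already |y|, so |f y| <= |y| kills the imaginary part. *)
move=> h; have h1 : Num.sqrt (nrm y ^+ 2 + b ^+ 2) <= nrm y by [].
have b0 : b = 0.
  have : nrm y ^+ 2 + b ^+ 2 <= nrm y ^+ 2.
    rewrite -(@ler_sqrt _ _ (nrm y ^+ 2)) ?sqr_ge0//.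
    by rewrite [X in _ <= X]sqrtr_sqr ger0_norm ?nrm_ge0.
  rewrite gerDl => b2; apply/eqP; rewrite -sqrf_eq0 eq_le b2 sqr_ge0//.
by rewrite b0.
Qed.

End NormingFunctional.

Section BidualEmbedding.
Variables (R : realType) (k : scalar_kind).
Notation K := (scalar_field R k).

Lemma norming_functional (V : normedModType K) (y : V) :
  exists l : dual V, nrm l <= 1 /\ l y = ofR k (nrm y).
Proof. by move: V y; case: k; [exact: real_norming|exact: complex_norming]. Qed.

Lemma nrm_to_bidual (V : normedModType K) (y : V) : nrm (to_bidual y) = nrm y.
Proof.
apply/eqP; rewrite eq_le; apply/andP; split.
  apply: bop_nrm_le (nrm_ge0 _) _ => l; rewrite mulrC.
  exact: (bop_nrm_bound l y).
have [l [l1 ly]] := norming_functional y.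
have := bop_nrm_bound (to_bidual y) l.
rewrite /= ly nrm_ofR ger0_norm ?nrm_ge0// => /le_trans; apply.
by rewrite ler_piMr ?nrm_ge0.
Qed.

Lemma to_bidualB (V : normedModType K) (x y : V) :
  to_bidual (x - y) = to_bidual x - to_bidual y.
Proof. by apply: bopP => l; exact: (linearB l). Qed.

Lemma to_bidual_lin (V : normedModType K) (a : K) (x y : V) :
  to_bidual (a *: x + y) = a *: to_bidual x + to_bidual y.
Proof. by apply: bopP => l; exact: (linearP l). Qed.

Lemma to_bidual_inj (V : normedModType K) : injective (@to_bidual R k V).
Proof.
move=> x y xy; apply/eqP; rewrite -subr_eq0; apply/eqP/nrm0_eq0.
by rewrite -nrm_to_bidual to_bidualB xy subrr nrm0.
Qed.

Lemma to_bidual_range_closed (V : completeNormedModType K) (u : nat -> V)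
    (w : bidual V) :
  (fun n => to_bidual (u n)) @ \oo --> w -> exists y : V, w = to_bidual y.
Proof.
move=> uw.
have [y uy] : exists y : V, u @ \oo --> y.
  apply: completeNormedMod_nrm_complete => e /(cvg_nrm_cauchy uw)[N NP].
  by exists N => n m Nn Nm; rewrite -nrm_to_bidual to_bidualB NP.
exists y; apply: (@cvg_unique _ (@norm_hausdorff _ (bidual V)) _ _ _ _ uw).
apply/cvg_nrmP => e e0; move/cvg_nrmP : uy => /(_ _ e0).
by apply: filterS => n; rewrite -nrm_to_bidual to_bidualB.
Qed.

End BidualEmbedding.

(** * Borel sets and finite nets *)

Section BorelSets.
Variable Omega : topologicalType.
Implicit Types A B : set Omega.

Lemma borel0 : borel (set0 : set Omega).
Proof. exact: sigma_algebra0. Qed.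

Lemma borelC A : borel A -> borel (~` A).
Proof. by rewrite -setTD; exact: sigma_algebraCD. Qed.

Lemma borel_bigcup (F : nat -> set Omega) : (forall n, borel (F n)) ->
  borel (\bigcup_n F n).
Proof. by move=> FB; exact: sigma_algebra_bigcup. Qed.

Lemma borelU A B : borel A -> borel B -> borel (A `|` B).
Proof.
move=> bA bB; rewrite -bigcup2E; apply: borel_bigcup => -[|[|n]]//=.
exact: borel0.
Qed.

Lemma borelT : borel [set: Omega].
Proof. by rewrite -setC0; apply: borelC; exact: borel0. Qed.

Lemma borelI A B : borel A -> borel B -> borel (A `&` B).
Proof.
move=> bA bB; rewrite -[A `&` B]setCK setCI.
by apply: borelC; apply: borelU; exact: borelC.
Qed.

Lemma borelD A B : borel A -> borel B -> borel (A `\` B).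
Proof. by move=> bA bB; rewrite setDE; apply: borelI => //; exact: borelC. Qed.

Lemma borel_open A : open A -> borel A.
Proof. by move=> oA; exact: sub_sigma_algebra. Qed.

Lemma borel_closed A : closed A -> borel A.
Proof. by move=> cA; rewrite -[A]setCK; apply: borelC; apply: borel_open; exact: closed_openC. Qed.

Lemma borel_forall (T : finType) (F : T -> set Omega) (P : pred T) :
  (forall i, borel (F i)) -> borel [set w | forall i, P i -> F i w].
Proof.
move=> bF.
have h (s : seq T) : borel [set w | forall i, i \in s -> P i -> F i w].
  elim: s => [|t s ih].
    by rewrite (_ : [set _ | _] = setT) ?eqEsubset; [exact: borelT|split].
  have [Pt|Pt] := boolP (P t).
    rewrite (_ : [set _ | _] = F t `&` [set w | forall i, i \in s -> P i -> F i w]).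
      exact: borelI.
    apply/seteqP; split=> w /= h.
      split; first by apply: h => //; rewrite mem_head.
      by move=> i si; apply: h; rewrite in_cons si orbT.
    move=> i; rewrite in_cons => /predU1P[-> _|]; first exact: h.1.
    exact: h.2.
  rewrite (_ : [set _ | _] = [set w | forall i, i \in s -> P i -> F i w])//.
  apply/seteqP; split=> w /= h i si; first by apply: h; rewrite in_cons si orbT.
  by move: si; rewrite in_cons => /predU1P[->|/h//]; rewrite (negbTE Pt).
rewrite (_ : [set _ | _] = [set w | forall i, i \in enum T -> P i -> F i w])//.
by apply/seteqP; split=> w /= Fw i; [move=> _; exact: Fw|apply: Fw; rewrite mem_enum].
Qed.

(** Compactness in a form that produces indexed centres. The near-covering
    property is applied to the filter of all sequences that contain a given
    one. *)
Lemma finite_net (Ocpt : compact [set: Omega]) (N : Omega -> set Omega) :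
  (forall w, nbhs w (N w)) ->
  exists n (c : 'I_n -> Omega), forall w, exists i, N (c i) w.
Proof.
move=> nN; pose F := filter_from [set: seq Omega]
  (fun s0 => [set s : seq Omega | {subset s0 <= s}]).
have FF : Filter F.
  apply: filter_from_filter; first by exists [::].
  move=> s t _ _; exists (s ++ t) => // u /= stu.
  by split=> x xs; apply: stu; rewrite mem_cat xs ?orbT.
move/compact_near_coveringP : Ocpt => /(_ _ F (fun s x => exists2 c, c \in s & N c x) FF).
move=> [|s _ /(_ s (fun _ => id)) sN].
  move=> x _; exists (N x, [set s : seq Omega | x \in s]) => /=.
    by split; [exact: nN|exists [:: x] => // s /= xs; apply: xs; rewrite inE].
  by move=> [y s] /= [Ny xs]; exists x.
case: s sN => [|w0 s] sN.
  exists 0%N, (fun i : 'I_0 => False_rect _ (notF (ltn_ord i))) => w.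
  by have [] := sN w Logic.I.
exists (size s).+1, (fun i => nth w0 (w0 :: s) i) => w.
have [c cs Nc] := sN w Logic.I.
have i0 : (index c (w0 :: s) < (size s).+1)%N by rewrite -[X in (_ < X)%N]/(size (w0 :: s)) index_mem.
by exists (Ordinal i0); rewrite [nat_of_ord _]/= nth_index.
Qed.

End BorelSets.

(** * Sums with bounded coefficients *)

Section SubsetSums.
Variables (R : realType) (k : scalar_kind).
Notation K := (scalar_field R k).
Variable Z : normedModType K.

(** The sum is affine in each coefficient, so on the cube its norm is largest at
    a vertex, where it is a partial sum over a subset. *)
Lemma seq_convex_sum (T : eqType) (s : seq T) (x : T -> Z) (t : T -> R) (M : R) y :
  uniq s -> (forall i, 0 <= t i <= 1) ->
  (forall P : pred T, nrm (y + \sum_(i <- s | P i) x i) <= M) ->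
  nrm (y + \sum_(i <- s) ofR k (t i) *: x i) <= M.
Proof.
move=> + t01; elim: s y => [|i s ih] y /=.
  by move=> _ /(_ xpredT); rewrite !big_nil.
move=> /andP[nis us] sM; rewrite big_cons; set S := \sum_(_ <- _) _.
have h0 : nrm (y + S) <= M.
  apply: ih => // P; have := sM (predI (predC1 i) P); rewrite big_cons /= eqxx /=.
  congr (nrm (y + _) <= M); rewrite big_seq_cond [RHS]big_seq_cond.
  apply: eq_bigl => j /=; case: (boolP (j \in s)) => //= js.
  by case: eqP => // ji; move: nis; rewrite -ji js.
have h1 : nrm (y + x i + S) <= M.
  apply: ih => // P; have := sM (predU (pred1 i) P); rewrite big_cons /= eqxx /=.
  rewrite addrA; congr (nrm (_ + _) <= M); rewrite big_seq_cond [RHS]big_seq_cond.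
  apply: eq_bigl => j /=; case: (boolP (j \in s)) => //= js.
  by case: eqP => // ji; move: nis; rewrite -ji js.
have /andP[ti0 ti1] := t01 i.
have -> : y + (ofR k (t i) *: x i + S) =
    ofR k (1 - t i) *: (y + S) + ofR k (t i) *: (y + x i + S).
  rewrite ofRD ofRN ofR1 scalerBl scale1r addrAC -addrA -scalerBr.
  have -> : y + x i + S - (y + S) = x i by rewrite [y + x i + S]addrAC [y + S + x i]addrC addrK.
  by rewrite -addrA [S + _]addrC.
rewrite (le_trans (nrmD _ _))// !nrmZ !nrm_ofR !ger0_norm ?subr_ge0//.
have h0' := ler_wpM2l (_ : 0 <= 1 - t i) h0.
have h1' := ler_wpM2l ti0 h1.
rewrite (le_trans (lerD (h0' _) h1')) ?subr_ge0//.
by rewrite -mulrDl subrK mul1r.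
Qed.

Lemma convex_sum (T : finType) (x : T -> Z) (t : T -> R) (M : R) :
  (forall i, 0 <= t i <= 1) ->
  (forall P : pred T, nrm (\sum_(i | P i) x i) <= M) ->
  nrm (\sum_i ofR k (t i) *: x i) <= M.
Proof.
move=> t01 xM; rewrite -[X in nrm X]add0r; apply: seq_convex_sum => //.
  exact: index_enum_uniq.
by move=> P; rewrite add0r; exact: xM.
Qed.

Lemma real_ball_sum (T : finType) (x : T -> Z) (t : T -> R) (M : R) :
  (forall i, `|t i| <= 1) ->
  (forall P : pred T, nrm (\sum_(i | P i) x i) <= M) ->
  nrm (\sum_i ofR k (t i) *: x i) <= 2 * M.
Proof.
move=> t1 xM.
have -> : \sum_i ofR k (t i) *: x i =
    \sum_i ofR k (Num.max (t i) 0) *: x i - \sum_i ofR k (Num.max (- t i) 0) *: x i.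
  rewrite -sumrB; apply: eq_bigr => i _; rewrite -scalerBl -ofRN -ofRD.
  congr (ofR k _ *: _); rewrite !maxEle; case: (leP (t i) 0) => ti.
    by case: leP => ?; lra.
  by case: leP => ?; lra.
rewrite (le_trans (nrmD _ _))// nrmN mulr_natl mulr2n lerD//;
  by apply: convex_sum => // i; rewrite le_max lexx orbT ge_max ler01;
     have := t1 i; rewrite ler_norml => /andP[? ?]; apply/andP; split => //; lra.
Qed.

(** [J] is i over the complex numbers and 0 over the reals. *)
Lemma scalar_parts : exists2 J : K, nrm J <= 1 &
  forall a : K, nrm a <= 1 ->
    exists r s : R, [/\ `|r| <= 1, `|s| <= 1 & a = ofR k r + J * ofR k s].
Proof.
case: (k).
  exists 0; first by rewrite nrm0 ler01.
  by move=> a a1; exists a, 0; split; rewrite ?normr0 ?ler01 ?mul0r ?addr0.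
exists ('i%C : R[i]).
  by have [_ _ h] := complex_parts_le ('i%C : R[i]); rewrite (le_trans h)//= normr0 add0r normr1.
move=> a a1; have [h1 h2 _] := complex_parts_le a.
exists (complex.Re a), (complex.Im a); split; [exact: le_trans h1 a1|exact: le_trans h2 a1|].
case: {a1 h1 h2} a => a b /=; apply/eqP; rewrite eq_complex /=.
by apply/andP; split; apply/eqP; ring.
Qed.

(** The constant 4 counts the positive and negative parts of the real and
    imaginary parts of the coefficients. *)
Lemma scalar_ball_sum (T : finType) (x : T -> Z) (c : T -> K) (M C : R) :
  0 <= C -> (forall i, nrm (c i) <= C) ->
  (forall P : pred T, nrm (\sum_(i | P i) x i) <= M) ->
  nrm (\sum_i c i *: x i) <= 4 * M * C.
Proof.
move=> C0 cC xM.
have [C00|C1] := eqVneq C 0.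
  rewrite big1 ?nrm0 ?C00 ?mulr0// => i _.
  have /nrm0_eq0 -> : nrm (c i) = 0; last by rewrite scale0r.
  by apply/eqP; rewrite eq_le nrm_ge0 andbT -C00.
have Cp : 0 < C by rewrite lt_def C1.
have [J J1 JP] := scalar_parts.
have c1 i : nrm (ofR k C^-1 * c i) <= 1.
  by rewrite nrmM nrm_ofR ger0_norm ?invr_ge0// ler_pdivrMl// mulr1.
have [r rP] := choice (fun i => JP _ (c1 i)); have [s sP] := choice rP.
have -> : \sum_i c i *: x i = ofR k C *: (\sum_i ofR k (r i) *: x i +
    J *: \sum_i ofR k (s i) *: x i).
  rewrite scaler_sumr -big_split scaler_sumr; apply: eq_bigr => i _ /=.
  have [_ _ /esym E] := sP i.
  by rewrite scalerA -scalerDl E scalerA mulrA -ofRM mulfV// ofR1 mul1r.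
have M0 : 0 <= M by rewrite (le_trans (nrm_ge0 _) (xM xpredT)).
have hr : nrm (\sum_i ofR k (r i) *: x i) <= 2 * M.
  by apply: real_ball_sum => // i; have [] := sP i.
have hs : nrm (\sum_i ofR k (s i) *: x i) <= 2 * M.
  by apply: real_ball_sum => // i; have [] := sP i.
rewrite nrmZ nrm_ofR ger0_norm// mulrC ler_wpM2r// (le_trans (nrmD _ _))//.
rewrite nrmZ (le_trans (lerD hr (ler_pM (nrm_ge0 _) (nrm_ge0 _) J1 hs)))//.
by rewrite mul1r -mulrDl; apply: ler_wpM2r; lra.
Qed.

End SubsetSums.

(** * Integration against a bounded finitely additive measure *)

Section SimpleIntegral.
Variables (R : realType) (k : scalar_kind) (Omega : topologicalType).
Notation K := (scalar_field R k).
Notation bsimple := (borel_simple R k Omega).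

Section Combinations.
Variable Z : normedModType K.

Lemma simple_comb (a : K) (s t : bsimple) : exists u : bsimple,
  (forall w, simple_fun u w = a * simple_fun s w + simple_fun t w) /\
  (forall (m : set Omega -> Z),
    simple_integral m u = a *: simple_integral m s + simple_integral m t).
Proof.
case: s t => [n c A bA] [n' c' A' bA'].
have bu (i : 'I_(n + n')) : borel (match fintype.split i with inl j => A j | inr j => A' j end).
  by case: fintype.split.
exists (@BorelSimple R k Omega (n + n')
  (fun i => match fintype.split i with inl j => a * c j | inr j => c' j end) _ bu).
have sl (i : 'I_n) : fintype.split (lshift n' i) = inl i.
  exact: (@unsplitK n n' (inl i)).
have sr (i : 'I_n') : fintype.split (rshift n i) = inr i.
  exact: (@unsplitK n n' (inr i)).
split=> [w|m].
  rewrite /simple_fun /= big_split_ord /= mulr_sumr.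
  by congr (_ + _); apply: eq_bigr => i _; rewrite ?sl ?sr ?mulrA.
rewrite /simple_integral /= big_split_ord /= scaler_sumr.
by congr (_ + _); apply: eq_bigr => i _; rewrite ?sl ?sr ?scalerA.
Qed.

Lemma simple_indic (A : set Omega) : borel A -> exists u : bsimple,
  (forall w, simple_fun u w = \1_A w) /\
  (forall (m : set Omega -> Z), simple_integral m u = m A).
Proof.
move=> bA; exists (@BorelSimple R k Omega 1 (fun _ => 1) (fun=> A) (fun=> bA)).
by split=> [w|m]; rewrite /simple_fun /simple_integral /= big_ord1 ?mul1r ?scale1r.
Qed.

End Combinations.

Lemma simple_restrict (D : set Omega) (s : bsimple) : borel D ->
  exists u : bsimple, forall w, simple_fun u w = \1_D w * simple_fun s w.
Proof.
case: s => [n c A bA] bD.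
exists (@BorelSimple R k Omega n c (fun i => D `&` A i) (fun i => borelI bD (bA i))) => w.
rewrite /simple_fun /= mulr_sumr; apply: eq_bigr => i _.
by rewrite indicI /= mulrCA.
Qed.

Variable Z : normedModType K.
Implicit Types m : set Omega -> Z.

(** The fibres of [signature] are the atoms of the finite algebra generated by
    the sets [A i]; a simple function is constant on each of them. *)
Definition signature n (A : 'I_n -> set Omega) (w : Omega) : {set 'I_n} :=
  [set i | w \in A i]%SET.

Lemma borel_signature n (A : 'I_n -> set Omega) (P : pred {set 'I_n}) :
  (forall i, borel (A i)) -> borel [set w | P (signature A w)].
Proof.
move=> bA.
have bS S : borel [set w | signature A w = S].
  rewrite (_ : [set _ | _] =
    [set w | forall i, xpredT i -> (if i \in S then A i else ~` A i) w]).
    by apply: borel_forall => i; case: ifP => _; [exact: bA|by apply: borelC].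
  apply/seteqP; split=> w /=.
    move=> <- i _; case: ifPn; rewrite inE ?inE//.
    by move=> /negP Aw Aw'; apply: Aw; rewrite inE.
  move=> wS; apply/setP => i; rewrite inE; have := wS i isT.
  case: ifPn => iS Aw; first exact: mem_set.
  by apply/negbTE/negP; rewrite inE.
rewrite (_ : [set _ | _] = ~` [set w | forall S, P S -> (~` [set w | signature A w = S]) w]).
  by apply: borelC; apply: borel_forall => S; exact: borelC.
apply/seteqP; split=> w /= h; first by move=> /(_ _ h); exact.
by apply: contrapT => Pw; apply: h => S PS wS; apply: Pw; rewrite wS.
Qed.

Lemma measure0 m : bounded_vector_measure m -> m set0 = 0.
Proof.
move=> [madd _]; have b0 := @borel0 Omega.
have := madd set0 set0 b0 b0 (setI0 _).
by rewrite setU0 => /eqP; rewrite addrC -subr_eq subrr eq_sym => /eqP.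
Qed.

Lemma measure_signature m n (A : 'I_n -> set Omega) (P : pred {set 'I_n}) :
  bounded_vector_measure m -> (forall i, borel (A i)) ->
  m [set w | P (signature A w)] = \sum_(S | P S) m [set w | signature A w = S].
Proof.
move=> bm bA; have m0 := measure0 bm; have [madd _] := bm.
have bS S : borel [set w | signature A w = S].
  have := borel_signature (pred1 S) bA; congr borel.
  by apply/seteqP; split=> w /= /eqP.
have h (s : seq {set 'I_n}) : uniq s ->
    m [set w | (signature A w \in s) && P (signature A w)] =
    \sum_(S <- s | P S) m [set w | signature A w = S].
  elim: s => [|S s ih] /=.
    by move=> _; rewrite big_nil -[RHS]m0; congr m; apply/seteqP; split.
  move=> /andP[Ss us]; rewrite big_cons -ih//.
  have bs := borel_signature (fun T => (T \in s) && P T) bA.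
  case: ifPn => PS.
    rewrite -madd//.
      congr m; apply/seteqP; split=> w /=.
        by rewrite in_cons => /andP[/predU1P[|ws Pw]]; [left|right; apply/andP].
      case=> [->|/andP[ws Pw]]; first by rewrite mem_head.
      by rewrite in_cons ws orbT.
    by apply/seteqP; split=> w //= [-> /andP[]]; rewrite (negbTE Ss).
  congr m; apply/seteqP; split=> w /= /andP[].
    rewrite in_cons => /predU1P[->|ws Pw]; first by rewrite (negbTE PS).
    by apply/andP.
  by move=> ws Pw; rewrite in_cons ws orbT.
have := h _ (index_enum_uniq _) => <-; congr m.
by apply/seteqP; split=> w /=; rewrite mem_index_enum.
Qed.

(** After rewriting the integral over the atoms, only non-empty atoms on which
    the function does not vanish contribute, and these lie inside [D]. So the
    estimate involves the measure on subsets of [D] only, which is what the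
    regularity argument uses. *)
Lemma simple_integral_bound m (D : set Omega) (M C : R) (s : bsimple) :
  bounded_vector_measure m -> 0 <= C ->
  (forall B, borel B -> B `<=` D -> nrm (m B) <= M) ->
  (forall w, nrm (simple_fun s w) <= C) ->
  (forall w, ~ D w -> simple_fun s w = 0) ->
  nrm (simple_integral m s) <= 4 * M * C.
Proof.
case: s => n a A bA bm C0 mM sC sD.
pose v (S : {set 'I_n}) := \sum_(i in S) a i.
have sv w : simple_fun (BorelSimple a bA) w = v (signature A w).
  rewrite /simple_fun /= /v [RHS]big_mkcond /=; apply: eq_bigr => i _.
  by rewrite inE indicE; case: (w \in A i); rewrite ?mulr1 ?mulr0.
pose atom S := [set w | signature A w = S].
(* On an empty atom the value v S is not bounded by C; it may be replaced by 0. *)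
pose c S := if `[< exists w, atom S w >] then v S else 0.
have -> : simple_integral m (BorelSimple a bA) = \sum_S c S *: m (atom S).
  rewrite /simple_integral /=.
  transitivity (\sum_S v S *: m (atom S)).
    transitivity (\sum_i \sum_(S : {set 'I_n} | i \in S) a i *: m (atom S)).
      apply: eq_bigr => i _; rewrite -scaler_sumr; congr (_ *: _).
      rewrite -(measure_signature _ bm bA); congr m.
      by apply/seteqP; split=> w /=; rewrite !inE.
    rewrite (exchange_big_dep xpredT) //=; apply: eq_bigr => S _.
    by rewrite /v scaler_suml.
  apply: eq_bigr => S _; rewrite /c; case: asboolP => // nS.
  have aS : atom S = set0.
    by apply/seteqP; split=> w //= wS; apply: nS; exists w.
  by have -> : m (atom S) = 0; rewrite ?aS ?(measure0 bm) ?scaler0.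
have cC S : nrm (c S) <= C.
  rewrite /c; case: asboolP => [[w wS]|_]; last by rewrite nrm0.
  by have := sC w; rewrite sv wS.
pose Q S := c S != 0.
rewrite (_ : \sum_S _ = \sum_S c S *: (if Q S then m (atom S) else 0)).
  apply: scalar_ball_sum => // P; rewrite -big_mkcondr /=.
  rewrite -(measure_signature _ bm bA); apply: mM; first exact: (borel_signature (fun S => P S && Q S) bA).
  move=> w /= /andP[_]; rewrite /Q /c.
  case: asboolP => [_|]; last by rewrite eqxx.
  by move=> vw; apply: contrapT => /sD/eqP; rewrite sv (negbTE vw).
apply: eq_bigr => S _; rewrite /Q; case: eqVneq => //= ->.
by rewrite !scale0r.
Qed.

End SimpleIntegral.

Section VectorIntegral.
Variables (R : realType) (k : scalar_kind) (Omega : topologicalType).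
Notation K := (scalar_field R k).
Notation bsimple := (borel_simple R k Omega).

Lemma uniform_nrmP (f : nat -> Omega -> K) (phi : Omega -> K) :
  {uniform, f @ \oo --> phi} <->
  (forall e : R, 0 < e -> \forall n \near \oo, forall w, nrm (phi w - f n w) < e).
Proof.
split=> [fphi e e0|fphi P /uniform_nbhs[E [entE EP]]].
  have : nbhs (phi : {uniform` setT -> K}) [set h | forall w, nrm (phi w - h w) < e].
    apply/uniform_nbhs; exists [set xy | nrm (xy.1 - xy.2) < e]; split.
      rewrite -entourage_ballE; exists (ofR k e) => /=.
        by rewrite -(ofR0 R) ofR_lt.
      by move=> [x y] /=; rewrite -ball_normE /ball_ /= -ofR_nrm ofR_lt.
    by move=> h /= hw w; exact: hw.
  exact: fphi.
move: entE; rewrite -entourage_ballE => -[e /= e0 eE].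
have er : ofR k (reK e) = e by rewrite reKK// gtr0_real.
have e0' : 0 < reK e by rewrite -(ofR_lt k) ofR0 er.
have := fphi _ e0'; apply: filterS => n fn; apply: EP => w _ /=; apply: eE => /=.
by rewrite -ball_normE /ball_ /= -ofR_nrm -er ofR_lt.
Qed.

(** Membership in B(Sigma), the uniform closure of the simple functions. *)
Definition borel_limit (phi : Omega -> K) := exists s : nat -> bsimple,
  {uniform, (fun n => simple_fun (s n)) @ \oo --> phi}.

Lemma continuous_borel_limit (Ocpt : compact [set: Omega]) (phi : Omega -> K) :
  continuous phi -> borel_limit phi.
Proof.
move=> cphi.
suff h (e : R) : 0 < e -> exists s : bsimple, forall w, nrm (phi w - simple_fun s w) < e.
  have [s sP] := choice (fun n => h n.+1%:R^-1 (ltac:(by rewrite invr_gt0))).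
  exists s; apply/uniform_nrmP => e e0.
  have [N _ NP] := near_infty_natSinv_lt (PosNum e0).
  by exists N => // n /NP /= ne w; rewrite (lt_trans (sP n w)).
move=> e0; pose N c := [set w | nrm (phi w - phi c) < e].
have oN c : open (N c).
  rewrite openE => w /= Nw; rewrite /interior.
  have d0 : 0 < e - nrm (phi w - phi c) by rewrite subr_gt0.
  have /cvg_nrmP/(_ _ d0) := cphi w; apply: filterS => z /=.
  rewrite /N/= ltrBrDr; apply: le_lt_trans; rewrite [nrm (phi w - phi z)]nrmB.
  have -> : phi z - phi c = (phi z - phi w) + (phi w - phi c) by rewrite addrA subrK.
  exact: nrmD.
have [n [c cP]] := finite_net Ocpt (fun w => (open_nbhs_nbhs (conj (oN w)
  (ltac:(by rewrite /N /= subrr nrm0) : N w w)))).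
have bN i : borel (N (c i) `&` [set w | forall j : 'I_n, (j < i)%N -> (~` N (c j)) w]).
  apply: borelI; first exact: borel_open.
  apply: (@borel_forall _ _ _ (fun j : 'I_n => (j < i)%N)) => j.
  by apply: borelC; exact: borel_open.
exists (@BorelSimple R k Omega n (fun i => phi (c i)) _ bN) => w.
have [i0 Ni0] := cP w.
(* The least index of a neighbourhood containing w selects its piece. *)
pose i := [arg min_(i < i0 | `[< N (c i) w >]) (i : nat)].
have [Ni imin] : N (c i) w /\ forall j, N (c j) w -> (i <= j)%N.
  rewrite /i; case: arg_minnP => [|j /asboolP Nj jmin]; first exact/asboolP.
  by split=> // l Nl; apply: jmin; exact/asboolP.
rewrite /simple_fun /= (bigD1 i)//= big1 => [|j ji].
  rewrite indicE mem_set ?mulr1 ?addr0//; split=> // j ji /imin.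
  by rewrite leqNgt ji.
rewrite indicE memNset ?mulr0// => -[Nj /= jlt].
have := imin _ Nj; rewrite leq_eqVlt => /predU1P[/val_inj ij|/jlt]; last exact.
by move: ji; rewrite ij eqxx.
Qed.

Section Integral.
Variable Z : normedModType K.
Hypothesis cZ : nrm_complete Z.
Variable m : set Omega -> Z.
Hypothesis bm : bounded_vector_measure m.

Lemma measure_bound : exists2 M : R, 0 < M & forall A, borel A -> nrm (m A) <= M.
Proof.
have [_ [M mM]] := bm; exists (M + 1); last first.
  by move=> A bA; rewrite (le_trans (mM _ bA))// lerDl.
by rewrite ltr_wpDl// (le_trans (nrm_ge0 _) (mM _ (@borel0 _))).
Qed.

Lemma simple_integral_dist (M C : R) (s t : bsimple) :
  (forall A, borel A -> nrm (m A) <= M) -> 0 <= C ->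
  (forall w, nrm (simple_fun s w - simple_fun t w) <= C) ->
  nrm (simple_integral m s - simple_integral m t) <= 4 * M * C.
Proof.
move=> mM C0 stC; have [u [fu Iu]] := simple_comb Z (-1) t s.
have -> : simple_integral m s - simple_integral m t = simple_integral m u.
  by rewrite Iu scaleN1r addrC.
apply: (@simple_integral_bound _ _ _ _ _ setT) => // [B bB _|w|w nw].
- exact: mM.
- by rewrite fu mulN1r addrC.
- by exfalso; exact: nw.
Qed.

(** Two sequences with the same uniform limit have integrals that get close, by
    the bound for simple functions. Hence the integrals converge and the limit
    does not depend on the sequence chosen in the definition. *)
Lemma vintegral_cvg (phi : Omega -> K) (s : nat -> bsimple) :
  {uniform, (fun n => simple_fun (s n)) @ \oo --> phi} ->
  (fun n => simple_integral m (s n)) @ \oo --> vintegral m phi.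
Proof.
have [M M0 mM] := measure_bound.
have close (t u : nat -> bsimple) (e : R) :
    {uniform, (fun n => simple_fun (t n)) @ \oo --> phi} ->
    {uniform, (fun n => simple_fun (u n)) @ \oo --> phi} -> 0 < e ->
    exists N, forall n n', (N <= n)%N -> (N <= n')%N ->
      nrm (simple_integral m (t n) - simple_integral m (u n')) < e.
  move=> /uniform_nrmP tphi /uniform_nrmP uphi e0.
  have d0 : 0 < e / (16 * M) by rewrite divr_gt0// mulr_gt0.
  have [N1 _ h1] := tphi _ d0; have [N2 _ h2] := uphi _ d0.
  exists (maxn N1 N2) => n n'; rewrite !geq_max => /andP[n1 _] /andP[_ n2].
  apply: (@le_lt_trans _ _ (4 * M * (e / (16 * M) + e / (16 * M)))).
    apply: simple_integral_dist => // [|w]; first by rewrite addr_ge0 ?ltW.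
    have -> : simple_fun (t n) w - simple_fun (u n') w =
        (phi w - simple_fun (u n') w) - (phi w - simple_fun (t n) w).
      by rewrite [RHS]addrC opprB addrA subrK.
    rewrite (le_trans (nrmD _ _))// nrmN lerD// ltW//; [exact: h2|exact: h1].
  have -> : 4 * M * (e / (16 * M) + e / (16 * M)) = e / 2 by field; rewrite gt_eqF.
  by rewrite ltr_pdivrMr// ltr_pMr// ltr1n.
move=> sphi; rewrite /vintegral; set S := [set z | _].
have [z Sz] : exists z, S z.
  have [|z sz] := cZ (u := fun n => simple_integral m (s n)).
    by move=> e e0; have [N NP] := close _ _ _ sphi sphi e0; exists N.
  by exists z, s.
have [t [tphi tz]] : S (xget 0 S) by exact: (xgetPex 0 (ex_intro _ z Sz)).
apply/cvg_nrmP => e e0.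
have e2 : 0 < e / 2 by rewrite divr_gt0.
have [N NP] := close _ _ _ tphi sphi e2.
have [N' _ NP'] : \forall n \near \oo, nrm (xget 0 S - simple_integral m (t n)) < e / 2.
  by move/cvg_nrmP : tz; exact.
exists (maxn N N') => // n /=; rewrite geq_max => /andP[n1 n2].
rewrite -(subrK (simple_integral m (t n)) (xget 0 S)) -addrA.
by rewrite (le_lt_trans (nrmD _ _))// (splitr e) ltrD//; [exact: NP'|exact: NP].
Qed.

Lemma vintegral_unique (phi : Omega -> K) (s : nat -> bsimple) z :
  {uniform, (fun n => simple_fun (s n)) @ \oo --> phi} ->
  (fun n => simple_integral m (s n)) @ \oo --> z -> vintegral m phi = z.
Proof.
move=> /vintegral_cvg h1 h2; exact: (cvg_unique (@norm_hausdorff _ Z) h1 h2).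
Qed.

Lemma vintegral_lin (a : K) (phi psi : Omega -> K) :
  borel_limit phi -> borel_limit psi ->
  vintegral m (fun w => a * phi w + psi w) =
  a *: vintegral m phi + vintegral m psi.
Proof.
move=> [s sphi] [t tpsi].
have [u uP] := choice (fun n => simple_comb Z a (s n) (t n)).
apply: (@vintegral_unique _ u).
  apply/uniform_nrmP => e e0.
  have a1 : 0 < nrm a + 1 by rewrite ltr_wpDl ?nrm_ge0.
  have d0 : 0 < e / ((nrm a + 1) * 2) by rewrite divr_gt0// mulr_gt0.
  have e2 : 0 < e / 2 by rewrite divr_gt0.
  move/uniform_nrmP : sphi => /(_ _ d0) h1; move/uniform_nrmP : tpsi => /(_ _ e2) h2.
  near=> n => w; rewrite (uP n).1.
  have -> : a * phi w + psi w - (a * simple_fun (s n) w + simple_fun (t n) w) =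
      a * (phi w - simple_fun (s n) w) + (psi w - simple_fun (t n) w).
    by rewrite mulrBr opprD addrACA.
  rewrite (le_lt_trans (nrmD _ _))// (splitr e) ler_ltD//; last first.
    by move: w; near: n.
  rewrite nrmM.
  apply: (@le_trans _ _ ((nrm a + 1) * (e / ((nrm a + 1) * 2)))).
    apply: ler_pM; rewrite ?nrm_ge0 ?lerDl// ltW//.
    by move: w; near: n.
  by rewrite le_eqVlt; apply/orP; left; apply/eqP; field; exact: lt0r_neq0.
rewrite (_ : (fun n => _) = fun n => a *: simple_integral m (s n) + simple_integral m (t n)).
  by apply: cvgD; [apply: cvgZl_tmp|]; exact: vintegral_cvg.
by apply/funext => n; rewrite (uP n).2.
Unshelve. all: by end_near. Qed.

Lemma vintegral_bound (phi : Omega -> K) (M C : R) :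
  (forall A, borel A -> nrm (m A) <= M) -> 0 <= C -> borel_limit phi ->
  (forall w, nrm (phi w) <= C) -> nrm (vintegral m phi) <= 4 * M * C.
Proof.
move=> mM C0 [s sphi] phiC.
have M0 : 0 <= M by rewrite (le_trans (nrm_ge0 _) (mM _ (@borel0 _))).
apply/ler_addgt0Pr => e e0.
have d0 : 0 < e / (4 * M + 1) by rewrite divr_gt0// ltr_wpDl// mulr_ge0.
apply: (@nrm_cvg _ _ _ _ \oo _ _ _ _ (vintegral_cvg sphi)).
move/uniform_nrmP : sphi => /(_ _ d0); apply: filterS => n sn.
apply: (@le_trans _ _ (4 * M * (C + e / (4 * M + 1)))).
  apply: (@simple_integral_bound _ _ _ _ _ setT) => // [|B bB _|w|w nw].
  - by rewrite addr_ge0// ltW.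
  - exact: mM.
  - rewrite -[simple_fun _ w](subrK (phi w)) (le_trans (nrmD _ _))// addrC lerD//.
    by rewrite nrmB ltW.
  - by exfalso; exact: nw.
rewrite mulrDr lerD2l mulrCA ler_piMr ?(ltW e0)//.
by rewrite ler_pdivrMr ?mul1r ?lerDl// ltr_wpDl// mulr_ge0.
Qed.

End Integral.

Lemma vintegral_bop (Z Z' : normedModType K) (m : set Omega -> Z) (T : bop Z Z')
    (phi : Omega -> K) : nrm_complete Z -> nrm_complete Z' ->
  bounded_vector_measure m -> borel_limit phi ->
  bounded_vector_measure (fun A => T (m A)) /\
  vintegral (fun A => T (m A)) phi = T (vintegral m phi).
Proof.
move=> cZ cZ' bm [s sphi].
have bT : bounded_vector_measure (fun A => T (m A)).
  have [madd [M mM]] := bm; split=> [A B bA bB AB|]; first by rewrite madd// linearD.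
  exists (nrm T * M) => A bA; rewrite (le_trans (bop_nrm_bound _ _))//.
  by rewrite ler_wpM2l ?nrm_ge0 ?mM.
split=> //; apply: (vintegral_unique cZ' bT sphi).
rewrite (_ : (fun n => _) = fun n => T (simple_integral m (s n))).
  apply: (cvg_comp _ _ (vintegral_cvg cZ bm sphi)).
  exact: bop_continuous.
apply/funext => n; rewrite /simple_integral linear_sum.
by apply: eq_bigr => i _; rewrite linearZ.
Qed.

End VectorIntegral.

(** * Regular measures are determined by continuous functions *)

Lemma ofR_cfun (R : realType) (k : scalar_kind) (Omega : topologicalType)
    (f : Omega -> R) : continuous f ->
  (fun w => ofR k (f w)) \in @cfun_pred R k Omega.
Proof.
move=> cf; apply/asboolP => w; apply/cvg_nrmP => d d0.
have /cvgrPdist_lt/(_ _ d0) := cf w; apply: filterS => z.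
by rewrite -ofRN -ofRD nrm_ofR.
Qed.

Section RegularUniqueness.
Variables (R : realType) (k : scalar_kind) (Omega : topologicalType).
Notation K := (scalar_field R k).
Notation bsimple := (borel_simple R k Omega).

(** The simple functions approximating phi are replaced by 1 on [C] and 0 off
    [U]; they still converge to phi, and their integrals differ from [mu C] by
    integrals over [U `\` C], where [mu] is small. The factor 8 is 4 times the
    bound 2 for the approximants. *)
Lemma integral_near_measure (mu : set Omega -> K) (C U : set Omega) (e : R)
    (phi : Omega -> K) :
  bounded_vector_measure mu -> borel C -> borel U -> C `<=` U ->
  (forall B, borel B -> B `<=` U `\` C -> nrm (mu B) < e) ->
  borel_limit phi -> (forall w, nrm (phi w) <= 1) ->
  (forall w, C w -> phi w = 1) -> (forall w, ~ U w -> phi w = 0) ->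
  nrm (vintegral mu phi - mu C) <= 8 * e.
Proof.
move=> bmu bC bU CU mue [s sphi] phi1 phiC phiU.
have bD : borel (U `\` C) by exact: borelD.
have [r rP] := choice (fun n => simple_restrict (s n) bD).
have [c [fc Ic]] := simple_indic K bC.
have [u uP] := choice (fun n => simple_comb K 1 (r n) c).
have uphi : {uniform, (fun n => simple_fun (u n)) @ \oo --> phi}.
  apply/uniform_nrmP => d d0; move/uniform_nrmP : sphi => /(_ _ d0).
  apply: filterS => n sn w; rewrite (uP n).1 mul1r rP fc !indicE.
  have [Cw|Cw] := boolP (w \in C).
    rewrite memNset => [|[_]]; last by move: Cw; rewrite inE.
    by rewrite mul0r add0r phiC ?subrr ?nrm0//; move: Cw; rewrite inE.
  have nC : ~ C w by move=> ?; move/negP : Cw; apply; rewrite inE.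
  have [Uw|Uw] := pselect (U w).
    by rewrite mem_set// mul1r addr0.
  by rewrite memNset => [|[]//]; rewrite mul0r addr0 phiU// subrr nrm0.
have := vintegral_cvg (@scalar_complete R k) bmu uphi => /cvg_nrmP h.
have e0 : 0 < e by rewrite (le_lt_trans (nrm_ge0 _) (mue _ (@borel0 _) (@sub0set _ _))).
apply: (@nrm_cvg R k K _ \oo _ (fun n => simple_integral mu (u n) - mu C)).
  by apply: cvgB; [apply/cvg_nrmP|exact: cvg_cst].
move/uniform_nrmP : sphi => /(_ _ ltr01); apply: filterS => n sn.
rewrite (uP n).2 scale1r Ic addrK.
have -> : 8 * e = 4 * e * 2 by ring.
apply: (simple_integral_bound bmu _ (D := U `\` C)) => // [B bB BD|w|w nD].
- by rewrite ltW// mue.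
- rewrite rP indicE; case: (w \in _); last by rewrite mul0r nrm0.
  rewrite mul1r -[simple_fun _ w](subrK (phi w)) (le_trans (nrmD _ _))//.
  by rewrite (_ : 2 = 1 + 1 :> R)// lerD// nrmB ltW.
- by rewrite rP indicE memNset// mul0r.
Qed.

(** The closed and open sets provided by the two regularities are combined, and
    a Urysohn function between them compares both measures with the same
    integral. *)
Lemma regular_measure_unique (Ocpt : compact [set: Omega])
    (Ohaus : hausdorff_space Omega) (mu nu : set Omega -> K) :
  regular_measure mu -> regular_measure nu ->
  (forall phi : cfun_of R k Ocpt, vintegral mu phi = vintegral nu phi) ->
  forall A, borel A -> mu A = nu A.
Proof.
move=> [bmu _ rmu] [bnu _ rnu] munu A bA.
apply/eqP; rewrite -subr_eq0; apply/eqP/(@nrm_small0 R k) => e e0.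
(* 18 = 2 * (8 + 1): for each measure, the integral and the set A minus C. *)
have d0 : 0 < e / 18 by rewrite divr_gt0.
have [C1 [U1 [cC1 oU1 C1A AU1 h1]]] := rmu _ bA _ d0.
have [C2 [U2 [cC2 oU2 C2A AU2 h2]]] := rnu _ bA _ d0.
pose C := C1 `|` C2; pose U := U1 `&` U2.
have cC : closed C by exact: closedU.
have oU : open U by exact: openI.
have CA : C `<=` A by move=> w [/C1A|/C2A].
have AU : A `<=` U by move=> w Aw; split; [exact: AU1|exact: AU2].
have [bC bU] : borel C /\ borel U.
  by split; [exact: borel_closed|exact: borel_open].
have h1' B : borel B -> B `<=` U `\` C -> nrm (mu B) < e / 18.
  by move=> bB BU; apply: h1 => // w /BU[[? ?] nC]; split => // ?; apply: nC; left.
have h2' B : borel B -> B `<=` U `\` C -> nrm (nu B) < e / 18.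
  by move=> bB BU; apply: h2 => // w /BU[[? ?] nC]; split => // ?; apply: nC; right.
have [f [cf f01 f0 f1]] : exists f : Omega -> R,
    [/\ continuous f, forall w, 0 <= f w <= 1,
      forall w, ~ U w -> f w = 0 & forall w, C w -> f w = 1].
  have /normal_separatorP ns := compact_normal Ohaus Ocpt.
  have us : uniform_separator (~` U) C.
    apply: (ns R) => //; first exact: open_closedC.
    by rewrite setIC; apply/disjoints_subset; rewrite setCK; exact: subset_trans AU.
  have /(@uniform_separatorP _ R)[f [cf f01 f0 f1]] := us.
  exists f; split => // w.
  - by have := f01 (f w) (ex_intro2 _ _ w Logic.I erefl); rewrite /= in_itv.
  - by move=> Uw; exact: (f0 _ (ex_intro2 _ _ w Uw erefl)).
  - by move=> Cw; exact: (f1 _ (ex_intro2 _ _ w Cw erefl)).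
pose phi : cfun_of R k Ocpt := Cfun Ocpt (ofR_cfun k cf).
have bl : borel_limit phi.
  exact: (continuous_borel_limit Ocpt (@cfun_continuous R k Omega Ocpt phi)).
have phi1 w : nrm (phi w) <= 1.
  by rewrite /phi /= nrm_ofR; have /andP[? ?] := f01 w; rewrite ger0_norm.
have phiC w : C w -> phi w = 1 by move=> Cw; rewrite /phi /= f1// ofR1.
have phiU w : ~ U w -> phi w = 0 by move=> Uw; rewrite /phi /= f0// ofR0.
have CU : C `<=` U := subset_trans CA AU.
have k1 := integral_near_measure bmu bC bU CU h1' bl phi1 phiC phiU.
have k2 := integral_near_measure bnu bC bU CU h2' bl phi1 phiC phiU.
have bAC : borel (A `\` C) by exact: borelD.
have ACU : A `\` C `<=` U `\` C by move=> w [/AU].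
have AE (la : set Omega -> K) : bounded_vector_measure la -> la A = la C + la (A `\` C).
  move=> [ladd _]; rewrite -ladd//.
    by congr la; apply/seteqP; split=> [w Aw|w [/CA|[]]//]; have [|] := pselect (C w); [left|right].
  by apply/seteqP; split=> // w [Cw []].
rewrite (AE _ bmu) (AE _ bnu).
have -> : mu C + mu (A `\` C) - (nu C + nu (A `\` C)) =
   (vintegral nu phi - nu C) - (vintegral mu phi - mu C) + (mu (A `\` C) - nu (A `\` C)).
  by rewrite (munu phi); ring.
have k3 := h1' _ bAC ACU; have k4 := h2' _ bAC ACU.
rewrite (le_trans (nrmD _ _))// (le_trans (lerD (nrmD _ _) (nrmD _ _)))// !nrmN.
rewrite (le_trans (lerD (lerD k2 k1) (lerD (ltW k3) (ltW k4))))//.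
by lra.
Qed.

End RegularUniqueness.

(** * Sequences in l_p *)

Section LpCalculus.
Variables (R : realType) (k : scalar_kind).
Notation K := (scalar_field R k).
Implicit Types (V W : normedModType K) (q : \bar R) (A B C : R).

Lemma lp_mono V W q (x : nat -> V) (y : nat -> W) C : (1 <= q)%E -> 0 <= C ->
  (forall n, nrm (x n) <= nrm (y n)) ->
  (lp_norm q y <= C%:E)%E -> (lp_norm q x <= C%:E)%E.
Proof.
move=> + C0 xy; case: q => [r||//] r1.
  have r0 : 0 < r by rewrite (lt_le_trans ltr01)// -lee_fin.
  move=> /(lp_fin_le y r0 C0) yC; apply/lp_fin_le => // m.
  apply: le_trans (yC m); apply: ler_sum => i _.
  by rewrite ge0_ler_powR ?nnegrE ?nrm_ge0// ltW.
move=> /lp_oo_le yC; apply/lp_oo_le => i.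
by rewrite (le_trans (xy i)).
Qed.

Lemma lp_normD V q (x y : nat -> V) A B : (1 <= q)%E -> 0 <= A -> 0 <= B ->
  (lp_norm q x <= A%:E)%E -> (lp_norm q y <= B%:E)%E ->
  (lp_norm q (fun n => x n + y n)%R <= (A + B)%:E)%E.
Proof.
move=> q1 A0 B0 xA yB.
pose f n : R := nrm (x n); pose g n : R := nrm (y n).
apply: (@lp_mono _ K _ _ (fun n => ofR k (f n + g n))) => //.
- by rewrite addr_ge0.
- by move=> n; rewrite nrm_ofR ger0_norm ?nrmD// addr_ge0 ?nrm_ge0.
rewrite EFinD (le_trans _ (leeD xA yB))//.
have := @eminkowski _ _ R (@counting nat R) f g q (ltac:(by [])) (ltac:(by [])) q1.
rewrite /lp_norm; congr (_ <= _)%E; congr Lnorm.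
by apply/funext => n /=; rewrite nrm_ofR ger0_norm// addr_ge0 ?nrm_ge0.
Qed.

Lemma lp_norm_cst0 V q C : (1 <= q)%E -> 0 <= C ->
  (lp_norm q (fun=> 0%R : V) <= C%:E)%E.
Proof. by move=> q1 C0; rewrite (le_trans (lp_norm0 V q1)) ?lee_fin. Qed.

Lemma lp_norm_conv V q (I : finType) (t : I -> R) (x : I -> nat -> V) C :
  (1 <= q)%E -> 0 <= C -> (forall i, 0 <= t i) -> \sum_i t i = 1 ->
  (forall i, (lp_norm q (x i) <= C%:E)%E) ->
  (lp_norm q (fun n => \sum_i ofR k (t i) *: x i n)%R <= C%:E)%E.
Proof.
move=> q1 C0 t0 t1 xC.
have h (s : seq I) : (lp_norm q (fun n => \sum_(i <- s) ofR k (t i) *: x i n)%R <=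
    ((\sum_(i <- s) t i) * C)%:E)%E.
  elim: s => [|i s ih].
    rewrite big_nil mul0r (_ : (fun n => _) = fun=> 0); first exact: lp_norm_cst0.
    by apply/funext => n; rewrite big_nil.
  rewrite big_cons mulrDl.
  rewrite (_ : (fun n => _) = fun n => ofR k (t i) *: x i n +
      \sum_(j <- s) ofR k (t j) *: x j n); last first.
    by apply/funext => n; rewrite big_cons.
  apply: lp_normD => //.
  - by rewrite mulr_ge0.
  - by rewrite mulr_ge0// sumr_ge0.
  - have := lp_normZ (ofR k (t i)) q1 C0 (xC i).
    by rewrite nrm_ofR ger0_norm.
by have := h (index_enum I); rewrite t1 mul1r.
Qed.

Lemma lp_coord V q (x : nat -> V) C n : (1 <= q)%E -> 0 <= C ->
  (lp_norm q x <= C%:E)%E -> nrm (x n) <= C.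
Proof.
move=> + C0; case: q => [r||//] r1; last by move=> /lp_oo_le; exact.
have r0 : 0 < r by rewrite (lt_le_trans ltr01)// -lee_fin.
move=> /(lp_fin_le x r0 C0)/(_ n.+1) xC.
have {}xC : nrm (x n) `^ r <= C `^ r.
  apply: le_trans xC; rewrite big_nat_recr//= lerDr sumr_ge0// => i _.
  exact: powR_ge0.
rewrite leNgt; apply/negP => Cx; move: xC; rewrite leNgt => /negP; apply.
by apply: gt0_ltr_powR => //; rewrite ?nnegrE ?nrm_ge0.
Qed.

Definition upto V N (x : nat -> V) n := if (n < N)%N then x n else 0.
Definition beyond V N (x : nat -> V) n := if (n < N)%N then 0 else x n.

Lemma lp_upto V q N (x : nat -> V) C : (1 <= q)%E -> 0 <= C ->
  (lp_norm q x <= C%:E)%E -> (lp_norm q (upto N x) <= C%:E)%E.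
Proof.
move=> q1 C0; apply: lp_mono => // n.
by rewrite /upto; case: ifP; rewrite ?nrm0 ?nrm_ge0.
Qed.

Lemma lp_beyond V q N (x : nat -> V) C : (1 <= q)%E -> 0 <= C ->
  (lp_norm q x <= C%:E)%E -> (lp_norm q (beyond N x) <= C%:E)%E.
Proof.
move=> q1 C0; apply: lp_mono => // n.
by rewrite /beyond; case: ifP; rewrite ?nrm0 ?nrm_ge0.
Qed.

Lemma lp_le_upto V q (x : nat -> V) C : (1 <= q)%E -> 0 <= C ->
  (forall N, lp_norm q (upto N x) <= C%:E)%E -> (lp_norm q x <= C%:E)%E.
Proof.
move=> + C0; case: q => [r||//] r1.
  have r0 : 0 < r by rewrite (lt_le_trans ltr01)// -lee_fin.
  move=> h; apply/lp_fin_le => // m.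
  have /(lp_fin_le _ r0 C0)/(_ m) := h m; apply: le_trans.
  by apply: ler_sum_nat => i /andP[_ im]; rewrite /upto im.
move=> h; apply/lp_oo_le => i; have /lp_oo_le/(_ i) := h i.+1.
by rewrite /upto ltnSn.
Qed.

Lemma lp_upto_small V q N (x : nat -> V) e : (1 <= q)%E -> 0 <= e ->
  (forall n, (n < N)%N -> nrm (x n) <= e) ->
  (lp_norm q (upto N x) <= (N%:R * e)%:E)%E.
Proof.
move=> q1 e0; elim: N => [|N ih] xe.
  rewrite mul0r (_ : upto 0 x = fun=> 0) ?lp_norm_cst0//.
rewrite -natr1 mulrDl mul1r.
pose y n := if n == N then x N else 0.
rewrite (_ : upto N.+1 x = fun n => upto N x n + y n); last first.
  apply/funext => n; rewrite /upto /y ltnS; case: ltngtP => [nN|nN|->].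
  - by rewrite addr0.
  - by rewrite addr0.
  - by rewrite add0r.
apply: lp_normD => //.
- by rewrite mulr_ge0.
- by apply: ih => n nN; apply: xe; rewrite ltnS ltnW.
have xN : nrm (x N) <= e by exact: xe.
case: q q1 {ih} => [r||//] r1; last first.
  by apply/lp_oo_le => n; rewrite /y; case: eqP; rewrite ?nrm0.
have r0 : 0 < r by rewrite (lt_le_trans ltr01)// -lee_fin.
apply/lp_fin_le => // m.
apply: (@le_trans _ _ (\sum_(0 <= i < m) if i == N then e `^ r else 0)).
  apply: ler_sum => i _; rewrite /y; case: eqP => _.
    by rewrite ge0_ler_powR ?nnegrE ?nrm_ge0// ltW.
  by rewrite nrm0 powR0 ?gt_eqF.
rewrite -big_mkcond /= big_nat1_eq.
by case: ifP; rewrite ?powR_ge0.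
Qed.

(** The unit ball of l_q is closed for coordinatewise convergence: on finitely
    many coordinates this convergence is convergence in norm. *)
Lemma lp_pointwise_limit V q (T : Type) (F : set_system T) (FF : ProperFilter F)
    (a : T -> nat -> V) (b : nat -> V) C : (1 <= q)%E -> 0 <= C ->
  (\forall t \near F, (lp_norm q (a t) <= C%:E)%E) ->
  (forall n, (fun t => a t n) @ F --> b n) ->
  (lp_norm q b <= C%:E)%E.
Proof.
move=> q1 C0 aC ab; apply: lp_le_upto => // N.
apply/lee_addgt0Pr => e e0.
pose d := e / N.+1%:R.
have d0 : 0 < d by rewrite divr_gt0.
have near_d : \forall t \near F, forall i : 'I_N, nrm (b i - a t i) < d.
  by apply: filter_forall => i; move/cvg_nrmP : (ab i); exact.
have [t [/= tC td]] := filter_ex (filterI aC near_d).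
rewrite (_ : upto N b = fun n => upto N (a t) n + upto N (fun n => b n - a t n) n).
  apply: lp_normD => //; [exact: ltW|exact: lp_upto|].
  apply: (le_trans (lp_upto_small q1 (ltW d0) _)) => [n nN|].
    by rewrite ltW//; exact: (td (Ordinal nN)).
  rewrite lee_fin /d mulrCA ler_piMr ?(ltW e0)//.
  by rewrite ler_pdivrMr// mul1r ler_nat.
by apply/funext => n; rewrite /upto; case: ifP; rewrite ?addr0// addrC subrK.
Qed.

Lemma lp_hoelder_scaled V p (a : nat -> K) (x : nat -> V) A C : (1 <= p)%E ->
  0 < A -> 0 < C -> (lp_norm p x <= C%:E)%E ->
  (lp_norm (hoelder_conjugate p) a <= A%:E)%E ->
  forall m, nrm (\sum_(0 <= i < m) a i *: x i) <= A * C.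
Proof.
move=> p1 A0 C0 xC aA m.
have a1 : (lp_norm (hoelder_conjugate p) (fun n => ofR k A^-1 * a n)%R <= 1)%E.
  have := lp_normZ (ofR k A^-1) (hoelder_conj_ge1 p1) (ltW A0) aA.
  by rewrite nrm_ofR ger0_norm ?invr_ge0 ?(ltW A0)// mulVf ?gt_eqF.
have := lp_hoelder p1 C0 xC a1 m.
have -> : \sum_(0 <= i < m) (ofR k A^-1 * a i) *: x i =
    ofR k A^-1 *: \sum_(0 <= i < m) a i *: x i.
  by rewrite scaler_sumr; apply: eq_bigr => i _; rewrite scalerA.
by rewrite nrmZ nrm_ofR ger0_norm ?invr_ge0 ?(ltW A0)// ler_pdivrMl.
Qed.

Lemma lp_seq_beyond_small V p (x : nat -> V) e : (1 <= p)%E -> lp_seq p x -> 0 < e ->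
  exists N, (lp_norm p (beyond N x) <= e%:E)%E.
Proof.
move=> + xp e0; case: p xp => [r||//] [xfin x0] r1; last first.
  have /cvg_nrmP/(_ _ e0)[N _ NP] := x0 erefl.
  exists N; apply/lp_oo_le => n; rewrite /beyond; case: ltnP => Nn.
    by rewrite nrm0 ltW.
  by have := NP _ Nn; rewrite sub0r nrmN => /ltW.
have r0 : 0 < r by rewrite (lt_le_trans ltr01)// -lee_fin.
have [C C0 xC] := lp_seq_bound (conj xfin x0).
have hC := (lp_fin_le x r0 (ltW C0)).1 xC.
pose u m := \sum_(0 <= i < m) nrm (x i) `^ r.
have cu : cvgn u.
  apply: nondecreasing_is_cvgn.
    apply/nondecreasing_seqP => n; rewrite /u big_nat_recr//= lerDl.
    exact: powR_ge0.
  by exists (C `^ r) => _ [m _ <-]; exact: hC.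
have er0 : 0 < e `^ r by rewrite powR_gt0.
have [N _ NP] : \forall n \near \oo, `|lim (u @ \oo) - u n| < e `^ r.
  by move/cvgrPdist_lt : cu; exact.
exists N; apply/lp_fin_le => //; first exact: ltW.
move=> m; have [mN|Nm] := leqP m N.
  rewrite big_nat_cond big1 ?powR_ge0// => i /andP[/andP[_ im] _].
  by rewrite /beyond (leq_trans im mN) nrm0 powR0 ?gt_eqF.
have umono i j : (i <= j)%N -> u i <= u j.
  move=> ij; rewrite /u (big_cat_nat (leq0n i) ij)//= lerDl sumr_ge0// => *.
  exact: powR_ge0.
rewrite (big_cat_nat (leq0n N) (ltnW Nm))//= big_nat_cond big1 ?add0r => [|i /andP[/andP[_ iN] _]]; last first.
  by rewrite /beyond iN nrm0 powR0 ?gt_eqF.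
have -> : \sum_(N <= i < m) nrm (beyond N x i) `^ r = u m - u N.
  rewrite /u (big_cat_nat (leq0n N) (ltnW Nm))//= [X in X - _]addrC addrK.
  by apply: eq_big_nat => i /andP[Ni _]; rewrite /beyond ltnNge Ni.
have uml : u m <= lim (u @ \oo).
  apply: limr_ge => //; exists m => // j /= mj; exact: umono.
have := NP _ (leqnn N); rewrite ltr_norml => /andP[_ h].
by rewrite (le_trans _ (ltW h))// lerB.
Qed.

Lemma ultra_fmap (T U : Type) (G : set_system T) (f : T -> U) :
  UltraFilter G -> UltraFilter (f @ G).
Proof.
move=> UG; split=> [|H HP GH]; first exact: fmap_proper_filter.
apply/seteqP; split=> A; last exact: GH.
move=> HA; have [//|GA] := in_ultra_setVsetC (f @^-1` A) UG.
have HA' : H (~` A) by apply: GH.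
by have [x [Ax /(_ Ax)]] := filter_ex (filterI HA HA').
Qed.

(** Bolzano-Weierstrass along an ultrafilter, which replaces a diagonal
    extraction when infinitely many coordinates have to converge at once. *)
Lemma scalar_ultra_cvg (T : Type) (G : set_system T) (UG : UltraFilter G)
    (a : T -> K) C : (\forall t \near G, nrm (a t) <= C) ->
  exists b : K, a @ G --> b.
Proof.
have real_ultra (f : T -> R) : (\forall t \near G, `|f t| <= C) ->
    exists b : R, f @ G --> b.
  move=> fC; have := @segment_compact R (- C) C; rewrite compact_ultra.
  move=> /(_ (f @ G) (ultra_fmap f UG)) [].
    by apply: filterS fC => t /=; rewrite in_itv /= ler_norml.
  by move=> b [_ fb]; exists b.
case: k a => [a aC|a aC]; first exact: real_ultra.
have [|r ar] := real_ultra (fun t => complex.Re (a t)).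
  by apply: filterS aC => t; have [h _ _] := complex_parts_le (a t); exact: le_trans.
have [|s as_] := real_ultra (fun t => complex.Im (a t)).
  by apply: filterS aC => t; have [_ h _] := complex_parts_le (a t); exact: le_trans.
exists (Complex r s); apply/cvg_nrmP => e e0.
have e2 : 0 < e / 2 by rewrite divr_gt0.
have := ar; move=> /cvgrPdist_lt/(_ _ e2); have := as_; move=> /cvgrPdist_lt/(_ _ e2).
apply: filterS2 => t h1 h2.
have [_ _ h] := complex_parts_le (Complex r s - a t).
rewrite (le_lt_trans h)// (splitr e) ltrD//.
  have -> // : complex.Re (Complex r s - a t) = r - complex.Re (a t) by case: (a t).
have -> // : complex.Im (Complex r s - a t) = s - complex.Im (a t) by case: (a t).
Qed.

End LpCalculus.

(** * Density of finite sums in the space of p-continuous functions *)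

Section PartitionOfUnity.
Variables (R : realType) (k : scalar_kind) (Omega : topologicalType).
Notation K := (scalar_field R k).
Variable Ocpt : compact [set: Omega].

Lemma real_continuous_sum (I : Type) (s : seq I) (f : I -> Omega -> R) :
  (forall i, continuous (f i)) -> continuous (fun w => \sum_(i <- s) f i w).
Proof.
move=> cf w; elim: s => [|i s ih].
  by under eq_fun do rewrite big_nil; exact: cst_continuous.
under eq_fun do rewrite big_cons.
by apply: (@continuousD _ _ _ (f i)) => //; exact: cf.
Qed.

(** The gauge [d] need not be a metric. Being free to choose it, one can make
    the partition fine for a vector-valued function or for several scalar
    functions simultaneously. *)
Lemma partition_of_unity (d : Omega -> Omega -> R) (e : R) :
  (forall c, continuous (d c)) -> (forall c, d c c = 0) -> 0 < e ->
  exists n (c : 'I_n -> Omega) (t : 'I_n -> Omega -> R),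
    [/\ forall i, continuous (t i), forall i w, 0 <= t i w,
        forall w, \sum_i t i w = 1 &
        forall i w, t i w != 0 -> d (c i) w < e].
Proof.
move=> cd dcc e0.
have nd c : nbhs c [set w | d c w < e].
  have /cvgrPdist_lt/(_ _ e0) := cd c c; apply: filterS => w /=.
  by rewrite dcc sub0r normrN; exact: le_lt_trans (ler_norm _).
have [n [c cP]] := finite_net Ocpt nd.
(* Twice the positive part of e - d. *)
pose h i w := (e - d (c i) w) + `|e - d (c i) w|.
have h0 i w : 0 <= h i w by have := ler_norm (- (e - d (c i) w)); rewrite normrN /h; lra.
have hp i w : d (c i) w < e -> 0 < h i w.
  by move=> de; rewrite /h gtr0_norm ?subr_gt0//; lra.
have hn i w : e <= d (c i) w -> h i w = 0.
  by move=> ed; rewrite /h ler0_norm ?subr_le0//; lra.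
pose S w := \sum_i h i w.
have S0 w : 0 < S w.
  have [i ci] := cP w; rewrite /S (bigD1 i)//=.
  by rewrite ltr_pwDl ?hp// sumr_ge0.
have ch i : continuous (h i).
  move=> w; have ced : (e - d (c i) z) @[z --> w] --> e - d (c i) w.
    by apply: cvgB; [exact: cvg_cst|exact: cd].
  by apply: cvgD => //; exact: cvg_norm.
have cS : continuous S by exact: real_continuous_sum.
exists n, c, (fun i w => h i w / S w); split.
- move=> i w; apply: cvgM; first exact: ch.
  by apply: cvgV; [rewrite gt_eqF|exact: cS].
- by move=> i w; rewrite divr_ge0// ltW.
- by move=> w; rewrite -mulr_suml -/(S w) mulfV// gt_eqF.
- move=> i w; rewrite ltNge; apply: contraNN => /hn ->.
  by rewrite mul0r.
Qed.

End PartitionOfUnity.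

Section Density.
Variables (R : realType) (k : scalar_kind).
Notation K := (scalar_field R k).
Variables (X : normedModType K) (p : \bar R).
Hypothesis p1 : (1 <= p)%E.
Notation q := (hoelder_conjugate p).
Let q1 : (1 <= q)%E := hoelder_conj_ge1 p1.

Lemma series_remainder_bound (x : nat -> X) (N : nat) (e A : R) (a : nat -> K) v m :
  0 < e -> 0 < A -> (lp_norm p (beyond N x) <= e%:E)%E -> (lp_norm q a <= A%:E)%E ->
  series (fun n => a n *: x n) @ \oo --> v -> (N <= m)%N ->
  nrm (v - series (fun n => a n *: x n) m) <= A * e.
Proof.
move=> e0 A0 xe aA av Nm.
apply: (@nrm_cvg R k X _ \oo _ (fun j => series (fun n => a n *: x n) j -
    series (fun n => a n *: x n) m)).
  by apply: cvgB => //; exact: cvg_cst.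
exists m => // j /= mj; rewrite /series /= (big_cat_nat (leq0n m) mj)/= [X in X - _]addrC addrK.
have := lp_hoelder_scaled p1 A0 e0 xe (lp_beyond m q1 (ltW A0) aA) j.
rewrite (big_cat_nat (leq0n m) mj)/= [X in nrm (X + _)]big_nat_cond big1 ?add0r.
  congr (nrm _ <= _); apply: eq_big_nat => i /andP[mi _].
  by rewrite /beyond !ltnNge mi (leq_trans Nm mi).
by move=> i /andP[/andP[_ im] _]; rewrite /beyond im scale0r.
Qed.

(** If this failed for every d, there would be coefficients [a] in the ball of
    radius 2 representing vectors that tend to 0. Along an ultrafilter they
    converge coordinatewise to some b; since the tails of [x] are uniformly
    negligible, b represents 0. Then [a - b] represents the same vectors as [a],
    lies in the ball of radius 4, and has small first coordinates. *)
Lemma small_head_coefficients (x : nat -> X) (N : nat) (e : R) :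
  lp_seq p x -> 0 < e -> exists2 d : R, 0 < d &
  forall (a : nat -> K) v, (lp_norm q a <= 2%:E)%E ->
    series (fun n => a n *: x n) @ \oo --> v -> nrm v < d ->
    exists c : nat -> K, [/\ (lp_norm q c <= 4%:E)%E,
      series (fun n => c n *: x n) @ \oo --> v &
      forall n, (n < N)%N -> nrm (c n) <= e].
Proof.
move=> lx e0; apply: contrapT => nd.
have bad j : exists av : (nat -> K) * X, [/\ (lp_norm q av.1 <= 2%:E)%E,
    series (fun n => av.1 n *: x n) @ \oo --> av.2, nrm av.2 < j.+1%:R^-1 &
    ~ exists c : nat -> K, [/\ (lp_norm q c <= 4%:E)%E,
      series (fun n => c n *: x n) @ \oo --> av.2 &
      forall n, (n < N)%N -> nrm (c n) <= e]].
  apply: contrapT => nj; apply: nd; exists j.+1%:R^-1; first by rewrite invr_gt0.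
  move=> a v a2 av vj; apply: contrapT => nc; apply: nj.
  by exists (a, v).
have [u uP] := choice bad.
have [G [UG ooG]] := ultraFilterLemma (@eventually_filter).
have bnd n : \forall j \near G, nrm ((u j).1 n) <= 2.
  apply: filterE => j; have [u2 _ _ _] := uP j.
  exact: (lp_coord n q1 (ler0n R 2) u2).
have [b bP] := choice (fun n => scalar_ultra_cvg UG (bnd n)).
have b2 : (lp_norm q b <= 2%:E)%E.
  apply: (@lp_pointwise_limit _ _ _ _ _ G _ (fun j => (u j).1)) => //.
  by apply: filterE => j; have [] := uP j.
have b0 : series (fun n => b n *: x n) @ \oo --> (0 : X).
  apply/cvg_nrmP => h h0; have h4 : 0 < h / 4 by rewrite divr_gt0.
  have [M xM] := lp_seq_beyond_small p1 lx h4.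
  exists M => // m /= Mm; rewrite sub0r nrmN.
  apply: (@le_lt_trans _ _ (2 * (h / 4) + h / 4)); last by lra.
  have cvm : (fun j => series (fun n => (u j).1 n *: x n) m) @ G -->
      series (fun n => b n *: x n) m.
    rewrite /series /=; elim: m {Mm} => [|m ih].
      under eq_fun do rewrite big_geq//; rewrite big_geq//; exact: cvg_cst.
    under eq_fun do rewrite big_nat_recr//=; rewrite big_nat_recr//=.
    by apply: cvgD => //; apply: cvgZr_tmp; exact: bP.
  apply: (@nrm_cvg R k X _ G _ _ _ _ cvm).
  have : \forall j \near G, j.+1%:R^-1 < h / 4.
    by apply: ooG; exact: (near_infty_natSinv_lt (PosNum h4)).
  apply: filterS => j jh; have [u2 uv vj _] := uP j.
  have := series_remainder_bound h4 (ltr0n R 2) xM u2 uv Mm.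
  rewrite -[X in nrm X <= 2 * _ + _](subrK (u j).2) nrmB => h1.
  by rewrite (le_trans (nrmD _ _))// lerD// ltW// (lt_trans vj).
have near_e : \forall j \near G, forall i : 'I_N, nrm (b i - (u j).1 i) < e.
  by apply: filter_forall => i; move/cvg_nrmP : (bP i); exact.
have [j jP] := filter_ex near_e.
have [u2 uv vj] := uP j; apply.
exists (fun n => (u j).1 n - b n); split.
- have -> : 4 = 2 + 2 :> R by rewrite -natrD.
  apply: (@lp_normD _ _ _ _ _ (fun n => - b n)) => //.
  by apply: (lp_mono q1 (ler0n R 2) _ b2) => n; rewrite nrmN.
- rewrite -[(u j).2]subr0.
  rewrite (_ : series _ = fun m => series (fun n => (u j).1 n *: x n) m -
      series (fun n => b n *: x n) m); first exact: cvgB.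
  apply/funext => m; rewrite /series /= -sumrB.
  by apply: eq_bigr => i _; rewrite scalerBl.
- by move=> n nN; rewrite nrmB ltW//; exact: (jP (Ordinal nN)).
Qed.

End Density.

Section CpDensity.
Variables (R : realType) (k : scalar_kind) (Omega : topologicalType).
Notation K := (scalar_field R k).
Variable Ocpt : compact [set: Omega].
Variables (X : normedModType K) (p : \bar R) (p1 : (1 <= p)%E).
Notation cp := (cp_of Omega X p1).
Notation q := (hoelder_conjugate p).

Lemma cp_sumE (I : Type) (s : seq I) (F : I -> cp) w :
  (\sum_(i <- s) F i) w = \sum_(i <- s) F i w.
Proof. by elim: s => [|i s ih]; rewrite ?big_nil// !big_cons -ih. Qed.

Lemma cvg_sum_series (I : finType) (t : I -> K) (b : I -> nat -> K) (x : nat -> X)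
    (v : I -> X) :
  (forall i, series (fun n => b i n *: x n) @ \oo --> v i) ->
  series (fun n => (\sum_i t i * b i n) *: x n) @ \oo --> \sum_i t i *: v i.
Proof.
move=> bv.
rewrite (_ : series _ = fun m => \sum_i t i *: series (fun n => b i n *: x n) m).
  elim: (index_enum I) => [|i s ih].
    under eq_fun do rewrite big_nil; rewrite big_nil; exact: cvg_cst.
  under eq_fun do rewrite big_cons; rewrite big_cons.
  by apply: cvgD => //; apply: cvgZl_tmp; exact: bv.
apply/funext => m; rewrite /series /=.
under [RHS]eq_bigr do rewrite scaler_sumr.
rewrite [RHS]exchange_big /=; apply: eq_bigr => n _.
by rewrite scaler_suml; apply: eq_bigr => i _; rewrite scalerA.
Qed.

Lemma lp_norm_conv_coef (I : finType) (t : I -> R) (a : I -> nat -> K) C :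
  0 <= C -> (forall i, 0 <= t i) -> \sum_i t i = 1 ->
  (forall i, (lp_norm q (a i) <= C%:E)%E) ->
  (lp_norm q (fun n => \sum_i ofR k (t i) * a i n)%R <= C%:E)%E.
Proof. by move=> C0 t0 t1 aC; apply: (lp_norm_conv (hoelder_conj_ge1 p1)). Qed.

(** The error F - sum_i psi_i F(c_i) is at each point a convex combination of
    differences F(w) - F(c_i) of small norm, each rewritten with small head
    coefficients. Its head and its tail are covered by two different multiples
    of the sequence [x], although both may be discontinuous functions. *)
Lemma cp_approx (F : cp) (e : R) : 0 < e ->
  exists n (psi : 'I_n -> cfun_of R k Ocpt) (c : 'I_n -> Omega),
    nrm (F - \sum_i tensor p1 (psi i) (F (c i))) <= e.
Proof.
move=> e0; have q1 : (1 <= q)%E := hoelder_conj_ge1 p1.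
have /asboolP[cF [x lx Fx]] := cp_valP F.
have [A A0 xA] := lp_seq_bound lx.
have e8 : 0 < e / 8 by rewrite divr_gt0.
have [N xN] := lp_seq_beyond_small p1 lx e8.
pose r := e / (2 * A); have r0 : 0 < r by rewrite divr_gt0// mulr_gt0.
pose e' := r / N.+1%:R; have e'0 : 0 < e' by rewrite divr_gt0.
have [d d0 dP] := small_head_coefficients p1 N lx e'0.
have [a aP] := choice (fun w => let: ex_intro2 a h1 h2 := Fx w in ex_intro _ a (conj h1 h2)).
pose g c w := nrm (F w - F c).
have gc c : continuous (g c).
  move=> w; apply: (@continuous_comp _ _ _ (fun w => F w - F c) (@nrm R k X)).
    by apply: cvgB; [exact: cF|exact: cvg_cst].
  exact: nrm_continuous.
have [|n [c [t [ct t0 t1 tg]]]] := partition_of_unity Ocpt gc _ d0.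
  by move=> z; rewrite /g subrr nrm0.
pose psi i : cfun_of R k Ocpt := Cfun Ocpt (ofR_cfun k (ct i)).
exists n, psi, c.
set D := F - _.
have DE w : D w = \sum_i ofR k (t i w) *: (F w - F (c i)).
  rewrite [LHS](_ : _ = F w - (\sum_i tensor p1 (psi i) (F (c i)) : cp) w)//.
  rewrite cp_sumE -[in LHS](scale1r (F w)) -(ofR1 R) -(t1 w).
  have -> : ofR k (\sum_i t i w) = \sum_i ofR k (t i w).
    by rewrite (big_morph _ (@ofRD R k) (@ofR0 R k)).
  rewrite scaler_suml -sumrB; apply: eq_bigr => i _.
  by rewrite scalerBr.
(* Indices whose weight vanishes carry no information and get the zero sequence. *)
have coef w i : exists b : nat -> K, [/\ (lp_norm q b <= 4%:E)%E,
    series (fun n => b n *: x n) @ \oo -->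
      (if t i w == 0 then 0 else F w - F (c i)) &
    forall n, (n < N)%N -> nrm (b n) <= e'].
  have [t00|tn0] := eqVneq (t i w) 0.
    exists (fun=> 0); split; first exact: lp_norm_cst0.
      rewrite (_ : series _ = fun=> 0); first exact: cvg_cst.
      by apply/funext => m; rewrite /series /= big1// => j _; rewrite scale0r.
    by move=> j _; rewrite nrm0 ltW.
  apply: (dP (fun n => a w n - a (c i) n)); last exact: tg.
    have -> : 2 = 1 + 1 :> R by [].

    apply: (@lp_normD _ _ _ _ _ (fun n => - a (c i) n)) => //; first exact: (aP w).1.
    by apply: (lp_mono q1 ler01 _ (aP (c i)).1) => j; rewrite nrmN.
  rewrite (_ : series _ = fun m => series (fun n => a w n *: x n) m -
      series (fun n => a (c i) n *: x n) m).
    by apply: cvgB; [exact: (aP w).2|exact: (aP (c i)).2].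
  apply/funext => m; rewrite /series /= -sumrB.
  by apply: eq_bigr => j _; rewrite scalerBl.
pose b w := projT1 (choice (coef w)).
have bP w i := projT2 (choice (coef w)) i; rewrite -/(b _) in bP.
pose C w n := \sum_i ofR k (t i w) * b w i n.
have C4 w : (lp_norm q (C w) <= 4%:E)%E.
  by apply: lp_norm_conv_coef => // i; have [] := bP w i.
have CD w : series (fun n => C w n *: x n) @ \oo --> D w.
  rewrite DE (_ : \sum_i _ = \sum_i ofR k (t i w) *:
      (if t i w == 0 then 0 else F w - F (c i))).
    by apply: cvg_sum_series => i; have [] := bP w i.
  apply: eq_bigr => i _; case: eqVneq => // ->.
  by rewrite ofR0 !scale0r.
have Cs w j : (j < N)%N -> nrm (C w j) <= e'.
  move=> jN; apply: (le_trans (nrm_sum _ _ _)).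
  rewrite -[leRHS]mul1r -(t1 w) mulr_suml; apply: ler_sum => i _.
  rewrite nrmM nrm_ofR ger0_norm// ler_wpM2l//.
  by have [_ _] := bP w i; exact.
pose H w := \sum_(0 <= j < N) C w j *: x j.
have lxr := lp_seqZ p1 (ofR k r) (ltW A0) lx xA.
rewrite nrm_ofR gtr0_norm// in lxr.
have rA : r * A = e / 2 by rewrite /r; field; rewrite gt_eqF.
have HC : lp_covers p H (fun j => ofR k r *: x j).
  move=> w; exists (fun j => ofR k r^-1 * upto N (C w) j).
    have h1 : (lp_norm q (upto N (C w)) <= r%:E)%E.
      apply: (le_trans (lp_upto_small q1 (ltW e'0) (Cs w))).
      rewrite lee_fin /e' mulrCA ler_piMr ?(ltW r0)//.
      by rewrite ler_pdivrMr// mul1r ler_nat.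
    have := lp_normZ (ofR k r^-1) q1 (ltW r0) h1.
    by rewrite nrm_ofR gtr0_norm ?invr_gt0// mulVf ?gt_eqF.
  have rr : ofR k r^-1 * ofR k r = 1 by rewrite -ofRM mulVf ?gt_eqF// ofR1.
  apply: (@cvg_near_cst _ _ _ _ \oo); exists N => // m /= Nm.
  rewrite /series /= (big_cat_nat (leq0n N) Nm)/= [X in _ + X]big_nat_cond.
  rewrite [X in _ + X]big1 ?addr0 => [|j /andP[/andP[Nj _] _]].
    apply: eq_big_nat => j /andP[_ jN].
    by rewrite scalerA mulrAC rr mul1r /upto jN.
  by rewrite /upto ltnNge Nj mulr0 scale0r.
have lt4 : lp_seq p (fun j => ofR k 4 *: beyond N x j) /\
    (lp_norm p (fun j => ofR k 4 *: beyond N x j)%R <= (4 * (e / 8))%:E)%E.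
  have := lp_seqZ p1 (ofR k 4) (ltW e8) _ xN.
  rewrite nrm_ofR ger0_norm//; apply; split.
    by rewrite (le_lt_trans xN)// ltry.
  move=> poo; apply/cvg_nrmP => h h0; have [_ /(_ poo)/cvg_nrmP/(_ _ h0)] := lx.
  apply: filterS => j; apply: le_lt_trans; rewrite !sub0r !nrmN /beyond.
  by case: ifP; rewrite ?nrm0 ?nrm_ge0.
have TC : lp_covers p (fun w => D w - H w) (fun j => ofR k 4 *: beyond N x j).
  move=> w; exists (fun j => ofR k 4^-1 * C w j).
    have := lp_normZ (ofR k 4^-1) q1 (ler0n R 4) (C4 w).
    by rewrite nrm_ofR gtr0_norm ?invr_gt0// mulVf.
  have rr : ofR k (4^-1 : R) * ofR k (4 : R) = 1 by rewrite -(@ofRM R k) mulVf// ofR1.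
  have : (fun m => series (fun n => C w n *: x n) m - H w) @ \oo --> D w - H w.
    by apply: cvgB => //; exact: cvg_cst.
  apply: cvg_trans; apply: near_eq_cvg; exists N => // m /= Nm.
  rewrite /series /= !(big_cat_nat (leq0n N) Nm)/= [X in X - _]addrC addrK.
  rewrite [in RHS]big_nat_cond [X in X + _]big1 ?add0r => [|j /andP[/andP[_ jN] _]].
    apply: eq_big_nat => j /andP[Nj _].
    by rewrite scalerA mulrAC rr mul1r /beyond ltnNge Nj.
  by rewrite /beyond jN !scaler0.
have e2 : 0 < e / 2 by rewrite divr_gt0.
have e48 : 0 < 4 * (e / 8) by rewrite mulr_gt0.
have hA := lxr.2; rewrite rA in hA.
have [z [lz zC zn]] := lp_combine p1 e2 e48 lxr.1 HC hA lt4.1 TC lt4.2.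
rewrite nrm_cp; apply: (cp_norm_le lz).
  rewrite (_ : (D : Omega -> X) = H + (fun w => D w - H w))//.
  by apply/funext => w; rewrite fctE addrC subrK.
by rewrite (le_trans zn)// lee_fin; lra.
Qed.

End CpDensity.

(** * Absolutely summing operators and the pairing with finite sums *)

Section ConjugateNorming.
Variables (R : realType) (k : scalar_kind).
Notation K := (scalar_field R k).

(** The equality case of Hoelder's inequality: the multiplier is
    tau^(s-1), normalized in l_p. *)
Lemma conjugate_norming (p : \bar R) (s : R) (n : nat) (tau : nat -> R) :
  (1 <= p)%E -> hoelder_conjugate p = s%:E -> (forall i, 0 <= tau i) ->
  exists beta : nat -> R, [/\ forall i, 0 <= beta i,
    forall i, (n <= i)%N -> beta i = 0,
    (lp_norm p (fun i => ofR k (beta i)) <= 1)%E &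
    \sum_(0 <= i < n) beta i * tau i = (\sum_(0 <= i < n) tau i `^ s) `^ s^-1].
Proof.
move=> p1 ps tau0.
have [[_ qE]|[pE qE]|[r [s' [pE qE r1 s1 rs]]]] := hoelder_cases p1.
- by rewrite ps in qE.
- move: qE; rewrite ps => -[->].
  exists (fun i => (i < n)%N%:R); split.
  + by move=> i; exact: ler0n.
  + by move=> i ni; rewrite ltnNge ni.
  + rewrite pE; apply/lp_oo_le => i; rewrite nrm_ofR normr_nat.
    by case: (i < n)%N.
  + rewrite invr1 powRr1; last by rewrite sumr_ge0// => i _; exact: powR_ge0.
    by apply: eq_big_nat => i /andP[_ ->]; rewrite mul1r powRr1.
- move: qE; rewrite ps => -[ss]; rewrite -{s'}ss in s1 rs.
  have [r0 s0] : 0 < r /\ 0 < s by rewrite !(lt_trans ltr01).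
  pose S := \sum_(0 <= i < n) tau i `^ s.
  have S0 : 0 <= S by rewrite sumr_ge0// => i _; exact: powR_ge0.
  have [S00|Sn0] := eqVneq S 0.
    exists (fun=> 0); split=> //.
    + have := lp_norm_cst0 K p1 (ler01 : 0 <= 1 :> R); congr (lp_norm _ _ <= _)%E.
      by apply/funext => i; rewrite ofR0.
    + rewrite -/S S00 powR0 ?invr_eq0 ?gt_eqF// big1// => i _.
      by rewrite mul0r.
  have Sp : 0 < S by rewrite lt_def Sn0.
  have srE : (s - 1) * r = s.
    have : (r^-1 + s^-1) * (r * s) = r * s by rewrite rs mul1r.
    rewrite mulrDl mulrA mulVf ?gt_eqF// mul1r mulrCA mulVf ?gt_eqF// mulr1.
    by lra.
  pose N := S `^ s^-1; have N0 : 0 < N by rewrite powR_gt0.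
  have Ns : N `^ s = S by rewrite -powRrM mulVf ?gt_eqF// powRr1.
  have Nd : 0 < N `^ (s - 1) by rewrite powR_gt0.
  exists (fun i => if (i < n)%N then tau i `^ (s - 1) / N `^ (s - 1) else 0); split.
  + by move=> i; case: ifP => // _; rewrite divr_ge0 ?powR_ge0.
  + by move=> i ni; rewrite ltnNge ni.
  + rewrite pE; apply/lp_fin_le => // m; rewrite powR1.
    apply: (@le_trans _ _ (\sum_(0 <= i < n) (tau i `^ s) / S)); last first.
      by rewrite -mulr_suml mulfV.
    apply: (@le_trans _ _ (\sum_(0 <= i < m) if (i < n)%N then (tau i `^ s) / S else 0)).
      apply: ler_sum => i _; case: ifP => _; last by rewrite ofR0 nrm0 powR0 ?gt_eqF.
      rewrite nrm_ofR ger0_norm ?divr_ge0 ?powR_ge0//.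
      rewrite powRM ?invr_ge0 ?powR_ge0//.
      rewrite -(powR_inv1 (ltW Nd)) -(powRrM (N `^ (s - 1)) (-1) r) mulN1r powRN.
      by rewrite -(powRrM N (s - 1) r) srE Ns -powRrM srE.
    have tS0 i : 0 <= tau i `^ s / S by rewrite divr_ge0 ?powR_ge0.
    have [mn|nm] := leqP m n.
      rewrite (big_cat_nat (leq0n m) mn)//= ler_wpDr//.
        by rewrite sumr_ge0.
      by apply: ler_sum_nat => i /andP[_ im]; rewrite (leq_trans im mn).
    rewrite (big_cat_nat (leq0n n) (ltnW nm))//= [X in _ + X]big_nat_cond.
    rewrite [X in _ + X]big1 ?addr0.
      by apply: ler_sum_nat => i /andP[_ ->].
    by move=> i /andP[/andP[ni _] _]; rewrite ltnNge ni.
  + rewrite (eq_big_nat _ _ (F2 := fun i => tau i `^ s / N `^ (s - 1))).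
      rewrite -mulr_suml -/S -[in LHS]Ns -(mulr_powRB1 (ltW N0) s0).
      by rewrite mulrK// unitfE gt_eqF.
    move=> i /andP[_ ->]; rewrite mulrAC; congr (_ / _).
    by rewrite mulrC mulr_powRB1.
Qed.

Lemma phase (a : K) : exists th : K, nrm th <= 1 /\ th * a = ofR k (nrm a).
Proof.
have [->|a0] := eqVneq a 0.
  by exists 0; rewrite nrm0 ler01 mulr0 ofR0.
have na : nrm a != 0 by apply: contra_neq a0 => /nrm0_eq0.
exists (ofR k (nrm a) * a^-1).
by rewrite nrmM nrm_ofR nrmV ger0_norm ?nrm_ge0// mulfV// mulfVK.
Qed.

End ConjugateNorming.

Section SummingOperators.
Variables (R : realType) (k : scalar_kind) (Omega : topologicalType).
Notation K := (scalar_field R k).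
Variable Ocpt : compact [set: Omega].
Notation COmega := (cfun_of R k Ocpt).
Variables (X : normedModType K) (p : \bar R) (p1 : (1 <= p)%E).
Notation q := (hoelder_conjugate p).
Let q1 : (1 <= q)%E := hoelder_conj_ge1 p1.

Lemma cfun_sumE (I : Type) (s : seq I) (F : I -> COmega) w :
  (\sum_(i <- s) F i) w = \sum_(i <- s) F i w.
Proof. by elim: s => [|i s ih]; rewrite ?big_nil// !big_cons -ih. Qed.

Lemma cfun_nrm_le (f : COmega) (M : R) : 0 <= M -> (forall w, nrm (f w) <= M) ->
  nrm f <= M.
Proof. by rewrite nrm_cfun; exact: supnorm_le. Qed.

Lemma cfun_nrm_ge (f : COmega) w : nrm (f w) <= nrm f.
Proof. by rewrite nrm_cfun; exact: supnorm_ge. Qed.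

(** On C(Omega) the weak l_q norm is computed by point evaluations: a functional
    [l] applied to the z_i is normed by multipliers b_i in the ball of l_p, and
    the function sum_i b_i z_i has sup norm at most [B] by Hoelder at each
    point. *)
Lemma weak_norm_le (s : R) (n : nat) (z : nat -> COmega) (B : R) :
  q = s%:E -> 0 < B ->
  (forall w, (lp_norm q (upto n (fun i => z i w)) <= B%:E)%E) ->
  (weak_lp_norm s (fun i : 'I_n => z i) <= B%:E)%E.
Proof.
move=> qs B0 zB; apply: ge_ereal_sup => _ [l /= l1 <-]; rewrite lee_fin.
rewrite -(big_mkord xpredT (fun i => nrm (l (z i)) `^ s)).
have [b [b0 bn b1 <-]] := conjugate_norming k n p1 qs (fun i => nrm_ge0 (l (z i))).
have [th thP] := choice (fun i => phase (l (z i))).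
pose g : COmega := \sum_(0 <= i < n) (ofR k (b i) * th i) *: z i.
have lg : l g = ofR k (\sum_(0 <= i < n) b i * nrm (l (z i))).
  rewrite /g linear_sum (big_morph _ (@ofRD R k) (@ofR0 R k)).
  apply: eq_bigr => i _; rewrite linearZ /= ofRM -(thP i).2.
  by rewrite -[_ *: _]mulrA.
have gB : nrm g <= B.
  apply: cfun_nrm_le; first exact: ltW.
  move=> w; rewrite /g cfun_sumE.
  have b1' : (lp_norm p (fun i => ofR k (b i) * th i)%R <= 1%:E)%E.
    apply: lp_mono b1 => // i; rewrite nrmM ler_piMr ?nrm_ge0//.
    exact: (thP i).1.
  have := lp_hoelder_scaled p1 B0 ltr01 b1' (zB w) n.
  rewrite mulr1; congr (nrm _ <= _); apply: eq_big_nat => i /andP[_ ni].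
  by rewrite /upto ni; exact: mulrC.
have := bop_nrm_bound l g; rewrite lg nrm_ofR ger0_norm; last first.
  by rewrite sumr_ge0// => i _; rewrite mulr_ge0 ?nrm_ge0.
move=> /le_trans; apply; apply: le_trans gB.
by rewrite ler_piMl ?nrm_ge0.
Qed.

Lemma summing_op_bound (T : COmega -> dual X) (C C' : R) :
  (summing_norm q T <= C%:E)%E -> 0 <= C -> C < C' ->
  (forall a f, nrm (T (a *: f)) = nrm a * nrm (T f)) ->
  q = +oo%E -> forall f, nrm (T f) <= C' * nrm f.
Proof.
move=> TC C0 CC' TZ qoo f; rewrite qoo /= in TC.
have [f0|f0] := eqVneq (nrm f) 0.
  rewrite (nrm0_eq0 f0) nrm0 mulr0.
  by have := TZ 0 0; rewrite scaler0 nrm0 mul0r => ->.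
have fp : 0 < nrm f by rewrite lt_def f0 nrm_ge0.
have h : nrm (T (ofR k (nrm f)^-1 *: f)) <= C.
  rewrite -lee_fin; apply: le_trans TC; apply: ereal_sup_ubound.
  exists (ofR k (nrm f)^-1 *: f) => //=.
  by rewrite nrmZ nrm_ofR gtr0_norm ?invr_gt0// mulVf.
move: h; rewrite TZ nrm_ofR gtr0_norm ?invr_gt0// ler_pdivrMl// mulrC => h.
by rewrite (le_trans h)// ler_wpM2r ?nrm_ge0// ltW.
Qed.

(** For q = oo the summing norm is the operator norm. For finite q it is an
    infimum of admissible constants, hence the slack between [C] and [C']. *)
Lemma summing_image (T : COmega -> dual X) (C C' B : R) (n : nat)
    (z : nat -> COmega) :
  (summing_norm q T <= C%:E)%E -> 0 <= C -> C < C' -> 0 < B ->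
  (forall w, (lp_norm q (upto n (fun i => z i w)) <= B%:E)%E) ->
  (forall a f, nrm (T (a *: f)) = nrm a * nrm (T f)) ->
  (lp_norm q (upto n (fun i => ofR k (nrm (T (z i))))) <= (C' * B)%:E)%E.
Proof.
move=> TC C0 CC' B0 zB TZ; have Tb := summing_op_bound TC C0 CC' TZ.
have C'0 : 0 < C' by rewrite (le_lt_trans C0).
have CB : 0 <= C' * B by rewrite mulr_ge0 ?ltW.
have [qoo|] := eqVneq q +oo%E.
  rewrite qoo; apply/lp_oo_le => i; rewrite /upto; case: ifP => [ni|]; last by rewrite nrm0.
  rewrite nrm_ofR ger0_norm ?nrm_ge0// (le_trans (Tb qoo _))// ler_wpM2l ?(ltW C'0)//.
  apply: cfun_nrm_le (ltW B0) _ => w.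
  have := zB w; rewrite qoo => /lp_oo_le/(_ i); rewrite /upto ni; exact.
case qs : q => [s||] //= _; last by have := q1; rewrite qs.
have s1 : 1 <= s by have := q1; rewrite qs lee_fin.
have s0 : 0 < s by rewrite (lt_le_trans ltr01).
have TC' : (summing_norm s%:E T < C'%:E)%E by rewrite -qs (le_lt_trans TC)// lte_fin.
have [_ [D [D0 DP] <-] DC'] := ereal_inf_lt TC'.
have weakB := weak_norm_le qs B0 zB.
have := DP n (fun i => z i) => h.
have {}h : ((\sum_(i < n) nrm (T (z i)) `^ s) `^ s^-1 <= C' * B)%R.
  rewrite -lee_fin (le_trans h)// EFinM.
  apply: (@le_trans _ _ (D%:E * B%:E)%E); first by apply: lee_wpmul2l; rewrite ?lee_fin.
  by rewrite -!EFinM lee_fin ler_wpM2r ?(ltW B0)// ltW// -lte_fin.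
set S := \sum_(i < n) _ in h.
have S0 : 0 <= S by rewrite sumr_ge0// => i _; exact: powR_ge0.
have SB : S <= (C' * B) `^ s.
  have := @ge0_ler_powR _ s (ltW s0) (S `^ s^-1) (C' * B).
  rewrite !nnegrE powR_ge0 CB => /(_ isT isT h).
  by rewrite -powRrM mulVf ?gt_eqF// powRr1.
apply/lp_fin_le => // m; apply: le_trans SB.
rewrite /S -(big_mkord xpredT (fun i => nrm (T (z i)) `^ s)).
pose F i : R := if (i < n)%N then nrm (T (z i)) `^ s else 0.
have F0 i : 0 <= F i by rewrite /F; case: ifP => // _; exact: powR_ge0.
rewrite (eq_bigr F) => [|i _]; last first.
  rewrite /upto /F; case: ifP => _; last by rewrite nrm0 powR0 ?gt_eqF.
  by rewrite nrm_ofR ger0_norm ?nrm_ge0.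
rewrite [leRHS](eq_big_nat _ _ (F2 := F)); last by move=> i /andP[_ ni]; rewrite /F ni.
have [mn|nm] := leqP m n.
  by rewrite (big_cat_nat (leq0n m) mn)//= ler_wpDr// sumr_ge0.
rewrite (big_cat_nat (leq0n n) (ltnW nm))//= [X in _ + X]big_nat_cond.
rewrite [X in _ + X]big1 ?addr0//.
by move=> i /andP[/andP[ni _] _]; rewrite /F ltnNge ni.
Qed.


(** Trace duality between the q-summing norm of [T] and the l_p norm of [x]. *)
Lemma summing_pairing (T : COmega -> dual X) (C A B : R) (n : nat)
    (z : nat -> COmega) (x : nat -> X) :
  (summing_norm q T <= C%:E)%E -> 0 <= C -> 0 < A -> 0 < B ->
  (forall a f, nrm (T (a *: f)) = nrm a * nrm (T f)) ->
  (lp_norm p x <= A%:E)%E ->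
  (forall w, (lp_norm q (upto n (fun i => z i w)) <= B%:E)%E) ->
  nrm (\sum_(0 <= i < n) T (z i) (x i)) <= C * B * A.
Proof.
move=> TC C0 A0 B0 TZ xA zB; apply/ler_addgt0Pr => e e0.
have AB0 : 0 < A * B by rewrite mulr_gt0.
pose C' := C + e / (A * B).
have CC' : C < C' by rewrite ltrDl divr_gt0.
have C'0 : 0 < C' by rewrite (le_lt_trans C0).
have -> : C * B * A + e = C' * B * A.
  by rewrite /C'; field; rewrite !gt_eqF.
have h := summing_image TC C0 CC' B0 zB TZ.
have xA' : (lp_norm p (fun i => ofR k (nrm (x i)) : K) <= A%:E)%E.
  by apply: lp_mono xA => // [|i]; rewrite ?(ltW A0)// nrm_ofR ger0_norm ?nrm_ge0.
have := lp_hoelder_scaled p1 (mulr_gt0 C'0 B0) A0 xA' h n.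
apply: le_trans; apply: (le_trans (nrm_sum _ _ _)).
rewrite (_ : \sum_(0 <= i < n) _ = ofR k (\sum_(0 <= i < n) nrm (T (z i)) * nrm (x i))).
  rewrite nrm_ofR (le_trans _ (ler_norm _))//.
  by apply: ler_sum => i _; exact: bop_nrm_bound.
rewrite (big_morph _ (@ofRD R k) (@ofR0 R k)); apply: eq_big_nat => i /andP[_ ni].
by rewrite /upto ni ofRM.
Qed.

Lemma lp_norm_eval (s : R) (n : nat) (z : nat -> COmega) (W : R) w :
  q = s%:E -> 0 <= W -> (weak_lp_norm s (fun i : 'I_n => z i) <= W%:E)%E ->
  (lp_norm q (upto n (fun i => z i w)) <= W%:E)%E.
Proof.
move=> qs W0 zW.
have s1 : 1 <= s by have := q1; rewrite qs lee_fin.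
have s0 : 0 < s by rewrite (lt_le_trans ltr01).
have evb : (fun f : COmega => f w) \in @bop_pred R k COmega K.
  apply: (@linear_bounded_bop _ _ _ _ _ 1) => // f.
  by rewrite mul1r; exact: cfun_nrm_ge.
have ev1 : nrm (Bop evb : dual COmega) <= 1.
  by apply: bop_nrm_le => // f; rewrite mul1r; exact: cfun_nrm_ge.
have : (((\sum_(i < n) nrm (z i w) `^ s) `^ s^-1)%:E <= W%:E)%E.
  by apply: le_trans zW; apply: ereal_sup_ubound; exists (Bop evb).
rewrite lee_fin -(big_mkord xpredT (fun i => nrm (z i w) `^ s)) => h.
rewrite qs; apply/lp_fin_le => // m.
set S := \sum_(0 <= i < n) _ in h.
have S0 : 0 <= S by rewrite sumr_ge0// => i _; exact: powR_ge0.
have SW : S <= W `^ s.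
  have := @ge0_ler_powR _ s (ltW s0) (S `^ s^-1) W.
  rewrite !nnegrE powR_ge0 W0 => /(_ isT isT h).
  by rewrite -powRrM mulVf ?gt_eqF// powRr1.
apply: le_trans SW.
have F0 i : 0 <= nrm (upto n (fun i => z i w) i) `^ s by exact: powR_ge0.
rewrite /S [leRHS](eq_big_nat _ _ (F2 := fun i => nrm (upto n (fun i => z i w) i) `^ s)); last first.
  by move=> i /andP[_ ni]; rewrite /upto ni.
have [mn|nm] := leqP m n.
  by rewrite (big_cat_nat (leq0n m) mn)//= ler_wpDr// sumr_ge0.
rewrite (big_cat_nat (leq0n n) (ltnW nm))//= [X in _ + X]big_nat_cond.
rewrite [X in _ + X]big1 ?addr0//.
by move=> i /andP[/andP[ni _] _]; rewrite /upto ltnNge ni nrm0 powR0 ?gt_eqF.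
Qed.

Lemma weak_norm_fin (s : R) (n : nat) (z : nat -> COmega) : q = s%:E ->
  exists2 W : R, 0 <= W & weak_lp_norm s (fun i : 'I_n => z i) = W%:E.
Proof.
move=> qs.
have [M M0 zM] : exists2 M : R, 0 < M & forall i, (i < n)%N -> nrm (z i) <= M.
  exists (1 + \sum_(0 <= i < n) nrm (z i)).
    by rewrite ltr_pwDl// sumr_ge0// => i _; exact: nrm_ge0.
  move=> i ni; rewrite big_mkord (bigD1 (Ordinal ni))//= addrCA lerDl.
  by rewrite addr_ge0// sumr_ge0// => j _; exact: nrm_ge0.
have B0 : 0 < n.+1%:R * M by rewrite mulr_gt0.
have zB w : (lp_norm q (upto n (fun i => z i w)) <= (n.+1%:R * M)%:E)%E.
  have := @lp_upto_small R k K q n (fun i => z i w) M q1 (ltW M0).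
  move=> /(_ _)/le_trans; apply; last by rewrite lee_fin ler_pM2r// ler_nat.
  by move=> i ni; rewrite (le_trans (cfun_nrm_ge _ _))// zM.
have h := weak_norm_le qs B0 zB.
have h0 : (0 <= weak_lp_norm s (fun i : 'I_n => z i))%E.
  apply: (@le_trans _ _ ((\sum_(i < n) nrm ((0 : dual COmega) (z i)) `^ s) `^ s^-1)%:E).
    by rewrite lee_fin powR_ge0.
  by apply: ereal_sup_ubound; exists 0; rewrite //= nrm0 ler01.
have hf : weak_lp_norm s (fun i : 'I_n => z i) \is a fin_num.
  by rewrite ge0_fin_numE// (le_lt_trans h)// ltry.
exists (fine (weak_lp_norm s (fun i : 'I_n => z i))); first exact: fine_ge0.
by rewrite fineK.
Qed.

Lemma tensor_sum_norm (n : nat) (z : nat -> COmega) (x : nat -> X) (B : R) :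
  0 < B -> (lp_norm p x <= 1)%E -> (forall i, (n <= i)%N -> x i = 0) ->
  (forall w, (lp_norm q (upto n (fun i => z i w)) <= B%:E)%E) ->
  nrm (\sum_(0 <= i < n) tensor p1 (z i) (x i)) <= B.
Proof.
move=> B0 x1 xn zB; rewrite nrm_cp.
have lx : lp_seq p x.
  split; first by rewrite (le_lt_trans x1)// ltry.
  move=> _; apply/cvg_nrmP => e e0; exists n => // i /= ni.
  by rewrite xn// subrr nrm0.
have [lBx Bx] := lp_seqZ p1 (ofR k B) ler01 lx x1.
rewrite nrm_ofR gtr0_norm// mulr1 in Bx.
apply: (cp_norm_le lBx _ Bx) => w.
exists (fun i => ofR k B^-1 * upto n (fun i => z i w) i).
  have := lp_normZ (ofR k B^-1) q1 (ltW B0) (zB w).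
  by rewrite nrm_ofR gtr0_norm ?invr_gt0// mulVf ?gt_eqF.
have rr : ofR k B^-1 * ofR k B = 1 by rewrite -ofRM mulVf ?gt_eqF// ofR1.
apply: (@cvg_near_cst _ _ _ _ \oo); exists n => // m /= nm.
rewrite cp_sumE /series /= (big_cat_nat (leq0n n) nm)/= [X in _ + X]big_nat_cond.
rewrite [X in _ + X]big1 ?addr0 => [|i /andP[/andP[ni _] _]]; last first.
  by rewrite xn// !scaler0.
by apply: eq_big_nat => i /andP[_ ni]; rewrite /upto ni scalerA mulrAC rr mul1r.
Qed.

(** The vector is rotated so that the value of the functional is real. *)
Lemma approx_norming (l : dual X) (e : R) : 0 < e -> exists x : X,
  nrm x <= 1 /\ exists2 r : R, l x = ofR k r & nrm l - e <= r.
Proof.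
move=> e0.
have [_ [x /= x1 <-] lx] : exists2 r, [set nrm (l x) | x in [set x : X | nrm x <= 1]] r &
    nrm l - e < r.
  by rewrite nrm_bop; apply: sup_adherent => //; exact: opnorm_has_sup.
have [th [th1 thl]] := phase (l x).
exists (th *: x); split.
  by rewrite nrmZ -[leRHS]mulr1 ler_pM ?nrm_ge0.
by exists (nrm (l x)); [rewrite linearZ|exact: ltW].
Qed.

(** Converse of the trace duality: the vectors [x i] are multiples, by a norming
    element of the ball of l_p, of vectors almost norming the functionals
    [T (z i)]. The C_p norm of the resulting sum is at most the weak norm of
    [z] ([tensor_sum_norm]). *)
Lemma summing_norm_le (T : COmega -> dual X) (C : R) : 0 <= C ->
  (forall n (z : nat -> COmega) (x : nat -> X),
    nrm (\sum_(0 <= i < n) T (z i) (x i)) <=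
    C * nrm (\sum_(0 <= i < n) tensor p1 (z i) (x i))) ->
  (summing_norm q T <= C%:E)%E.
Proof.
move=> C0 TC; case qs : q => [s||]; last by have := q1; rewrite qs.
  apply: ereal_inf_lbound; exists C => //; split=> // n z0.
  pose z (i : nat) : COmega := if insub i is Some j then z0 j else 0.
  have zE (i : 'I_n) : z i = z0 i by rewrite /z valK.
  have -> : z0 = fun i : 'I_n => z i by apply/funext => i; rewrite zE.
  have [W W0 WE] := weak_norm_fin n z qs.
  rewrite WE -EFinM lee_fin -(big_mkord xpredT (fun i => nrm (T (z i)) `^ s)).
  have [b [b0 bn b1 <-]] := conjugate_norming k n p1 qs (fun i => nrm_ge0 (T (z i))).
  pose S := \sum_(0 <= i < n) b i.
  have S0 : 0 <= S by rewrite sumr_ge0.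
  apply/ler_addgt0Pr => e e0.
  have d0 : 0 < e / 2 / (S + 1) by rewrite !divr_gt0// ltr_wpDl.
  have h0 : 0 < e / 2 / (C + 1) by rewrite !divr_gt0// ltr_wpDl.
  have [x xP] := choice (fun i => approx_norming (T (z i)) d0).
  have [r rP] := choice (fun i => let: conj _ (ex_intro2 r h1 h2) := xP i in ex_intro _ r (conj h1 h2)).
  have x1 i : nrm (x i) <= 1 by have [] := xP i.
  pose bx i := ofR k (b i) *: x i.
  have bx1 : (lp_norm p bx <= 1)%E.
    apply: (lp_mono p1 ler01 _ b1) => i.
    by rewrite /bx nrmZ ler_piMr ?nrm_ge0.
  have bxn i : (n <= i)%N -> bx i = 0 by move=> /bn bi; rewrite /bx bi ofR0 scale0r.
  have Wh : 0 < W + e / 2 / (C + 1) by rewrite ltr_wpDl.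
  have zW w : (lp_norm q (upto n (fun i => z i w)) <= (W + e / 2 / (C + 1))%:E)%E.
    apply: le_trans (_ : (W%:E <= _)%E); last by rewrite lee_fin lerDl ltW.
    by apply: (lp_norm_eval _ qs W0); rewrite WE.
  have := tensor_sum_norm Wh bx1 bxn zW.
  have := TC n z bx.
  have -> : \sum_(0 <= i < n) T (z i) (bx i) = ofR k (\sum_(0 <= i < n) b i * r i).
    rewrite (big_morph _ (@ofRD R k) (@ofR0 R k)); apply: eq_bigr => i _.
    by rewrite /bx linearZ /= (rP i).1 ofRM.
  rewrite nrm_ofR => k1 k2.
  have k3 : \sum_(0 <= i < n) b i * r i <= C * (W + e / 2 / (C + 1)).
    by rewrite (le_trans (ler_norm _))// (le_trans k1)// ler_wpM2l.
  have k4 : \sum_(0 <= i < n) b i * nrm (T (z i)) <=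
      \sum_(0 <= i < n) b i * r i + S * (e / 2 / (S + 1)).
    rewrite /S mulr_suml -big_split /=; apply: ler_sum => i _.
    by rewrite -mulrDr ler_wpM2l// -lerBlDr; exact: (rP i).2.
  rewrite (le_trans k4)// (le_trans (lerD k3 (lexx _)))//.
  have k5 : C * (e / 2 / (C + 1)) <= e / 2.
    rewrite mulrCA ler_piMr// ?divr_ge0 ?(ltW e0)//.
    by rewrite ler_pdivrMr ?mul1r ?lerDl// ltr_wpDl.
  have k6 : S * (e / 2 / (S + 1)) <= e / 2.
    rewrite mulrCA ler_piMr// ?divr_ge0 ?(ltW e0)//.
    by rewrite ler_pdivrMr ?mul1r ?lerDl// ltr_wpDl.
  by rewrite mulrDr -addrA lerD2l [leRHS]splitr lerD.
apply: ge_ereal_sup => _ [f /= f1 <-]; rewrite lee_fin.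
apply: bop_nrm_le => // x.
have := TC 1 (fun=> f) (fun=> x); rewrite !big_nat1 => h; rewrite (le_trans h)//.
rewrite ler_wpM2l// (le_trans (bop_nrm_bound (btensor X p1 f) x))//.
by rewrite ler_piMl ?nrm_ge0// (le_trans (nrm_btensor _ _ _)).
Qed.

Lemma summing_norm_ge0 (T : COmega -> dual X) : (0 <= summing_norm q T)%E.
Proof.
case qs : q => [s||]; last by have := q1; rewrite qs.
  by apply: le_ereal_inf_tmp => _ [C [C0 _] <-]; rewrite lee_fin.
apply: (@le_trans _ _ (nrm (T 0))%:E); first by rewrite lee_fin nrm_ge0.
by apply: ereal_sup_ubound; exists 0; rewrite //= nrm0 ler01.
Qed.

(** The infimum over the finite representations of G is replaced by the C_p norm:
    a covering sequence [y] of G serves as the second factor once G is sampled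
    at the nodes of a partition of unity. *)
Lemma tensor_functional_bound (T : bop COmega (dual X)) (C : R)
    (s : seq (COmega * X)) :
  (summing_norm q T <= C%:E)%E -> 0 <= C ->
  nrm (\sum_(u <- s) T u.1 u.2) <= C * nrm (\sum_(u <- s) tensor p1 u.1 u.2).
Proof.
move=> TC C0; set G := \sum_(u <- s) tensor p1 u.1 u.2.
have GE w : G w = \sum_(u <- s) u.1 w *: u.2 by rewrite cp_sumE.
have TZ a f : nrm (T (a *: f)) = nrm a * nrm (T f) by rewrite linearZ nrmZ.
apply/ler_addgt0Pr => e e0.
pose h := e / (2 * (C + 1)).
have h0 : 0 < h by rewrite divr_gt0// mulr_gt0// ltr_wpDl.
have nG : cp_norm p G < nrm G + h by rewrite nrm_cp ltrDl.
have [y [ly Gy yA]] := cp_norm_lt (cp_valP G) nG.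
have A0 : 0 < nrm G + h by rewrite ltr_wpDl ?nrm_ge0.
have [a aP] := choice (fun w => let: ex_intro2 a h1 h2 := Gy w in ex_intro _ a (conj h1 h2)).
pose d c w := \sum_(u <- s) nrm (u.1 w - u.1 c).
have cd c : continuous (d c).
  apply: real_continuous_sum => u w.
  apply: (@continuous_comp _ _ _ (fun w => u.1 w - u.1 c) (@nrm R k K)).
    by apply: cvgB; [exact: cfun_continuous|exact: cvg_cst].
  exact: nrm_continuous.
pose D := nrm T * \sum_(u <- s) nrm u.2 + 1.
have D0 : 0 < D.
  by rewrite ltr_wpDl// mulr_ge0 ?nrm_ge0// sumr_ge0// => i _; exact: nrm_ge0.
have eta0 : 0 < e / (2 * D) by rewrite divr_gt0// mulr_gt0.
have [|n [c [t [ct t0 t1 td]]]] := partition_of_unity Ocpt cd _ eta0.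
  by move=> w; rewrite /d big1// => u _; rewrite subrr nrm0.
pose psi i : COmega := Cfun Ocpt (ofR_cfun k (ct i)).
(* The pairing of the sampled function sum_i psi_i G(c_i). *)
pose L' := \sum_i T (psi i) (G (c i)).
have L'C : nrm L' <= C * (nrm G + h).
  pose g j : COmega := \sum_(i < n) a (c i) j *: psi i.
  have gE j w : g j w = \sum_(i < n) ofR k (t i w) * a (c i) j.
    by rewrite /g cfun_sumE; apply: eq_bigr => i _; rewrite [RHS]mulrC.
  have cvL : (fun m => \sum_(0 <= j < m) T (g j) (y j)) @ \oo --> L'.
    rewrite (_ : (fun m => _) =
        fun m => \sum_(i < n) T (psi i) (series (fun j => a (c i) j *: y j) m)).
      rewrite /L'; elim: (index_enum 'I_n) => [|i l ih].
        under eq_fun do rewrite big_nil; rewrite big_nil; exact: cvg_cst.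
      under eq_fun do rewrite big_cons; rewrite big_cons.
      apply: cvgD => //.
      exact: (cvg_comp _ _ (aP (c i)).2 (@bop_continuous _ _ _ _ (T (psi i)) _)).
    apply/funext => m; rewrite /series /=.
    under [RHS]eq_bigr do rewrite linear_sum.
    rewrite [RHS]exchange_big /=; apply: eq_bigr => j _.
    rewrite /g linear_sum /=.
    by rewrite bop_sumE; apply: eq_bigr => i _; rewrite !linearZ.
  apply: (nrm_cvg _ cvL); apply: nearW => m.
  have := @summing_pairing T C (nrm G + h) 1 m g y TC C0 A0 ltr01 TZ yA.
  rewrite mulr1; apply => w; apply: lp_upto => //.
  rewrite (_ : (fun i => g i w) = fun j => \sum_(i < n) ofR k (t i w) * a (c i) j).
    by apply: (lp_norm_conv_coef p1) => // i; exact: (aP (c i)).1.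
  by apply/funext => j; rewrite gE.
have LL' : nrm (\sum_(u <- s) T u.1 u.2 - L') <= e / 2.
  pose phi (u : COmega * X) : COmega := \sum_(i < n) u.1 (c i) *: psi i.
  have -> : L' = \sum_(u <- s) T (phi u) u.2.
    rewrite /L'; under eq_bigr do rewrite GE linear_sum.
    rewrite exchange_big /=; apply: eq_bigr => u _.
    rewrite /phi linear_sum.
    by rewrite bop_sumE; apply: eq_bigr => i _; rewrite !linearZ.
  rewrite -sumrB (le_trans (nrm_sum _ _ _))//.
  have ub (u : COmega * X) : u \in s -> nrm (T u.1 u.2 - T (phi u) u.2) <= nrm T * (e / (2 * D)) * nrm u.2.
    move=> us; have -> : T u.1 u.2 - T (phi u) u.2 = T (u.1 - phi u) u.2 by rewrite linearB.
    rewrite (le_trans (bop_nrm_bound _ _))// ler_wpM2r ?nrm_ge0//.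
    rewrite (le_trans (bop_nrm_bound _ _))// ler_wpM2l ?nrm_ge0//.
    apply: cfun_nrm_le; first exact: ltW.
    move=> w; rewrite [X in nrm X](_ : _ = \sum_(i < n) ofR k (t i w) * (u.1 w - u.1 (c i))).
      rewrite (le_trans (nrm_sum _ _ _))//.
      rewrite -[leRHS]mul1r -{1}(t1 w) mulr_suml; apply: ler_sum => i _.
      rewrite nrmM nrm_ofR ger0_norm//.
      have [->|ti] := eqVneq (t i w) 0; first by rewrite !mul0r.
      rewrite ler_wpM2l// (le_trans _ (ltW (td i w ti)))// /d.
      elim: (s) us => // v l ih; rewrite in_cons big_cons => /predU1P[<-|/ih ul].
        by rewrite lerDl sumr_ge0// => *; exact: nrm_ge0.
      by rewrite (le_trans ul)// lerDr nrm_ge0.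
    rewrite [LHS](_ : _ = u.1 w - phi u w)// /phi cfun_sumE -[in LHS](mul1r (u.1 w)).
    rewrite -(ofR1 R k) -(t1 w) (big_morph _ (@ofRD R k) (@ofR0 R k)) mulr_suml -sumrB.
    by apply: eq_bigr => i _; rewrite mulrBr [X in _ - X]mulrC.
  rewrite big_seq (le_trans (ler_sum _ (fun u us => ub u us)))// -big_seq -mulr_sumr.
  have -> : e / 2 = (nrm T * (e / (2 * D)) * \sum_(u <- s) nrm u.2) + e / (2 * D).
    rewrite mulrAC; move: D0 => /gt_eqF; rewrite /D; set S := nrm T * _ => Dn.
    by field; rewrite Dn.
  by rewrite lerDl ltW.
rewrite -[X in nrm X](subrK L') (le_trans (nrmD _ _))//.
rewrite (le_trans (lerD LL' L'C))// mulrDr addrCA lerD2l.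
have : C * h <= e / 2.
  rewrite /h; have -> : e / 2 = (C + 1) * (e / (2 * (C + 1))).
    by field; rewrite gt_eqF// ltr_wpDl.
  by rewrite ler_wpM2r ?lerDl// ltW.
by move=> ?; rewrite [leRHS]splitr lerD2l.
Qed.

End SummingOperators.

(** * The integration operator *)

Section IntegrationOperator.
Variables (R : realType) (k : scalar_kind).
Notation K := (scalar_field R k).

Lemma postcomp_subproof (V W Z : normedModType K) (g : bop W Z) :
  (fun f : bop V W => bcomp g f) \in @bop_pred R k (bop V W) (bop V Z).
Proof.
apply: (@linear_bounded_bop _ _ _ _ _ (nrm g)).
  by move=> a f h; apply: bopP => v; exact: (linearP g).
move=> f; apply: bop_nrm_le; first by rewrite mulr_ge0 ?nrm_ge0.
move=> v; rewrite (le_trans (bop_nrm_bound g (f v)))// -mulrA.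
by rewrite ler_wpM2l ?nrm_ge0// bop_nrm_bound.
Qed.

Definition postcomp (V W Z : normedModType K) (g : bop W Z) :
  bop (bop V W) (bop V Z) := Bop (@postcomp_subproof V W Z g).

Variables (Omega : topologicalType) (Ocpt : compact [set: Omega]).
Notation COmega := (cfun_of R k Ocpt).
Variables (X Y : normedModType K).
Variable m : set Omega -> bop X (bidual Y).
Hypothesis bm : bounded_vector_measure m.

Let cB : nrm_complete (bidual Y).
Proof. by apply: bop_nrm_complete; exact: scalar_complete. Qed.

Let cL : nrm_complete (bop X (bidual Y)).
Proof. exact: bop_nrm_complete. Qed.

Let cX : nrm_complete (dual X).
Proof. by apply: bop_nrm_complete; exact: scalar_complete. Qed.

Lemma cfun_borel_limit (phi : COmega) : borel_limit phi.
Proof. exact: (continuous_borel_limit Ocpt (@cfun_continuous R k Omega Ocpt phi)). Qed.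

Lemma integral_op_exists : exists J : bop COmega (bop X (bidual Y)),
  forall phi, J phi = vintegral m phi.
Proof.
have [M M0 mM] := measure_bound bm.
have lin : linear (fun phi : COmega => vintegral m phi).
  by move=> a f g; exact: (vintegral_lin cL bm a (cfun_borel_limit f) (cfun_borel_limit g)).
have bnd (phi : COmega) : nrm (vintegral m phi) <= (4 * M) * nrm phi.
  apply: (vintegral_bound cL bm mM (nrm_ge0 _) (cfun_borel_limit phi)).
  exact: cfun_nrm_ge.
by exists (Bop (linear_bounded_bop lin bnd)).
Qed.

Lemma scalarized_op_exists (ystar : dual Y) : exists T : bop COmega (dual X),
  (T : COmega -> dual X) = scalarized_integral m ystar /\
  forall phi x, T phi x = vintegral m phi x ystar.
Proof.
have [J JE] := integral_op_exists.
exists (bcomp (postcomp X (to_bidual ystar)) J); split.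
  apply/funext => phi; rewrite /scalarized_integral.
  have [_ h] := vintegral_bop (postcomp X (to_bidual ystar)) cL cX bm
    (cfun_borel_limit phi).
  rewrite [RHS](_ : _ = vintegral (fun A => postcomp X (to_bidual ystar) (m A)) phi)//.
  by rewrite h -JE.
by move=> phi x; rewrite -JE.
Qed.

Lemma vintegral_point (phi : COmega) (x : X) (ystar : dual Y) :
  vintegral (fun E => m E x ystar) phi = vintegral m phi x ystar.
Proof.
pose T := bcomp (to_bidual ystar : bop (bidual Y) K) (@beval R k X (bidual Y) x).
by have [_ h] := vintegral_bop T cL (@scalar_complete R k) bm (cfun_borel_limit phi).
Qed.

Variables (p : \bar R) (p1 : (1 <= p)%E).
Notation cp := (cp_of Omega X p1).
Notation q := (hoelder_conjugate p).
Notation rep := (seq (COmega * X)).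

(** Elements of the algebraic tensor product of C(Omega) and X are handled as
    lists of pairs, so the integral is a function of the list and not yet of the
    element of C_p that it represents. *)
Definition rep_fun (s : rep) : cp := \sum_(u <- s) tensor p1 u.1 u.2.
Definition rep_integral (s : rep) : bidual Y := \sum_(u <- s) vintegral m u.1 u.2.

Lemma rep_comb (a : K) (s t : rep) : exists u : rep,
  rep_fun u = a *: rep_fun s + rep_fun t /\
  rep_integral u = a *: rep_integral s + rep_integral t.
Proof.
exists ([seq (v.1, a *: v.2) | v <- s] ++ t).
split; rewrite /rep_fun /rep_integral big_cat big_map /= scaler_sumr; congr (_ + _);
  apply: eq_bigr => v _.
  apply: cpP => w; change (v.1 w *: (a *: v.2) = a *: (v.1 w *: v.2)).
  by rewrite !scalerA mulrC.
by rewrite linearZ.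
Qed.

Lemma rep_dense (F : cp) (e : R) : 0 < e -> exists s : rep, nrm (F - rep_fun s) <= e.
Proof.
move=> e0; have [n [psi [c h]]] := cp_approx Ocpt F e0.
exists [seq (psi i, F (c i)) | i <- index_enum 'I_n].
by rewrite /rep_fun big_map.
Qed.

Lemma rep_integral_bound (S : R) (s : rep) : 0 <= S ->
  (semivariation Ocpt m q <= S%:E)%E ->
  nrm (rep_integral s) <= S * nrm (rep_fun s).
Proof.
move=> S0 mS; apply: bop_nrm_le_ball => ystar y1.
have [T [TE Tx]] := scalarized_op_exists ystar.
have TS : (summing_norm q T <= S%:E)%E.
  by apply: le_trans mS; apply: ereal_sup_ubound; exists ystar => //; rewrite TE.
have := tensor_functional_bound p1 s TS S0; apply: le_trans.
rewrite /rep_integral bop_sumE le_eqVlt; apply/orP; left; apply/eqP.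
by congr nrm; apply: eq_bigr => u _; rewrite Tx.
Qed.

Lemma semivariation_ge0 : (0 <= semivariation Ocpt m q)%E.
Proof.
apply: (@le_trans _ _ (summing_norm q (scalarized_integral (Ocpt := Ocpt) m (0 : dual Y)))).
  exact: summing_norm_ge0.
by apply: ereal_sup_ubound; exists 0; rewrite //= nrm0 ler01.
Qed.

Lemma tensor_agree (W : normedModType K) (U V : bop cp W) :
  (forall (phi : COmega) x, U (tensor p1 phi x) = V (tensor p1 phi x)) -> U = V.
Proof.
move=> UV; apply: bopP => F; apply/eqP; rewrite -subr_eq0; apply/eqP.
have [D DE] : exists D : bop cp W, forall G, D G = U G - V G by exists (U - V).
rewrite -DE; apply: (@nrm_small0 R k) => e e0.
have d0 : 0 < e / (nrm D + 1) by rewrite divr_gt0// ltr_wpDl ?nrm_ge0.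
have [s sF] := rep_dense F d0.
have Ds : D (rep_fun s) = 0.
  rewrite /rep_fun linear_sum big1// => u _.
  by transitivity (D (tensor p1 u.1 u.2)); rewrite // DE UV subrr.
have -> : D F = D (F - rep_fun s).
  transitivity (D F - D (rep_fun s)); first by rewrite Ds subr0.
  exact/esym/linearB.
rewrite (le_trans (bop_nrm_bound _ _))// (le_trans (ler_wpM2l (nrm_ge0 _) sF))//.
rewrite mulrCA ler_piMr ?(ltW e0)//.
by rewrite ler_pdivrMr ?mul1r ?lerDl// ltr_wpDl ?nrm_ge0.
Qed.

Lemma semivariation_le_norm (U : bop cp (bidual Y)) :
  (forall (phi : COmega) x, U (tensor p1 phi x) = vintegral m phi x) ->
  (semivariation Ocpt m q <= (nrm U)%:E)%E.
Proof.
move=> UE; apply: ge_ereal_sup => _ [ystar /= y1 <-].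
have [T [<- Tx]] := scalarized_op_exists ystar.
apply: (summing_norm_le (p1 := p1)); first exact: nrm_ge0.
move=> n z x.
have -> : \sum_(0 <= i < n) T (z i) (x i) =
    U (\sum_(0 <= i < n) tensor p1 (z i) (x i)) ystar.
  rewrite (linear_sum U) bop_sumE; apply: eq_bigr => i _.
  by rewrite Tx -UE.
rewrite (le_trans (bop_nrm_bound _ _))// -[leRHS]mulr1.
by rewrite ler_pM ?nrm_ge0 ?bop_nrm_bound.
Qed.

End IntegrationOperator.

Section RangeInY.
Variables (R : realType) (k : scalar_kind).
Notation K := (scalar_field R k).
Variables (Y : completeNormedModType K).

(** The image of a Banach space in its bidual is complete, hence closed. *)
Lemma to_bidual_range_approx (S : set (bidual Y)) (w : bidual Y) :
  (forall s, S s -> exists y : Y, s = to_bidual y) ->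
  (forall e : R, 0 < e -> exists2 s, S s & nrm (w - s) <= e) ->
  exists y : Y, w = to_bidual y.
Proof.
move=> SY wS.
have [s sP] : exists s : nat -> Y, forall n, nrm (w - to_bidual (s n)) <= n.+1%:R^-1.
  have h n : exists y : Y, nrm (w - to_bidual y) <= n.+1%:R^-1.
    have [|s Ss ws] := wS n.+1%:R^-1; first by rewrite invr_gt0.
    by have [y ys] := SY _ Ss; exists y; rewrite -ys.
  by have [s sP] := choice h; exists s.
apply: (@to_bidual_range_closed R k Y s); apply/cvg_nrmP => e e0.
have [N _ NP] := near_infty_natSinv_lt (PosNum e0).
by exists N => // n /NP /= h; rewrite (le_lt_trans (sP n)).
Qed.

(** Linearity uses that the embedding is injective, boundedness that it is
    isometric. *)
Lemma codomain_restriction (V : normedModType K) (U : bop V (bidual Y)) :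
  (forall f, exists y : Y, U f = to_bidual y) ->
  exists U0 : bop V Y, forall f, to_bidual (U0 f) = U f.
Proof.
move=> /choice[u uP].
have lin : linear u.
  move=> a x y; apply: to_bidual_inj.
  by rewrite to_bidual_lin -!uP linearP.
have bnd x : nrm (u x) <= nrm U * nrm x.
  by have := bop_nrm_bound U x; rewrite uP nrm_to_bidual.
by exists (Bop (linear_bounded_bop lin bnd)) => f; rewrite -uP.
Qed.

End RangeInY.

Section IntegralInY.
Variables (R : realType) (k : scalar_kind).
Notation K := (scalar_field R k).
Variables (X : normedModType K) (Y : completeNormedModType K).
Variables (Omega : topologicalType) (Ocpt : compact [set: Omega]).

Lemma vintegral_in_range (m : set Omega -> bop X (bidual Y))
    (phi : cfun_of R k Ocpt) (x : X) : bounded_vector_measure m ->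
  (forall E, borel E -> exists T : bop X Y, forall x, m E x = to_bidual (T x)) ->
  exists y : Y, vintegral m phi x = to_bidual y.
Proof.
move=> bm mY.
have cY : nrm_complete (bidual Y) by apply: bop_nrm_complete; exact: scalar_complete.
have cL : nrm_complete (bop X (bidual Y)) by exact: bop_nrm_complete.
have [s sphi] := cfun_borel_limit phi.
have := vintegral_cvg cL bm sphi => /cvg_nrmP h.
apply: (@to_bidual_range_approx R k Y [set simple_integral m (s n) x | n in [set: nat]]).
  move=> _ [n _ <-]; rewrite /simple_integral bop_sumE.
  have [T TP] := choice (fun i => mY _ (simple_borel (b := s n) i)).
  exists (\sum_i simple_coef (b := s n) i *: T i x).
  elim/big_rec2: _ => [|i y z _ ->].
    by apply: bopP => l; rewrite /= linear0.
  by rewrite to_bidual_lin -TP.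
move=> e e0; have e1 : 0 < e / (nrm x + 1) by rewrite divr_gt0// ltr_wpDl ?nrm_ge0.
have [N _ NP] := h _ e1; exists (simple_integral m (s N) x); first by exists N.
have -> : vintegral m phi x - simple_integral m (s N) x =
  (vintegral m phi - simple_integral m (s N)) x by [].
rewrite (le_trans (bop_nrm_bound _ _))//.
rewrite (le_trans (ler_wpM2r (nrm_ge0 _) (ltW (NP N (leqnn N)))))//.
rewrite mulrAC ler_pdivrMr ?ltr_wpDl ?nrm_ge0//.
by rewrite ler_wpM2l ?lerDl// ltW.
Qed.

End IntegralInY.

Theorem theorem3p4 (R : realType) (k : scalar_kind)
    (X Y : completeNormedModType (scalar_field R k))
    (Omega : topologicalType) (Ocpt : compact [set: Omega])
    (Ohaus : hausdorff_space Omega)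
    (p : \bar R) (p1 : (1 <= p)%E)
    (m : set Omega -> bop X (bidual Y))
    (hm : bounded_semivariation Ocpt m (hoelder_conjugate p)) :
  exists U : bop (cp_of Omega X p1) (bidual Y),
    [/\ (forall (phi : cfun_of R k Ocpt) (x : X),
           U (tensor p1 phi x) = vintegral m phi x),
        (forall V : bop (cp_of Omega X p1) (bidual Y),
           (forall (phi : cfun_of R k Ocpt) (x : X),
              V (tensor p1 phi x) = vintegral m phi x) -> V = U),
        (nrm U)%:E = semivariation Ocpt m (hoelder_conjugate p) &
        (forall ystar : dual Y,
           cp_dual_op Ocpt (adjoint U (to_bidual ystar)) =
           scalarized_integral m ystar :> (cfun_of R k Ocpt -> dual X))] /\
    ((forall E, borel E ->
        exists T : bop X Y, forall x, m E x = to_bidual (T x)) ->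
     forall f, exists y : Y, U f = to_bidual y) /\
    ((forall f, exists y : Y, U f = to_bidual y) ->
     exists U0 : bop (cp_of Omega X p1) Y,
       (forall f, to_bidual (U0 f) = U f) /\
       (forall x : X,
          (forall ystar : dual Y, regular_measure (fun E => m E x ystar)) ->
          forall E, borel E ->
            biadjoint U0 (chi_tensor Ocpt E x) = m E x :> (dual Y -> scalar_field R k))).
Proof.
have [bm mfin] := hm; set q := hoelder_conjugate p in mfin *.
have sv0 : (0 <= semivariation Ocpt m q)%E by exact: (semivariation_ge0 Ocpt m p1).
pose S := fine (semivariation Ocpt m q).
have SE : S%:E = semivariation Ocpt m q by rewrite fineK// ge0_fin_numE.
have S0 : 0 <= S by exact: fine_ge0.
have cY : nrm_complete (bidual Y) by apply: bop_nrm_complete; exact: scalar_complete.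
have [U [UL US]] := dense_extension cY S0 (rep_comb (Ocpt := Ocpt) m p1)
  (fun s => rep_integral_bound bm p1 s S0 (eq_ind _ (fun z => (z <= S%:E)%E) (lexx _) _ SE))
  (rep_dense Ocpt (p1 := p1)).
have UE (phi : cfun_of R k Ocpt) x : U (tensor p1 phi x) = vintegral m phi x.
  by have := UL [:: (phi, x)]; rewrite /rep_fun /rep_integral !big_seq1.
exists U; split; [split => //|split].
- by move=> V VE; apply: (tensor_agree (Ocpt := Ocpt)) => phi x; rewrite VE UE.
- apply/eqP; rewrite eq_le; apply/andP; split; first by rewrite -SE lee_fin.
  exact: semivariation_le_norm.
- move=> ystar; have [T [<- Tx]] := scalarized_op_exists Ocpt bm ystar.
  apply/funext => phi; apply: bopP => x.
  by rewrite Tx -UE.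
- move=> mY f.
  apply: (@to_bidual_range_approx R k Y (range (rep_integral m))).
    move=> _ [s _ <-]; rewrite /rep_integral.
    elim: s => [|u s [y yE]].
      by exists 0; rewrite big_nil; apply: bopP => l; rewrite /= linear0.
    have [z zE] := vintegral_in_range u.1 u.2 bm mY; exists (1 *: z + y).
    by rewrite big_cons to_bidual_lin scale1r yE zE.
  move=> e e0; have e1 : 0 < e / (nrm U + 1) by rewrite divr_gt0// ltr_wpDl ?nrm_ge0.
  have [s sf] := rep_dense Ocpt f e1; exists (rep_integral m s); first by exists s.
  rewrite -UL -(linearB U) (le_trans (bop_nrm_bound _ _))//.
  rewrite (le_trans (ler_wpM2l (nrm_ge0 _) sf))// mulrCA ler_piMr ?(ltW e0)//.
  by rewrite ler_pdivrMr ?mul1r ?lerDl// ltr_wpDl ?nrm_ge0.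
- move=> UY; have [U0 U0E] := codomain_restriction UY.
  exists U0; split=> // x mreg E bE; apply/funext => ystar.
  rewrite /biadjoint /= /chi_tensor /riesz_measure.
  set l := adjoint _ _; set A := [set mu | _].
  (* The functional attached to x and y^* is represented by <y^*, m(.) x>. *)
  have lE (phi : cfun_of R k Ocpt) : l phi = vintegral (fun E => m E x ystar) phi.
    by rewrite vintegral_point// -UE -U0E.
  have Am : A (fun E => m E x ystar) by split=> [|phi]; [exact: mreg|exact: lE].
  have [nreg nE] : A (xget (fun=> 0) A) by exact: (xgetPex _ (ex_intro _ _ Am)).
  have agree (phi : cfun_of R k Ocpt) :
      vintegral (xget (fun=> 0) A) phi = vintegral (fun E => m E x ystar) phi.
    by rewrite -nE lE.
  exact: (regular_measure_unique Ohaus nreg (mreg ystar) agree bE).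
Qed.
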